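(* Let $k$ be a field, $R=k[x_1,\dots,x_d]$ a standard graded polynomial ring, and $I=(\alpha_1,\dots,\alpha_m)\subset R$ a perfect ideal of height $2$ such that, with respect to $\alpha_1,\dots,\alpha_m$, $I$ has a Hilbert–Burch matrix $\varphi=[v_1|\cdots|v_{m-1}]$ with $v_i\in(R_1)^m$ for $1\le i\le m-2$ and $v_{m-1}\in(R_n)^m$ for some $n\ge1$. Assume $I$ satisfies $G_d$ and $\mu(I)=m=d+1$. Then \[\mathcal A=\mathcal L+I_d(B_n(\varphi))=\mathcal L:(x_1,\dots,x_d)^n,\] and the special fiber ring satisfies $\mathcal F(I)\cong k[T_1,\dots,T_{d+1}]/(f)$ for a form $f$ with $\deg f=n(d-1)+1$.
   Context: $G_d$: $\mu(I_P)\le\operatorname{ht}P$ for all primes $P\supseteq I$ with $\operatorname{ht}P<d$. $S=R[T_1,\dots,T_m]$, bigraded by $\deg x_i=(1,0)$, $\deg T_j=(0,1)$; $\mathcal A=\ker(S\to R[It],\ T_j\mapsto\alpha_jt)$, the defining ideal of the Rees algebra $\mathcal R(I)$; $\mathcal F(I)=\mathcal R(I)/(x_1,\dots,x_d)\mathcal R(I)$. Write $[T_1\cdots T_m]\cdot\varphi=[L_1\cdots L_{m-2}\ g]$, $\mathcal L=(L_1,\dots,L_{m-2},g)$. Iterated Jacobian duals with respect to $x_1,\dots,x_d$: $B_1(\varphi)$ is a $d\times(m-1)$ matrix with bihomogeneous entries of constant bidegree along each column such that $[x_1\cdots x_d]\cdot B_1(\varphi)=[T_1\cdots T_m]\cdot\varphi$;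 inductively, with $\mathcal L_{i-1}$ the ideal of entries of $[x_1\cdots x_d]\cdot B_{i-1}(\varphi)$, choose bihomogeneous $u_1,\dots,u_l$ with $\mathcal L_{i-1}+(I_d(B_{i-1}(\varphi))\cap(x_1,\dots,x_d))=\mathcal L_{i-1}+(u_1,\dots,u_l)$ and a matrix $C$ with bihomogeneous entries of constant bidegree along columns with $[u_1\cdots u_l]=[x_1\cdots x_d]\cdot C$, and set $B_i(\varphi)=[B_{i-1}(\varphi)|C]$. $I_d$ denotes the ideal of $d\times d$ minors. *)

(* Defs.v *)
From HB Require Import structures.
From mathcomp Require Import all_boot all_order all_algebra.
From mathcomp Require Import mpoly.
Set Implicit Arguments.
Unset Strict Implicit.
Unset Printing Implicit Defensive.
Import Order.TTheory GRing.Theory.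
Local Open Scope ring_scope.

Section Ideals.
Variable A : comNzRingType.

Definition ideal_span (G : A -> Prop) (p : A) : Prop :=
  exists s : seq (A * A), (forall q, q \in s -> G q.2) /\
                          p = \sum_(q <- s) q.1 * q.2.

Definition ideal_gen (r : nat) (g : 'I_r -> A) : A -> Prop :=
  ideal_span (fun q => exists i, q = g i).

Definition subI (P Q : A -> Prop) := forall a, P a -> Q a.
Definition eqI (P Q : A -> Prop) := forall a, P a <-> Q a.
Definition plusI (P Q : A -> Prop) : A -> Prop := ideal_span (fun q => P q \/ Q q).
Definition capI (P Q : A -> Prop) : A -> Prop := fun q => P q /\ Q q.
Definition colonI (L J : A -> Prop) : A -> Prop := fun p => forall q, J q -> L (p * q).

Definition is_ideal (P : A -> Prop) :=
  P 0 /\ (forall a b, P a -> P b -> P (a + b)) /\ (forall r a, P a -> P (r * a)).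
Definition prime_ideal (P : A -> Prop) :=
  is_ideal P /\ ~ P 1 /\ (forall a b, P (a * b) -> P a \/ P b).

Definition ht_ge (P : A -> Prop) (h : nat) :=
  exists Q : nat -> A -> Prop,
    (forall i, (i <= h)%N -> prime_ideal (Q i)) /\
    (forall i, (i < h)%N -> subI (Q i) (Q i.+1) /\ ~ subI (Q i.+1) (Q i)) /\
    eqI (Q h) P.
Definition height_eq (P : A -> Prop) (h : nat) := ht_ge P h /\ ~ ht_ge P h.+1.
Definition ideal_height_eq (I : A -> Prop) (h : nat) :=
  (exists P, prime_ideal P /\ subI I P /\ height_eq P h) /\
  (forall P, prime_ideal P -> subI I P -> ht_ge P h).

Definition mu_eq (I : A -> Prop) (r : nat) :=
  (exists g : 'I_r -> A, eqI (ideal_gen g) I) /\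
  (forall r' (g : 'I_r' -> A), eqI (ideal_gen g) I -> (r <= r')%N).

(* mu(I_P) <= r, localization written out: I_P is generated by r elements
   g_i of I (denominators cleared), i.e. s I \subset (g) for some s \notin P *)
Definition mu_loc_le (I P : A -> Prop) (r : nat) :=
  exists g : 'I_r -> A, (forall i, I (g i)) /\
    exists s, ~ P s /\ forall a, I a -> ideal_gen g (s * a).

Definition G_cond (I : A -> Prop) (dd : nat) :=
  forall P h, prime_ideal P -> subI I P -> height_eq P h -> (h < dd)%N ->
    mu_loc_le I P h.
End Ideals.

(* homogeneous of degree e for the standard grading (0 is homogeneous of all degrees) *)
Definition homog_of (k : fieldType) (N : nat) (e : nat) (p : {mpoly k[N]}) :=
  forall mm, mm \in msupp p -> mdeg mm = e.

Section Rings.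
Variables (k : fieldType) (d : nat).
Definition Rr := {mpoly k[d]}.
Definition Sr := {mpoly k[d + d.+1]}.
Definition xS (i : 'I_d) : Sr := 'X_(lshift d.+1 i).
Definition TS (j : 'I_d.+1) : Sr := 'X_(rshift d j).
Definition RtoS (p : Rr) : Sr := p \mPo [tuple xS i | i < d].
Definition TtoS (q : {mpoly k[d.+1]}) : Sr := q \mPo [tuple TS j | j < d.+1].

Definition xdeg (mm : 'X_{1..d + d.+1}) : nat := (\sum_(i < d) mm (lshift d.+1 i))%N.
Definition Tdeg (mm : 'X_{1..d + d.+1}) : nat := (\sum_(j < d.+1) mm (rshift d j))%N.
Definition bihom (a b : nat) (p : Sr) :=
  forall mm, mm \in msupp p -> xdeg mm = a /\ Tdeg mm = b.

(* R[t] is realized as k[x_1..x_d,t] = {mpoly k[d.+1]}, t = 'X_ord_max *)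
Definition RtoRt (p : Rr) : {mpoly k[d.+1]} :=
  p \mPo [tuple 'X_(widen_ord (leqnSn d) i) | i < d].
Definition rees_images (alpha : 'rV[Rr]_(d.+1)) (i : 'I_(d + d.+1)) : {mpoly k[d.+1]} :=
  match split i with
  | inl a => 'X_(widen_ord (leqnSn d) a)
  | inr j => RtoRt (alpha 0 j) * 'X_ord_max
  end.
Definition rees_ideal (alpha : 'rV[Rr]_(d.+1)) : Sr -> Prop :=
  fun F => F \mPo [tuple rees_images alpha i | i < d + d.+1] = 0.

Definition xideal : Sr -> Prop := ideal_gen xS.
Definition xpow (n : nat) : Sr -> Prop :=
  ideal_span (fun q => exists f : 'I_n -> 'I_d, q = \prod_(l < n) xS (f l)).

Definition Tphi (phi : 'M[Rr]_(d.+1, d)) (j : 'I_d) : Sr :=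
  \sum_(i < d.+1) TS i * RtoS (phi i j).
Definition Lideal (phi : 'M[Rr]_(d.+1, d)) : Sr -> Prop := ideal_gen (Tphi phi).

(* a d x c matrix over S is given by B : 'I_d -> nat -> S (only columns < c matter) *)
Definition minors_ideal (c : nat) (B : 'I_d -> nat -> Sr) : Sr -> Prop :=
  ideal_span (fun q => exists f : 'I_d -> nat, injective f /\ (forall s, (f s < c)%N) /\
                       q = \det (\matrix_(r, s) B r (f s))).
Definition xB (B : 'I_d -> nat -> Sr) (j : nat) : Sr := \sum_(r < d) xS r * B r j.
Definition Lcols (c : nat) (B : 'I_d -> nat -> Sr) : Sr -> Prop :=
  ideal_span (fun q => exists j, (j < c)%N /\ q = xB B j).
Definition Lnew (c1 c2 : nat) (B : 'I_d -> nat -> Sr) : Sr -> Prop :=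
  ideal_span (fun q => exists j, (c1 <= j < c2)%N /\ q = xB B j).

(* Iterated Jacobian duals B_1(phi), ..., B_N(phi) w.r.t. x_1..x_d.
   Since B_i = [B_{i-1} | C], all B_i are the first c i columns of a single
   family of columns B; c i is the number of columns of B_i. *)
Definition jacobian_duals (phi : 'M[Rr]_(d.+1, d)) (N : nat)
    (c : nat -> nat) (B : 'I_d -> nat -> Sr) :=
  c 1%N = d /\
  (forall j : 'I_d, xB B j = Tphi phi j) /\
  (forall j, (j < c N)%N -> exists a b, forall r, bihom a b (B r j)) /\
  (forall i, (2 <= i <= N)%N ->
     (c i.-1 <= c i)%N /\
     (forall j, (c i.-1 <= j < c i)%N -> exists a b, bihom a b (xB B j)) /\
     eqI (plusI (Lcols (c i.-1) B)
                (capI (minors_ideal (c i.-1) B) xideal))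
         (plusI (Lcols (c i.-1) B) (Lnew (c i.-1) (c i) B))).
End Rings.

(* Main.v *)
Require Import Defs.
From HB Require Import structures.
From mathcomp Require Import all_boot all_order all_algebra.
From mathcomp Require Import ring zify.
From mathcomp Require Import perm mpoly.
From mathcomp Require boolp classical_sets.
Set Implicit Arguments.
Unset Strict Implicit.
Unset Printing Implicit Defensive.
Import Order.TTheory GRing.Theory.
Local Open Scope ring_scope.

(** Let [L_1, ..., L_d] be the entries of [T phi], the last one of x-degree [n],
    and let [L'] be generated by the others.

    For a set [C] of columns with [r F] in [(L_c, c in C)] but [F] outside, take
    a maximal set [Z] of variables such that the annihilator of [F] contains no
    nonzero polynomial in [Z], and a prime over it with the same property.
    Condition [G_d] bounds from below the rank of [phi] modulo this prime;
    eliminating as many T-variables reduces [C] to fewer forms than there are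
    variables outside [Z], and Koszul cohomology on polynomials in these separate
    variables shows that [F] is in the ideal. The only exception is
    [Z] empty and [C] everything. Hence fewer than [d] of the [L_j] generate a
    prime ideal, and the Rees ideal [A] is the x-saturation of [(L_1, ..., L_d)].

    On the other side let [D] be the vector of maximal minors of the linear part
    of the Jacobian dual. Since [x_i D_j = x_j D_i] modulo [L'], the substitution
    [sigma : x -> D] has, on x-homogeneous elements, kernel [L']. The iterated
    connecting homomorphisms for the regular sequence [L] on the Koszul complex
    of [x] show that [(L)] is saturated in x-degrees at least [n], and that the
    left kernel of the linear part is generated by [D]. It follows that
    [sigma A] is contained in the multiples of [f = sigma L_d], so that in
    x-degree [a < n] the ideal [A] is generated modulo [L'] by any [f_a] with
    [sigma f_a = f]. Finally [f_(a-1) = sum_r D_r u_r] when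
    [f_a = sum_r x_r u_r]; if the [u_r] are chosen from the columns of an
    iterated Jacobian dual, this is one of its minors, and
    any other choice changes it by an element of [L']. *)

(** * Finitely generated ideals *)

(** Koszul complexes stand in for local cohomology, and multipliers outside a prime stand in for
    localisation. The cohomology of a regular sequence of s elements vanishes below degree s, and
    each regular form divided out costs one degree, so H^0 still vanishes for fewer than s forms.
    With Z empty and all columns the count can be d against d; but then the annihilator of F
    contains a nonzero polynomial in each single variable, and for x-homogeneous F its leading term
    already annihilates F. This is the origin of the saturation in x. For the sequence x itself the
    count is again d against d, and what survives is a residue in top degree. A connecting
    homomorphism adds 1 to the x-degree for the differential and subtracts the degree of the form:
    linear forms are neutral, the last one contributes 1 - n. From degree a one reaches a + 1 - n,
    which is positive exactly when a is at least n. The number n(d-1)+1 is the T-degree of a form of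
    bidegree (n,1) after x is replaced by minors of T-degree d-1. Heights enter through the
    inequality of ht P plus the number of parameters modulo P with d, proved by counting
    monomials. *)

Section ListIdeals.
Variable A : comNzRingType.
Implicit Types (a b g : A) (gs hs : seq A).

(** Recursive on the list of generators, so that an induction can divide out one generator at a
    time. *)
Fixpoint inI gs a : Prop :=
  if gs is g :: gs' then exists b, inI gs' (a - b * g) else a = 0.

Lemma inI0 gs : inI gs 0.
Proof. by elim: gs => //= g gs IH; exists 0; rewrite mul0r subr0. Qed.

Lemma inID gs a b : inI gs a -> inI gs b -> inI gs (a + b).
Proof.
elim: gs a b => [|g gs IH] a b /=; first by move=> -> ->; rewrite addr0.
move=> [u Hu] [v Hv]; exists (u + v).
have -> : a + b - (u + v) * g = (a - u * g) + (b - v * g) by ring.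
exact: IH.
Qed.

Lemma inIM gs a b : inI gs b -> inI gs (a * b).
Proof.
elim: gs a b => [|g gs IH] a b /=; first by move=> ->; rewrite mulr0.
move=> [u Hu]; exists (a * u).
have -> : a * b - a * u * g = a * (b - u * g) by ring.
exact: IH.
Qed.

Lemma inIMr gs a b : inI gs a -> inI gs (a * b).
Proof. by rewrite mulrC; exact: inIM. Qed.

Lemma inIN gs a : inI gs a -> inI gs (- a).
Proof. by rewrite -mulN1r; exact: inIM. Qed.

Lemma inIB gs a b : inI gs a -> inI gs b -> inI gs (a - b).
Proof. by move=> Ha Hb; apply: inID => //; apply: inIN. Qed.

Lemma inI_sum gs (I : Type) (r : seq I) (P : pred I) (F : I -> A) :
  (forall i, P i -> inI gs (F i)) -> inI gs (\sum_(i <- r | P i) F i).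
Proof. by move=> H; apply: (big_ind (inI gs)); [exact: inI0|exact: inID|]. Qed.

Lemma inI_cons g gs a : inI gs a -> inI (g :: gs) a.
Proof. by move=> H; exists 0; rewrite mul0r subr0. Qed.

Lemma mem_inI gs g : g \in gs -> inI gs g.
Proof.
elim: gs => //= h gs IH; rewrite inE => /orP [/eqP ->|/IH]; last exact: inI_cons.
by exists 1; rewrite mul1r subrr; exact: inI0.
Qed.

Lemma inI_sub gs hs a : (forall g, g \in gs -> inI hs g) -> inI gs a -> inI hs a.
Proof.
elim: gs a => [|g gs IH] a H /=; first by move=> ->; exact: inI0.
move=> [b /IH Hb]; rewrite -(subrK (b * g) a); apply: inID.
  by apply: Hb => x xgs; apply: H; rewrite inE xgs orbT.
by apply: inIM; apply: H; rewrite inE eqxx.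
Qed.

Lemma inI_subset gs hs a : {subset gs <= hs} -> inI gs a -> inI hs a.
Proof. by move=> H; apply: inI_sub => g /H /mem_inI. Qed.

Lemma inI_eq gs a b : inI gs (a - b) -> inI gs a <-> inI gs b.
Proof.
move=> H; split=> Hx; last by rewrite -(subrK b a); exact: inID.
have -> : b = a - (a - b) by rewrite subKr.
exact: inIB.
Qed.

Lemma inI_sumP (I : finType) (F : I -> A) (r : seq I) a :
  inI (map F r) a -> exists h : I -> A,
    (forall i, i \notin r -> h i = 0) /\ a = \sum_i h i * F i.
Proof.
elim: r a => [|j r IH] a /=.
  by move=> ->; exists (fun _ => 0); split=> //; rewrite big1 // => i _; rewrite mul0r.
move=> [b /IH [h [h0 Hh]]]; exists (fun i => h i + (i == j)%:R * b); split.
  move=> i; rewrite inE negb_or => /andP [/negPf -> /h0 ->].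
  by rewrite mul0r addr0.
under eq_bigr => i _ do rewrite mulrDl.
rewrite big_split /= -Hh (bigD1 j) //= eqxx mul1r big1 ?addr0 ?subrK //.
by move=> i /negPf ->; rewrite !mul0r.
Qed.

Lemma sum_inI (I : finType) (F : I -> A) (r : seq I) (h : I -> A) :
  (forall i, i \notin r -> h i = 0) -> inI (map F r) (\sum_i h i * F i).
Proof.
move=> h0; apply: inI_sum => i _; case: (boolP (i \in r)) => [ir|/h0 ->].
  by apply: inIM; apply: mem_inI; apply: map_f.
by rewrite mul0r; exact: inI0.
Qed.

Lemma span_ind (G P : A -> Prop) a :
  is_ideal P -> (forall g, G g -> P g) -> ideal_span G a -> P a.
Proof.
move=> [P0 [PD PM]] H [s [Hs ->]].
elim: s Hs => [|q s IH] Hs; first by rewrite big_nil.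
rewrite big_cons; apply: PD.
  by apply: PM; apply: H; apply: Hs; rewrite inE eqxx.
by apply: IH => x xs; apply: Hs; rewrite inE xs orbT.
Qed.

Lemma span_ideal (G : A -> Prop) : is_ideal (ideal_span G).
Proof.
split; first by exists [::]; split=> //; rewrite big_nil.
split=> [a b [s [Hs ->]] [t [Ht ->]]|r a [s [Hs ->]]].
  exists (s ++ t); split=> [q|]; last by rewrite big_cat.
  by rewrite mem_cat => /orP [/Hs|/Ht].
exists [seq (r * q.1, q.2) | q <- s]; split=> [q /mapP [x /Hs Hx ->] //|].
by rewrite big_map mulr_sumr; apply: eq_bigr => i _ /=; rewrite mulrA.
Qed.

Lemma span_gen (G : A -> Prop) g : G g -> ideal_span G g.
Proof.
move=> H; exists [:: (1, g)]; split=> [q|]; first by rewrite inE => /eqP ->.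
by rewrite big_seq1 mul1r.
Qed.

End ListIdeals.

Lemma inI_rmorph (A B : comNzRingType) (f : {rmorphism A -> B}) gs a :
  inI gs a -> inI (map f gs) (f a).
Proof.
elim: gs a => [|g gs IH] a /=; first by move=> ->; rewrite rmorph0.
by move=> [b /IH]; rewrite rmorphB rmorphM; exists (f b).
Qed.

(** * Koszul cohomology *)

Section Koszul.
Variable A : comNzRingType.
Implicit Types (c b e : seq bool -> A) (ys gs : seq A) (s : seq bool).

(* A Koszul cochain is a function on the subsets of [ys], encoded as bit lists. *)
Fixpoint kosD ys c s : A :=
  match ys, s with
  | y :: ys', true :: s' =>
      y * c (false :: s') - kosD ys' (fun t => c (true :: t)) s'
  | _ :: ys', false :: s' => kosD ys' (fun t => c (false :: t)) s'
  | _, _ => 0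
  end.

(** The cochains of degree i. Values at bit lists whose length is not [size ys] carry no meaning;
    this is why the cohomological statements are restricted to [size s = size ys]. *)
Definition klev i c := forall s, count id s != i -> c s = 0.

Lemma eq_kosD ys c b s :
  (forall t, c t = b t) -> kosD ys c s = kosD ys b s.
Proof.
elim: ys s c b => [|y ys IH] [|[] s] c b H //=; last by apply: IH => t; apply: H.
by rewrite H; congr (_ - _); apply: IH => t; apply: H.
Qed.

Lemma kosD_lin ys u v c b s :
  kosD ys (fun t => u * c t + v * b t) s = u * kosD ys c s + v * kosD ys b s.
Proof.
elim: ys s c b => [|y ys IH] [|[] s] c b //=; rewrite ?mulr0 ?addr0 //.
rewrite (IH s (fun t => c (true :: t)) (fun t => b (true :: t))); ring.
Qed.

Lemma kosD0 ys c s : (forall t, c t = 0) -> kosD ys c s = 0.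
Proof.
move=> H; rewrite -(@eq_kosD ys (fun t => 0 * c t + 0 * c t)).
  by rewrite kosD_lin !mul0r addr0.
by move=> t; rewrite H !mul0r addr0.
Qed.

Lemma kosDM ys u c s : kosD ys (fun t => u * c t) s = u * kosD ys c s.
Proof.
rewrite -[RHS]addr0 -[X in _ + X](mul0r (kosD ys c s)) -kosD_lin.
by apply: eq_kosD => t; rewrite mul0r addr0.
Qed.

Lemma kosDB ys c b s :
  kosD ys (fun t => c t - b t) s = kosD ys c s - kosD ys b s.
Proof.
have -> : kosD ys c s - kosD ys b s = 1 * kosD ys c s + (-1) * kosD ys b s by ring.
by rewrite -kosD_lin; apply: eq_kosD => t; ring.
Qed.

Lemma kosDN ys c s : kosD ys (fun t => - c t) s = - kosD ys c s.
Proof.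
by rewrite -mulN1r -kosDM; apply: eq_kosD => t; rewrite mulN1r.
Qed.

Lemma kosDD ys c s : kosD ys (kosD ys c) s = 0.
Proof.
elim: ys s c => [|y ys IH] [|[] s] c //=.
have -> : kosD ys (fun t => y * c (false :: t) - kosD ys (fun u => c (true :: u)) t) s
  = y * kosD ys (fun t => c (false :: t)) s - 0.
  by rewrite kosDB kosDM (IH s (fun u => c (true :: u))).
by ring.
Qed.

Lemma inI_kosD gs ys c s :
  (forall t, size t = size ys -> inI gs (c t)) -> size s = size ys ->
  inI gs (kosD ys c s).
Proof.
elim: ys s c => [|y ys IH] [|[] s] c H /= sz; try exact: inI0; case: sz => sz.
  apply: inIB; first by apply: inIM; apply: H; rewrite /= sz.
  by apply: IH => // t st; apply: H; rewrite /= st.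
by apply: IH => // t st; apply: H; rewrite /= st.
Qed.

Lemma klevD ys i c : klev i c -> klev i.+1 (kosD ys c).
Proof.
elim: ys i c => [|y ys IH] i c H [|[] s] //=; rewrite ?add0n ?add1n ?eqSS => Hs.
  rewrite H ?mulr0 ?sub0r; last by rewrite /= add0n.
  case: i H Hs => [|i] H Hs.
    by rewrite kosD0 ?oppr0 // => t; apply: H.
  rewrite (IH i) ?oppr0 // => t Ht; apply: H; by rewrite /= add1n eqSS.
by apply: (IH i) => // t Ht; apply: H; rewrite /= add0n.
Qed.

Lemma klev_lin i u v c b : klev i c -> klev i b ->
  klev i (fun t => u * c t + v * b t).
Proof. by move=> Hc Hb s Hs; rewrite Hc // Hb // !mulr0 addr0. Qed.

(* [klevp i] is "level [i - 1]", empty for [i = 0] *)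
Definition klevp i c := forall s, (count id s).+1 != i -> c s = 0.

Variable W : A -> Prop.
Hypothesis W1 : W 1.
Hypothesis WM : forall a a', W a -> W a' -> W (a * a').

(* [W] annihilates the cohomology H^i(ys; A/(gs)). *)
Definition kvan ys gs i := forall c, klev i c ->
  (forall s, size s = size ys -> inI gs (kosD ys c s)) ->
  exists w b, [/\ W w, klevp i b &
    forall s, size s = size ys -> inI gs (w * c s - kosD ys b s)].

(** A regular sequence on A/(gs) up to multipliers from [W], each head being regular modulo its
    tail. [W = eq 1] gives honest nonzerodivisors, the complement of a prime gives regularity after
    localisation. *)
Fixpoint wreg gs ys : Prop :=
  if ys is y :: ys' then
    wreg gs ys' /\
    forall a, inI (ys' ++ gs) (y * a) -> exists2 w, W w & inI (ys' ++ gs) (w * a)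
  else True.

Lemma kosD_inI ys c s : inI ys (kosD ys c s).
Proof.
elim: ys s c => [|y ys IH] [|[] s] c; try exact: inI0.
  exists (c (false :: s)).
  rewrite /=; have -> : y * c (false :: s) - kosD ys (fun t => c (true :: t)) s - c (false :: s) * y
     = - kosD ys (fun t => c (true :: t)) s by ring.
  by apply: inIN; apply: IH.
by apply: inI_cons; apply: IH.
Qed.

Lemma inI_cat gs hs a : inI (gs ++ hs) a ->
  exists2 a', inI gs a' & inI hs (a - a').
Proof.
elim: gs a => [|g gs IH] a /=; first by move=> H; exists 0; rewrite ?subr0.
move=> [u /IH [b Hb Hab]]; exists (b + u * g).
  by exists u; rewrite addrK.
by have -> : a - (b + u * g) = a - u * g - b by ring.
Qed.

Lemma inI_catl gs hs a : inI gs a -> inI (gs ++ hs) a.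
Proof. by apply: inI_subset => x; rewrite mem_cat => ->. Qed.
Lemma inI_catr gs hs a : inI hs a -> inI (gs ++ hs) a.
Proof. by apply: inI_subset => x; rewrite mem_cat orbC => ->. Qed.

Lemma count_id_size s : (count id s == size s) = (s == nseq (size s) true).
Proof.
elim: s => [|[] s IH]; first by rewrite eqxx.
  by rewrite /= add1n eqSS IH.
rewrite /= add0n; apply/negP => /eqP E.
by have := count_size id s; rewrite E ltnn.
Qed.

(** Top Koszul cohomology is A/(ys): up to signs, the coefficients of [a] on [ys], placed on the
    complements of single elements, form the cochain [b]. *)
Lemma kos_top ys a : inI ys a -> exists b, klevp (size ys) b /\
  forall s, size s = size ys ->
    (if count id s == size ys then a else 0) = kosD ys b s.
Proof.
elim: ys a => [|y ys IH] a /=.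
  move=> ->; exists (fun _ => 0); split=> [s|[|//]] //=.
move=> [u /IH [b [lb Hb]]].
exists (fun s => if s is h :: s' then if h then - b s' else
   (if count id s' == size ys then u else 0) else 0).
split=> [[|[] s] //=|[|[] s] //= [sz]].
- by rewrite add1n eqSS => Hs; rewrite lb ?oppr0.
- by rewrite add0n eqSS; case: eqP.
- rewrite add1n eqSS kosDN -Hb //; case: eqP => _; ring.
- rewrite add0n; have := count_size id s; rewrite sz => Hs.
  rewrite ifN; last by rewrite neq_ltn ltnS Hs.
  symmetry.
  (* the false part is a top cochain, closed for level reasons *)
  have H : klev (size ys) (fun t => if count id t == size ys then u else 0).
    by move=> t /negPf ->.
  apply: (klevD ys H); by rewrite neq_ltn ltnS Hs.
Qed.

(** The complex of [y :: ys] is the mapping cone of y on the complex of [ys]: c splits into c0, on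
    the subsets without y, and c1, on those with y. Induction treats c0 below the top degree of
    [ys]; in that top degree the weak regularity of y does. *)
Lemma kvan_wreg gs ys : wreg gs ys -> forall i, (i < size ys)%N -> kvan ys gs i.
Proof.
elim: ys => [|y ys IH] //= [Hys Hy] i; rewrite ltnS => le_i c lc Hc.
pose c0 s := c (false :: s); pose c1 s := c (true :: s).
have l0 : klev i c0 by move=> s Hs; apply: lc.
have Hc0 s : size s = size ys -> inI gs (kosD ys c0 s).
  by move=> sz; apply: (Hc (false :: s)); rewrite /= sz.
have Hc1 s : size s = size ys -> inI gs (y * c0 s - kosD ys c1 s).
  by move=> sz; apply: (Hc (true :: s)); rewrite /= sz.
have [w [b [Ww lb Hb]]] : exists w b, [/\ W w, klevp i b &
    forall s, size s = size ys -> inI gs (w * c0 s - kosD ys b s)].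
  move: le_i; rewrite leq_eqVlt => /orP [/eqP Ei|lt_i]; last exact: IH.
  (* In top degree c0 is determined by its value at the full subset t, and y times this value lies
     in (ys) + (gs). *)
  pose t := nseq (size ys) true.
  have szt : size t = size ys by rewrite size_nseq.
  have : inI (ys ++ gs) (y * c0 t).
    rewrite -(subrK (kosD ys c1 t) (y * c0 t)); apply: inID.
      by apply: inI_catr; apply: Hc1.
    by apply: inI_catl; apply: kosD_inI.
  move=> /Hy [w Ww /inI_cat [a /kos_top [b [lb Hb]] Ha]].
  exists w, b; split=> //; first by rewrite Ei.
  move=> s sz; rewrite -Hb //.
  case: (boolP (count id s == size ys)) => Hs; last first.
    by rewrite l0 ?mulr0 ?subrr ?Ei //; exact: inI0.
  by have -> : s = t by apply/eqP; rewrite /t -sz -count_id_size sz.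
(* Once c0 is a coboundary, the remaining part e of c is a cocycle of degree one less; for i = 0 it
   vanishes. *)
pose e s := w * c1 s - y * b s.
have [w' [b' [Ww' lb' Hb']]] : exists w' b', [/\ W w', klevp i.-1 b' /\ (i = 0%N -> forall s, b' s = 0) &
    forall s, size s = size ys -> inI gs (w' * e s - kosD ys b' s)].
  case: i => [|i] in le_i lc l0 lb *.
    exists 1, (fun _ => 0); split=> //.
    move=> s sz; rewrite kosD0 // subr0 mul1r /e /c1 (lc (true :: s)) // lb //.
    by rewrite !mulr0 subr0; exact: inI0.
  have := IH Hys i le_i e; case.
  - move=> s Hs; rewrite /e lb; last by rewrite eqSS.
    by rewrite /c1 lc ?mulr0 ?subr0 //= add1n eqSS.
  - move=> s sz; rewrite /e kosDB !kosDM.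
    have -> : w * kosD ys c1 s - y * kosD ys b s =
       y * (w * c0 s - kosD ys b s) - w * (y * c0 s - kosD ys c1 s) by ring.
    by apply: inIB; apply: inIM; [exact: Hb|exact: Hc1].
  by move=> w' [b' [Ww' lb' Hb']]; exists w', b'; split.
exists (w' * w), (fun s => if s is h :: s' then if h then - b' s' else w' * b s' else 0).
split=> [||[|[] s] //= [sz]]; first exact: WM.
- move=> [|[] s] //=.
  + rewrite add1n => Hs; case: i {le_i lc l0 lb} => [|i] in lb' Hs *.
      by rewrite lb'.2 // oppr0.
    by rewrite lb'.1 ?oppr0.
  + by rewrite add0n => Hs; rewrite lb ?mulr0.
- rewrite kosDN.
  have -> : w' * w * c (true :: s) - (y * (w' * b s) - - kosD ys b' s) =
     w' * e s - kosD ys b' s by rewrite /e /c1; ring.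
  exact: Hb'.
- rewrite kosDM.
  have -> : w' * w * c (false :: s) - w' * kosD ys b s =
    w' * (w * c0 s - kosD ys b s) by rewrite /c0; ring.
  by apply: inIM; apply: Hb.
Qed.

(** The connecting homomorphism of 0 -> A/(gs) -> A/(gs) -> A/(g, gs) -> 0, the first map being
    multiplication by g: differentiate a lift of the cocycle and divide by g. *)
Lemma kos_connect ys gs g i c :
  (forall a, inI gs (g * a) -> inI gs a) -> klev i c ->
  (forall s, size s = size ys -> inI (g :: gs) (kosD ys c s)) ->
  exists e, [/\ klev i.+1 e,
    forall s, size s = size ys -> inI gs (kosD ys c s - g * e s) &
    forall s, size s = size ys -> inI gs (kosD ys e s)].
Proof.
move=> reg lc Hc.
have /boolp.choice [e He] : forall s, exists a : A,
   (size s = size ys -> inI gs (kosD ys c s - g * a)) /\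
   (count id s != i.+1 -> a = 0).
  move=> s; case: (eqVneq (size s) (size ys)) => [sz|/eqP sz]; last by exists 0.
  case: (eqVneq (count id s) i.+1) => [E|Hs].
    by have [a Ha] := Hc s sz; exists a; rewrite mulrC.
  exists 0; split=> // _; rewrite (klevD ys lc) // mulr0 subrr; exact: inI0.
exists e; split=> [s Hs|s sz|s sz]; [exact: (He s).2|exact: (He s).1|].
apply: reg; have -> : g * kosD ys e s = - kosD ys (fun t => kosD ys c t - g * e t) s.
  by rewrite kosDB kosDD sub0r opprK kosDM.
apply: inIN.
by apply: inI_kosD => // t st; apply: (He t).1.
Qed.

(** By the long exact sequence, H^i of A/(g, gs) sits between H^i and H^(i+1) of A/(gs). *)
Lemma kvan_cons ys gs g i :
  (forall a, inI gs (g * a) -> inI gs a) ->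
  kvan ys gs i -> kvan ys gs i.+1 -> kvan ys (g :: gs) i.
Proof.
move=> reg Ki KSi c lc Hc.
have [e [le He De]] := kos_connect reg lc Hc.
have [w [b [Ww lb Hb]]] := KSi e le De.
have lb' : klev i b by move=> s Hs; apply: lb; rewrite eqSS.
have [||w' [b' [Ww' lb2 Hb']]] := Ki (fun s => w * c s + (- g) * b s).
- exact: klev_lin.
- move=> s sz; rewrite kosD_lin.
  have -> : w * kosD ys c s + - g * kosD ys b s =
     w * (kosD ys c s - g * e s) + g * (w * e s - kosD ys b s) by ring.
  by apply: inID; apply: inIM; [exact: He|exact: Hb].
exists (w' * w), b'; split=> //; first exact: WM.
move=> s sz; exists (w' * b s).
have -> : w' * w * c s - kosD ys b' s - w' * b s * g =
   w' * (w * c s + (- g) * b s) - kosD ys b' s by ring.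
exact: Hb'.
Qed.

Fixpoint regseq hs gs : Prop :=
  if gs is g :: gs' then
    regseq hs gs' /\ forall a, inI (gs' ++ hs) (g * a) -> inI (gs' ++ hs) a
  else True.

Lemma kvan_regseq ys hs gs r : (forall i, (i < r)%N -> kvan ys hs i) ->
  regseq hs gs -> forall i, (i + size gs < r)%N -> kvan ys (gs ++ hs) i.
Proof.
move=> base; elim: gs => [|g gs IH] /=; first by move=> _ i; rewrite addn0; exact: base.
move=> [Hgs reg] i Hi; apply: kvan_cons => //; apply: IH => //.
  by apply: leq_trans Hi; rewrite ltnS addnS.
by rewrite addSnnS.
Qed.

End Koszul.

(** * Cochains of degree 0 and 1, and residues in top degree *)

Section KoszulCochains.
Variable A : comNzRingType.
Implicit Types (c b : seq bool -> A) (ys gs ws : seq A) (s : seq bool).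

Definition kcst a s : A := if has id s then 0 else a.

(** The cochain of degree 1 with the entries of [ws] as its values on singletons; [kcst a] is the
    constant in degree 0. *)
Fixpoint kvec ws s : A :=
  match ws, s with
  | w :: ws', true :: s' => kcst w s'
  | _ :: ws', false :: s' => kvec ws' s'
  | _, _ => 0
  end.

Lemma count_id0 s : (count id s == 0%N) = ~~ has id s.
Proof. by rewrite has_count -leqn0 -ltnNge. Qed.

Lemma klev_kcst a : klev 0 (kcst a).
Proof. by move=> s; rewrite count_id0 negbK /kcst => ->. Qed.

Lemma klev_kvec ws : klev 1 (kvec ws).
Proof.
elim: ws => [|w ws IH] [|[] s] //=; last by rewrite add0n; apply: IH.
by rewrite add1n eqSS; apply: klev_kcst.
Qed.

Lemma kosD_kcst ys a s : kosD ys (kcst a) s = a * kvec ys s.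
Proof.
elim: ys s => [|y ys IH] [|[] s] //=; rewrite ?mulr0 //.
rewrite kosD0 // subr0 /kcst /=; case: (has id s); ring.
Qed.

Lemma kvec_in (P : A -> Prop) ws s : P 0 -> (forall w, w \in ws -> P w) -> P (kvec ws s).
Proof.
move=> P0; elim: ws s => [|w ws IH] [|[] s] H //=.
  by rewrite /kcst; case: ifP => // _; apply: H; rewrite inE eqxx.
by apply: IH => x xws; apply: H; rewrite inE xws orbT.
Qed.

Lemma kvec_sub gs ys ws u y s : size ws = size ys ->
  (forall i, inI gs (u * ws`_i - y * ys`_i)) ->
  inI gs (u * kvec ws s - y * kvec ys s).
Proof.
elim: ws ys s => [|w ws IH] [|z ys] [|[] s] //= sz H;
  rewrite ?mulr0 ?subr0; try exact: inI0.
  rewrite /kcst; case: ifP => _; last exact: (H 0%N).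
  by rewrite !mulr0 subr0; exact: inI0.
by apply: IH; [case: sz|move=> i; apply: (H i.+1)].
Qed.

Lemma kosD_kvec gs ys ws s : size ws = size ys ->
  (forall i j, inI gs (ys`_i * ws`_j - ys`_j * ws`_i)) ->
  inI gs (kosD ys (kvec ws) s).
Proof.
elim: ys ws s => [|y ys IH] [|w ws] [|[] s] //= sz H; try exact: inI0.
  rewrite (@eq_kosD _ ys _ (kcst w)) // kosD_kcst.
  apply: kvec_sub; first by case: sz.
  by move=> i; have := H 0%N i.+1; rewrite /= [w * _]mulrC.
rewrite (@eq_kosD _ ys _ (kvec ws)) //.
by apply: IH; [case: sz|move=> i j; apply: (H i.+1 j.+1)].
Qed.

Lemma kvec_nth ws i : (i < size ws)%N ->
  kvec ws (nseq i false ++ true :: nseq (size ws - i.+1) false) = ws`_i.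
Proof.
elim: ws i => [|w ws IH] [|i] //=; last by rewrite ltnS subSS; exact: IH.
by move=> _; rewrite subSS subn0 /kcst has_nseq andbF.
Qed.

Section Residue.
Variable ys : seq A.

(* iterated connecting homomorphisms: [e] represents, in top degree, the
   class of the cocycle [c] modulo [gs] *)
Fixpoint kres gs c e : Prop :=
  if gs is g :: gs' then
    exists c1, [/\ klev (size ys - size gs')%N c1,
      forall s, size s = size ys -> inI gs' (kosD ys c s - g * c1 s) &
      kres gs' c1 e]
  else forall s, size s = size ys ->
    c s = if count id s == size ys then e else 0.

Lemma kres_lin gs u v c b e e' : kres gs c e -> kres gs b e' ->
  kres gs (fun s => u * c s + v * b s) (u * e + v * e').
Proof.
elim: gs c b => [|g gs IH] c b /=.
  by move=> Hc Hb s sz; rewrite Hc // Hb //; case: ifP => _ //; ring.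
move=> [c1 [lc1 Hc1 Kc]] [b1 [lb1 Hb1 Kb]].
exists (fun s => u * c1 s + v * b1 s); split; [exact: klev_lin| |exact: IH].
move=> s sz; rewrite kosD_lin.
have -> : u * kosD ys c s + v * kosD ys b s - g * (u * c1 s + v * b1 s) =
  u * (kosD ys c s - g * c1 s) + v * (kosD ys b s - g * b1 s) by ring.
by apply: inID; apply: inIM; [exact: Hc1|exact: Hb1].
Qed.

(** [P j] is a property, in practice a degree condition, of the cochains that occur while j
    generators are still to be divided out; the step hypothesis carries it through one connecting
    homomorphism. *)
Lemma kres_exists gs (P : nat -> A -> Prop) c :
  (forall k, P k 0) -> (size gs <= size ys)%N -> regseq [::] gs ->
  (forall g gs' pre c s, gs = pre ++ g :: gs' -> (forall t, P (size gs').+1 (c t)) ->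
     inI (g :: gs') (kosD ys c s) ->
     exists2 b, P (size gs') b & inI gs' (kosD ys c s - g * b)) ->
  klev (size ys - size gs)%N c -> (forall s, P (size gs) (c s)) ->
  (forall s, size s = size ys -> inI gs (kosD ys c s)) ->
  exists2 e, P 0%N e & kres gs c e.
Proof.
move=> P0; elim: gs c => [|g gs IH] c /=.
  move=> _ _ _; rewrite subn0 => lc Pc _.
  exists (c (nseq (size ys) true)) => // s sz; case: ifP => [|/negbT /lc //].
  by rewrite -sz count_id_size => /eqP {1}->.
move=> sz [Hgs reg] Hstep lc Pc Hc.
rewrite cats0 in reg.
have /boolp.choice [c1 Hc1] : forall s, exists a : A,
   [/\ size s = size ys -> inI gs (kosD ys c s - g * a), P (size gs) a &
   (count id s != size ys - size gs)%N -> a = 0].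
  move=> s; case: (eqVneq (size s) (size ys)) => [szs|/eqP szs]; last by exists 0.
  case: (eqVneq (count id s) (size ys - size gs)%N) => [E|Hs].
    by have [a Pa Ha] := Hstep g gs [::] c s erefl Pc (Hc s szs); exists a.
  exists 0; split=> // _; rewrite (klevD ys lc); last by rewrite -subSn // subSS.
  rewrite mulr0 subrr; exact: inI0.
have lc1 : klev (size ys - size gs)%N c1 by move=> s Hs; have [_ _] := Hc1 s; apply.
have [|||||e' Pe' Ke] := IH c1 _ Hgs.
- exact: ltnW.
- by move=> h gs' pre c' s E; apply: (Hstep h gs' (g :: pre)); rewrite E.
- exact: lc1.
- by move=> s; have [] := Hc1 s.
- move=> s szs; apply: reg.
  have -> : g * kosD ys c1 s = - kosD ys (fun t => kosD ys c t - g * c1 t) s.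
    by rewrite kosDB kosDD sub0r opprK kosDM.
  apply: inIN.
  by apply: inI_kosD => // t st; have [H _ _] := Hc1 t; apply: H.
by exists e' => //; exists c1; split=> // s szs; have [H _ _] := Hc1 s; apply: H.
Qed.

(** Every connecting homomorphism used is injective on cohomology: it starts in degree
    [size ys - (size gs).+1], where the cohomology of A/(gs) vanishes. So a residue that is zero in
    A/(ys), the top cohomology, forces c to be a coboundary. *)
Lemma kres_coboundary gs c e :
  wreg (eq 1) [::] ys -> (size gs <= size ys)%N -> regseq [::] gs ->
  klev (size ys - size gs)%N c -> kres gs c e -> inI ys e ->
  exists b, klevp (size ys - size gs)%N b /\
    forall s, size s = size ys -> inI gs (c s - kosD ys b s).
Proof.
move=> regy; elim: gs c => [|g gs IH] c /=.
  move=> _ _ lc Hc /kos_top [b [lb Hb]]; exists b; rewrite subn0; split=> //.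
  by move=> s sz; rewrite Hc // -Hb // subrr.
move=> sz [Hgs reg] lc [c1 [lc1 Hc1 Kc]] ye; rewrite cats0 in reg.
have [b [lb Hb]] := IH c1 (ltnW sz) Hgs lc1 Kc ye.
have E : (size ys - size gs)%N = (size ys - (size gs).+1).+1.
  by rewrite -subSn // subSS.
have W1 : (1 : A) = 1 by [].
have WM (a a' : A) : 1 = a -> 1 = a' -> 1 = a * a' by move=> <- <-; rewrite mulr1.
have K : kvan (eq 1) ys gs (size ys - (size gs).+1)%N.
  rewrite -[gs]cats0; apply: (kvan_regseq WM (r := size ys)) => //.
    exact: kvan_wreg.
  by rewrite ?cats0 -addSn -E subnK // ltnW.
have [||w [b' [<- lb' Hb']]] := K (fun s => 1 * c s + (- g) * b s).
- by apply: klev_lin => // s Hs; apply: lb; rewrite E eqSS.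
- move=> s szs; rewrite kosD_lin.
  have -> : 1 * kosD ys c s + - g * kosD ys b s =
     (kosD ys c s - g * c1 s) + g * (c1 s - kosD ys b s) by ring.
  by apply: inID; [exact: Hc1|apply: inIM; exact: Hb].
exists b'; split=> // s szs; exists (b s).
have -> : c s - kosD ys b' s - b s * g =
  1 * (1 * c s + - g * b s) - kosD ys b' s by ring.
exact: Hb'.
Qed.

End Residue.
End KoszulCochains.

(** * Primes, ranks and heights *)

Lemma prime_avoiding (A : comNzRingType) (I W : A -> Prop) :
  is_ideal I -> W 1 -> (forall a b, W a -> W b -> W (a * b)) ->
  (forall a, I a -> ~ W a) ->
  exists P, [/\ prime_ideal P, subI I P & forall a, P a -> ~ W a].
Proof.
move=> idI W1 WM IW.
pose ok (P : A -> Prop) := [/\ is_ideal P, subI I P & forall a, P a -> ~ W a].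
pose R (s t : {P : A -> Prop | ok P}) := boolp.asbool (subI (sval s) (sval t)).
have okI : ok I by split.
have [||C totC|[P [idP IP PW]] maxP] :=
  @classical_sets.ZL_preorder {P : A -> Prop | ok P} (exist _ I okI) R.
- by move=> t; apply/boolp.asboolP => a.
- move=> r s t /boolp.asboolP rs /boolp.asboolP st; apply/boolp.asboolP => a.
  by move=> /rs /st.
- have [[s0 Cs0]|C0] := boolp.pselect (exists s, C s); last first.
    by exists (exist _ I okI) => s Cs; case: C0; exists s.
  pose U a := exists2 s, C s & sval s a.
  suff okU : ok U.
    exists (exist _ U okU) => s Cs; apply/boolp.asboolP => a sa /=; by exists s.
  split.
  + split; first by exists s0 => //; case: (svalP s0) => [[]].
    split=> [a b [s Cs sa] [t Ct tb]|r a [s Cs sa]]; last first.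
      by exists s => //; case: (svalP s) => [[_ [_ M]] _ _]; apply: M.
    have [/boolp.asboolP st|/boolp.asboolP ts] := totC s t Cs Ct.
      exists t => //; case: (svalP t) => [[_ [D _]] _ _]; apply: D => //; exact: st.
    exists s => //; case: (svalP s) => [[_ [D _]] _ _]; apply: D => //; exact: ts.
  + by move=> a Ia; exists s0 => //; case: (svalP s0) => [_ H _]; apply: H.
  + by move=> a [s Cs sa]; case: (svalP s) => [_ _ H]; apply: H.
exists P; split=> //; split=> //; split; first by move=> /PW.
have [zeroP [PD PM]] := idP.
(* enlarging [P] by an element outside forces it to meet [W] *)
have meets a : ~ P a -> exists p r, P p /\ W (p + r * a).
  move=> nPa; apply: boolp.contrapT => H; apply: nPa.
  pose Q x := exists p r, P p /\ x = p + r * a.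
  have okQ : ok Q.
    split.
    - split; first by exists 0, 0; rewrite mul0r addr0.
      split=> [_ _ [p [r [Pp ->]]] [q [t [Pq ->]]]|t _ [p [r [Pp ->]]]].
        exists (p + q), (r + t); split; [exact: PD|ring].
      exists (t * p), (t * r); split; [exact: PM|ring].
    - by move=> x /IP Px; exists x, 0; rewrite mul0r addr0.
    - by move=> _ [p [r [Pp ->]]] HW; apply: H; exists p, r.
  have PQ : R (exist _ P (And3 idP IP PW)) (exist _ Q okQ).
    by apply/boolp.asboolP => x Px; exists x, 0; rewrite mul0r addr0.
  have /boolp.asboolP := maxP _ PQ.
  by move=> /(_ a); apply; exists 0, 1; rewrite mul1r add0r.
move=> a b Pab; apply: boolp.contrapT => H.
have [p [r [Pp Wp]]] : exists p r, P p /\ W (p + r * a).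
  by apply: meets => Pa; apply: H; left.
have [q [t [Pq Wq]]] : exists p r, P p /\ W (p + r * b).
  by apply: meets => Pb; apply: H; right.
apply: (PW _ _ (WM _ _ Wp Wq)).
have -> : (p + r * a) * (q + t * b) = (q + t * b) * p + (r * a) * q + (r * t) * (a * b) by ring.
by apply: (PD); [apply: (PD)|]; apply: PM.
Qed.

Section ResidueField.
Variables (A : comNzRingType) (P : A -> Prop).
Hypothesis primeP : prime_ideal P.

Definition idealb (a : A) : bool := boolp.asbool (P a).

Fact idealb_closed : idealr_closed idealb.
Proof.
have [[P0 [PD PM]] [P1 _]] := primeP.
split.
- by apply/boolp.asboolP.
- by apply/negP => /boolp.asboolP.
- move=> a u v /boolp.asboolP Pu /boolp.asboolP Pv; apply/boolp.asboolP.
  by apply: PD => //; apply: PM.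
Qed.
HB.instance Definition _ := isIdealr.Build A idealb idealb_closed.

Fact idealb_prime : prime_idealr_closed idealb.
Proof.
move=> a b /boolp.asboolP /(primeP.2.2 _ _) [H|H]; apply/orP; [left|right];
  exact/boolp.asboolP.
Qed.
HB.instance Definition _ := isPrimeIdealrClosed.Build A idealb idealb_prime.

Definition idealP : prime_idealr A := PrimeIdealr.clone A idealb _.
Definition residue := {ideal_quot idealP}.
HB.instance Definition _ := GRing.ComNzRing.on residue.

(** Units and inverses are chosen classically, to equip A/P with the integral domain structure from
    which its fraction field is formed. *)
Definition residue_unit : pred residue :=
  fun x => boolp.asbool (exists y, y * x = 1).
Definition residue_inv (x : residue) : residue :=
  if boolp.pselect (exists y, y * x = 1) is left ex then
    sval (boolp.cid ex) else x.

Fact residue_mulVr : {in residue_unit, left_inverse 1 residue_inv *%R}.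
Proof.
move=> x /boolp.asboolP ex; rewrite /residue_inv.
by case: boolp.pselect => // e; case: boolp.cid.
Qed.
Fact residue_unitP x y : y * x = 1 -> residue_unit x.
Proof. by move=> E; apply/boolp.asboolP; exists y. Qed.
Fact residue_inv_out : {in [predC residue_unit], residue_inv =1 id}.
Proof.
move=> x /negP H; rewrite /residue_inv; case: boolp.pselect => // ex.
by case: H; apply/boolp.asboolP.
Qed.
HB.instance Definition _ := GRing.ComNzRing_hasMulInverse.Build residue
  residue_mulVr residue_unitP residue_inv_out.

HB.instance Definition _ := GRing.ComUnitRing_isIntegral.Build residue
  (@Quotient.rquot_IdomainAxiom _ idealP).

End ResidueField.

Lemma residue_field (A : comNzRingType) (P : A -> Prop) : prime_ideal P ->
  exists (K : fieldType) (chi : {rmorphism A -> K}), forall a, chi a = 0 <-> P a.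
Proof.
move=> primeP.
pose Q : idomainType := residue primeP.
pose pr : {rmorphism A -> Q} := \pi_(residue primeP)%qT.
exists {fraction Q}, (@tofrac Q \o pr) => a /=.
split=> [/eqP|Pa]; last first.
  suff -> : pr a = 0 by rewrite tofrac0.
  apply/eqP; rewrite -(rmorph0 pr) -Quotient.idealrBE subr0; exact/boolp.asboolP.
rewrite tofrac_eq0 -(rmorph0 pr) -Quotient.idealrBE subr0 => H; exact/boolp.asboolP.
Qed.

Lemma minor_of_rank (K : fieldType) p q (M : 'M[K]_(p, q)) :
  exists (f : 'I_(\rank M) -> 'I_p) (g : 'I_(\rank M) -> 'I_q),
    [/\ injective f, injective g & \det (mxsub f g M) != 0].
Proof.
pose f := maxrankfun M; pose N := (rowsub f M)^T.
have fullN : row_full N.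
  by rewrite /row_full mxrank_tr; have := maxrowsub_free M; rewrite /row_free.
exists f, (fullrankfun fullN); split; [exact: maxrankfun_inj|exact: fullrankfun_inj|].
have := fullrowsub_unit fullN; rewrite unitmxE unitfE -det_tr.
by congr (\det _ != 0); apply/matrixP => i j; rewrite !mxE.
Qed.

Lemma fraction_numden (A : idomainType) (x : {fraction A}) :
  exists a b, b != 0 /\ x * tofrac b = tofrac a.
Proof.
elim/quotW: x => y; exists (frac y).1, (frac y).2; split.
  exact: denom_ratioP.
unlock tofrac; rewrite -[LHS]FracField.pi_mul; apply/eqmodP => /=.
rewrite FracField.equivfE /FracField.mulf.
by rewrite !numden_Ratio ?mulf_neq0 ?denom_ratioP ?oner_eq0 // !mulr1 mulrC.
Qed.

(** Injectivity persists over the fraction field, because the denominators of a kernel vector can be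
    cleared; there, full column rank supplies the minor. *)
Lemma minor_of_injective (A : idomainType) p q (M : 'M[A]_(p, q)) :
  (forall w : 'cV_q, M *m w = 0 -> w = 0) ->
  exists f : 'I_q -> 'I_p, injective f /\ \det (rowsub f M) != 0.
Proof.
move=> inj; pose K : fieldType := {fraction A}.
pose F : {rmorphism A -> K} := @tofrac A.
pose N := map_mx F M.
have F0 a : (F a == 0) = (a == 0) by exact: tofrac_eq0.
have fullN : row_full N.
  rewrite /row_full -mxrank_tr -/(row_free N^T).
  apply: inj_row_free => v vN.
  have /boolp.choice [ab Hab] : forall j, exists ab : A * A,
      ab.2 != 0 /\ v 0 j * F ab.2 = F ab.1.
    by move=> j; have [a [b H]] := fraction_numden (v 0 j); exists (a, b).
  pose D := \prod_j (ab j).2.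
  have D0 : D != 0 by apply/prodf_neq0 => j _; have [] := Hab j.
  pose w := \col_j ((ab j).1 * \prod_(i | i != j) (ab i).2).
  have Ew j : F (w j 0) = F D * v 0 j.
    have -> : D = (ab j).2 * \prod_(i | i != j) (ab i).2 by rewrite /D (bigD1 j).
    by rewrite mxE 2!rmorphM -(Hab j).2; ring.
  have w0 : w = 0.
    apply: inj; apply/colP => i; rewrite !mxE; apply/eqP; rewrite -F0 rmorph_sum.
    have : (v *m N^T) 0 i = 0 by rewrite vN mxE.
    rewrite mxE => /(congr1 ( *%R (F D))); rewrite mulr0 mulr_sumr => E.
    apply/eqP; rewrite -[RHS]E.
    by apply: eq_bigr => j _; rewrite rmorphM Ew !mxE; ring.
  apply/rowP => j; rewrite mxE; apply/eqP.
  have : F D * v 0 j == 0 by rewrite -Ew w0 mxE rmorph0.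
  by rewrite mulf_eq0 F0 (negPf D0).
exists (fullrankfun fullN); split; first exact: fullrankfun_inj.
have := fullrowsub_unit fullN; rewrite unitmxE unitfE -[rowsub _ _]map_mxsub.
by rewrite det_map_mx F0.
Qed.

Lemma mpoly_rmorph_eq n (A : comNzRingType) (S : comNzRingType)
    (f g : {rmorphism {mpoly A[n]} -> S}) :
  (forall c, f c%:MP = g c%:MP) -> (forall i, f 'X_i = g 'X_i) -> f =1 g.
Proof.
move=> HC HX; elim/mpolyind => [|c m p _ _ IH]; first by rewrite !rmorph0.
rewrite !rmorphD IH -mul_mpolyC !rmorphM HC mpolyXE_id !rmorph_prod.
congr (_ * _ + _); apply: eq_bigr => i _.
by rewrite !rmorphXn HX.
Qed.

Lemma mpoly_hom n (A S : comNzRingType) (f : {rmorphism A -> S}) (h : 'I_n -> S) :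
  {g : {rmorphism {mpoly A[n]} -> S} |
    (forall c, g c%:MP = f c) /\ (forall i, g 'X_i = h i)}.
Proof.
exists (mmap f h); split=> [c|i] /=; first by rewrite mmapC.
by rewrite mmapX mmap1U.
Qed.

(* [mmap] sealed behind an opaque proof: unfolding it makes unification diverge
   over concrete coefficient rings *)
Definition mhom n (A S : comNzRingType) (f : {rmorphism A -> S}) (h : 'I_n -> S) :
  {mpoly A[n]} -> S := sval (mpoly_hom f h).
HB.instance Definition _ n (A S : comNzRingType) (f : {rmorphism A -> S}) (h : 'I_n -> S) :=
  GRing.RMorphism.copy (mhom f h) (sval (mpoly_hom f h)).

Lemma mhomC n (A S : comNzRingType) (f : {rmorphism A -> S}) (h : 'I_n -> S) c :
  mhom f h c%:MP = f c.
Proof. exact: (svalP (mpoly_hom f h)).1. Qed.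

Lemma mhomU n (A S : comNzRingType) (f : {rmorphism A -> S}) (h : 'I_n -> S) i :
  mhom f h 'X_i = h i.
Proof. exact: (svalP (mpoly_hom f h)).2. Qed.

Lemma mhomX n (A S : comNzRingType) (f : {rmorphism A -> S}) (h : 'I_n -> S) m :
  mhom f h 'X_[m] = \prod_i h i ^+ m i.
Proof.
by rewrite mpolyXE_id rmorph_prod; apply: eq_bigr => i _; rewrite rmorphXn /= mhomU.
Qed.

(** * Algebraic independence modulo primes, and heights *)

Section Transcendence.
Variables (k : fieldType) (d : nat).
Local Notation R := {mpoly k[d]}.
Implicit Types (P Q : R -> Prop).

Definition evp e (y : 'I_e -> R) : {mpoly k[e]} -> R := mhom (@mpolyC d k) y.
HB.instance Definition _ e (y : 'I_e -> R) :=
  GRing.RMorphism.copy (evp y) (mhom (@mpolyC d k) y).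

Definition alg_indep e P (y : 'I_e -> R) := forall q, P (evp y q) -> q = 0.

Lemma muni_inj e : injective (@muni e k).
Proof.
pose psi : {rmorphism {poly {mpoly k[e]}} -> {mpoly k[e.+1]}} :=
  horner_eval 'X_ord_max \o map_poly (@mwiden e k).
apply: (can_inj (g := psi)); apply: (mpoly_rmorph_eq (f := psi \o @muni e k) (g := idfun)).
  move=> c /=; rewrite muniC /psi /= /horner_eval map_polyC hornerC.
  exact: mwidenC.
move=> i /=; rewrite /muni mmapX mmap1U /psi /= /horner_eval.
case: splitP => [j|j] /= Ej; last first.
  rewrite map_polyX hornerX; congr 'X_ _; apply: val_inj => /=.
  by rewrite Ej ord1 addn0.
rewrite map_polyC hornerC /= mwidenX mnmwiden1; congr 'X_[U_(_)].
exact: val_inj.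
Qed.

(** Read a relation modulo Q as a polynomial in w. Since w is in P, its constant coefficient
    vanishes modulo P, hence is 0 by independence; since w is not in the prime Q, a factor w can be
    cancelled and the argument repeated. *)
Lemma alg_indep_extend e P Q (y : 'I_e -> R) w :
  prime_ideal P -> prime_ideal Q -> subI Q P -> P w -> ~ Q w ->
  alg_indep P y ->
  alg_indep Q (fun i : 'I_e.+1 => oapp y w (unlift ord_max i)).
Proof.
move=> [[P0 [PD PM]] _] [[Q0 [QD QM]] [Q1 Qpr]] QP Pw nQw indy q.
set y' := fun i => _ => Qq.
pose ev (u : {poly {mpoly k[e]}}) := (map_poly (evp y) u).[w].
have evE : evp y' q = ev (muni q).
  apply: (mpoly_rmorph_eq (f := evp y')
    (g := horner_eval w \o map_poly (evp y) \o @muni e k)).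
    move=> c /=; rewrite muniC /horner_eval map_polyC hornerC /=.
    by rewrite [in LHS]/evp [LHS]mhomC /evp [RHS]mhomC.
  move=> i /=; rewrite /evp mhomU /muni mmapX mmap1U /horner_eval.
  case: splitP => [j|j] /= Ej.
    rewrite map_polyC hornerC /= mhomU /y'.
    have -> : i = lift ord_max j by apply: val_inj; rewrite /= /bump leqNgt ltn_ord add0n.
    by rewrite liftK.
  rewrite map_polyX hornerX /y'.
  have -> : i = ord_max by apply: val_inj; rewrite /= Ej ord1 addn0.
  by rewrite unlift_none.
apply: muni_inj; rewrite muni0; move: Qq; rewrite evE.
elim/poly_ind: (muni q) => [//|u c IH].
have -> : ev (u * 'X + c%:P) = ev u * w + evp y c.
  rewrite /ev (rmorphD (map_poly (evp y))) (rmorphM (map_poly (evp y))) /=.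
  by rewrite map_polyX map_polyC hornerMXaddC.
move=> H.
have c0 : c = 0.
  apply: indy; have /QP Pq := H.
  rewrite -(addKr (ev u * w) (evp y c)); apply: PD => //.
  by rewrite -mulNr; apply: PM.
move: H; rewrite c0 rmorph0 !addr0 => /Qpr [/IH -> |//].
by rewrite mul0r.
Qed.

Definition mdeg_le N (p : R) := forall m, m \in msupp p -> (mdeg m <= N)%N.

Lemma mdeg_le_msize p : mdeg_le (msize p) p.
Proof. by move=> m /msize_mdeg_lt /ltnW. Qed.

Lemma mdeg_leM N N' p q : mdeg_le N p -> mdeg_le N' q -> mdeg_le (N + N') (p * q).
Proof.
move=> Hp Hq m /msuppM_le /allpairsP [[a b] /= [ap bq ->]].
by rewrite mdegD leq_add // ?Hp ?Hq.
Qed.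

Lemma mdeg_leX N p n : mdeg_le N p -> mdeg_le (n * N) (p ^+ n).
Proof.
move=> Hp; elim: n => [|n IH].
  by move=> m; rewrite expr0 msupp1 inE => /eqP ->; rewrite mdeg0.
by rewrite exprS mulSn; apply: mdeg_leM.
Qed.

Lemma mdeg_le_prod (I : Type) (r : seq I) (F : I -> R) (N : I -> nat) :
  (forall i, mdeg_le (N i) (F i)) ->
  mdeg_le (\sum_(i <- r) N i) (\prod_(i <- r) F i).
Proof.
move=> H; elim: r => [|i r IH]; rewrite ?big_nil ?big_cons.
  by move=> m; rewrite msupp1 inE => /eqP ->; rewrite mdeg0.
exact: mdeg_leM.
Qed.

(** With more than d elements y, there are more monomials in y with exponents below s than monomials
    in x that can occur in them, so linear algebra gives a relation. *)
Lemma alg_indep_bound e (y : 'I_e -> R) : alg_indep (eq^~ 0) y -> (e <= d)%N.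
Proof.
move=> indy; rewrite leqNgt; apply/negP => ed.
pose D := \max_i msize (y i).
(* This s makes N at most s(eD + 1), so that N^d is at most s^d (eD + 1)^d < s^(d+1), which is at
   most s^e. *)
pose s := ((e * D).+1 ^ d).+1.
pose N := (e * (s * D)).+1.
pose mon (a : {ffun 'I_e -> 'I_s}) : 'X_{1..e} := [multinom (a i : nat) | i < e].
pose mon' (b : {ffun 'I_d -> 'I_N}) : 'X_{1..d} := [multinom (b i : nat) | i < d].
pose M := \matrix_(a < #|{ffun 'I_e -> 'I_s}|, b < #|{ffun 'I_d -> 'I_N}|)
   (evp y 'X_[mon (enum_val a)])@_(mon' (enum_val b)).
have small : (#|{ffun 'I_d -> 'I_N}| < #|{ffun 'I_e -> 'I_s}|)%N.
  rewrite !card_ffun !card_ord.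
  have HN : (N <= s * (e * D).+1)%N by rewrite /N mulnS mulnCA -add1n leq_add2r.
  apply: (@leq_trans (s ^ d.+1)); last by rewrite leq_exp2l // /s ltnS expn_gt0.
  apply: (@leq_ltn_trans ((s * (e * D).+1) ^ d)).
    by case: (posnP d) => [->|d0]; rewrite ?expn0 // leq_exp2r.
  by rewrite expnMn expnSr ltn_pmul2l ?expn_gt0.
have : kermx M != 0.
  rewrite kermx_eq0; apply/negP => /eqP E.
  by have := rank_leq_col M; rewrite E leqNgt small.
case/rowV0Pn => c /sub_kermxP cM /rV0Pn [a0 ca0].
pose q := \sum_a c 0 a *: 'X_[mon (enum_val a)] : {mpoly k[e]}.
have q0 : q = 0.
  apply: indy; apply/mpolyP => b; rewrite mcoeff0.
  have Ec a : (c 0 a *: evp y 'X_[mon (enum_val a)]) = evp y (c 0 a *: 'X_[mon (enum_val a)]).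
    by rewrite -[in RHS]mul_mpolyC rmorphM /= /evp [in RHS]mhomC mul_mpolyC.
  rewrite rmorph_sum /= raddf_sum /=.
  case: (leqP (mdeg b) (e * (s * D))) => Hb.
    have Hbi i : (b i < N)%N.
      by rewrite ltnS (leq_trans _ Hb) // mdegE (bigD1 i) //= leq_addr.
    pose b' := [ffun i => Ordinal (Hbi i)].
    have Eb : mon' (enum_val (enum_rank b')) = b.
      by apply/mnmP => i; rewrite mnmE enum_rankK ffunE.
    have : (c *m M) 0 (enum_rank b') = 0 by rewrite cM mxE.
    rewrite mxE => {2}<-; apply: eq_bigr => a _.
    by rewrite -/(evp y _) -Ec mcoeffZ mxE Eb.
  apply: big1 => a _; rewrite -/(evp y _) -Ec mcoeffZ.
  rewrite [_@__]memN_msupp_eq0 ?mulr0 //.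
  apply/negP => Hm; move: Hb; rewrite ltnNge => /negP; apply.
  move: b Hm; rewrite /evp mhomX.
  have -> : (e * (s * D) = \sum_(i < e) s * D)%N by rewrite sum_nat_const card_ord.
  apply: mdeg_le_prod => i m Hm.
  have /(_ m Hm) := mdeg_leX (n := mon (enum_val a) i) (@mdeg_le_msize (y i)).
  move=> /leq_trans; apply; rewrite mnmE leq_mul //; first exact: ltnW.
  exact: (leq_bigmax (F := fun i => msize (y i))).
have := congr1 (mcoeff (mon (enum_val a0))) q0.
rewrite mcoeff0 raddf_sum (bigD1 a0) //= big1 => [|a aa0].
  by rewrite addr0 mcoeffZ mcoeffX eqxx mulr1 => /eqP; rewrite (negPf ca0).
rewrite mcoeffZ mcoeffX; case: eqP => [E|]; last by rewrite mulr0.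
case/eqP: aa0; apply: enum_val_inj; apply/ffunP => i; apply: val_inj.
by have := congr1 (fun m : 'X_{1..e} => m i) E; rewrite !mnmE.
Qed.

(** Each step down the chain of primes adds one independent element by [alg_indep_extend]; at the
    bottom all of them are independent over k. *)
Lemma ht_alg_indep_le h e P (y : 'I_e -> R) :
  ht_ge P h -> alg_indep P y -> (h + e <= d)%N.
Proof.
move=> [Q [primeQ [Qlt QP]]] indy.
have indh : alg_indep (Q h) y by move=> q /QP /indy.
have H j : (j <= h)%N -> exists z : 'I_(j + e) -> R, alg_indep (Q (h - j)%N) z.
  elim: j => [|j IH] jh; first by exists y; rewrite subn0.
  have [z indz] := IH (ltnW jh).
  have Ej : ((h - j.+1).+1 = h - j)%N by rewrite -subSn // subSS.
  have [|sub nsub] := Qlt (h - j.+1)%N; first by rewrite -Ej in IH *; lia.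
  rewrite Ej in sub nsub.
  have [w [Pw nQw]] : exists w, Q (h - j)%N w /\ ~ Q (h - j.+1)%N w.
    apply: boolp.contrapT => Hw; apply: nsub => w Pw.
    by apply: boolp.contrapT => nQw; apply: Hw; exists w.
  rewrite addSn; exists (fun i => oapp z w (unlift ord_max i)).
  by apply: (@alg_indep_extend _ (Q (h - j)%N)) => //; apply: primeQ; lia.
have [z indz] := H h (leqnn h).
apply: (@alg_indep_bound _ z) => q Eq; apply: indz; rewrite subnn Eq.
by have [[]] := primeQ 0%N isT.
Qed.

Lemma height_exists P e (y : 'I_e -> R) : prime_ideal P -> alg_indep P y ->
  exists h, height_eq P h /\ (h + e <= d)%N.
Proof.
move=> primeP indy.
have ht0 : ht_ge P 0.
  by exists (fun _ => P); split=> //; split=> // a.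
have ex : exists h, boolp.asbool (ht_ge P h) by exists 0%N; apply/boolp.asboolP.
have ub h : boolp.asbool (ht_ge P h) -> (h <= d)%N.
  by move=> /boolp.asboolP /ht_alg_indep_le /(_ indy); apply: leq_trans; rewrite leq_addr.
case: (ex_maxnP ex ub) => h /boolp.asboolP hth maxh.
exists h; split; last exact: ht_alg_indep_le indy.
split=> // /boolp.asboolP /maxh; by rewrite ltnn.
Qed.

End Transcendence.

(** * Ideals of linear forms *)

Section LinearForms.
Variables (R : idomainType) (m d : nat) (phi : 'M[R]_(m, d)).
Local Notation SR := {mpoly R[m]}.

Definition linform (c : 'I_d) : SR := \sum_i (phi i c)%:MP * 'X_i.
Definition linJ (cs : seq 'I_d) : SR -> Prop := inI (map linform cs).

Lemma rmorph_linform (S : comNzRingType) (F : {rmorphism SR -> S}) c :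
  F (linform c) = \sum_i F (phi i c)%:MP * F 'X_i.
Proof. by rewrite rmorph_sum /=; apply: eq_bigr => i _; rewrite rmorphM /=. Qed.

Section Elimination.
Variables (r : nat) (f : 'I_r -> 'I_m) (g : 'I_r -> 'I_d).
Hypothesis f_inj : injective f.
Let N := mxsub f g phi.
Let delta := \det N.
Hypothesis delta0 : delta != 0.
Let J := linJ (map g (enum 'I_r)).

Let preim i : option 'I_r := [pick a | f a == i].

Fact preimP i a : preim i = Some a -> f a = i.
Proof. by rewrite /preim; case: pickP => // b /eqP E [<-]. Qed.
Fact preim_f a : preim (f a) = Some a.
Proof.
rewrite /preim; case: pickP => [b /eqP /f_inj -> //|/(_ a)]; by rewrite eqxx.
Qed.

Definition restvar i : SR := if preim i is Some _ then 0 else 'X_i.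
Definition restform c : SR := \sum_i (phi i (g c))%:MP * restvar i.
(** Cramer's rule: modulo the chosen forms, delta times the pivot variable ['X_(f a)] equals
    [pivotval a]. *)
Definition pivotval a : SR := - \sum_c restform c * (\adj N c a)%:MP.

Definition restproj : SR -> SR := mhom (@mpolyC m R) restvar.
HB.instance Definition _ := GRing.RMorphism.copy restproj (mhom (@mpolyC m R) restvar).
(** Solving for the pivot variables would divide by delta. Scaling the other variables by delta
    instead keeps the substitution over R, and on them it agrees with the injective map
    [rescale]. *)
Definition eliminate_var i : SR :=
  if preim i is Some a then pivotval a else delta%:MP * 'X_i.
Definition eliminate : SR -> SR := mhom (@mpolyC m R) eliminate_var.
HB.instance Definition _ :=
  GRing.RMorphism.copy eliminate (mhom (@mpolyC m R) eliminate_var).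
Definition rescale : SR -> SR := mhom (@mpolyC m R) (fun i => delta%:MP * 'X_i).
HB.instance Definition _ :=
  GRing.RMorphism.copy rescale (mhom (@mpolyC m R) (fun i => delta%:MP * 'X_i)).

Fact eliminateC c : eliminate c%:MP = c%:MP. Proof. exact: mhomC. Qed.
Fact eliminateX i : eliminate 'X_i =
  if preim i is Some a then pivotval a else delta%:MP * 'X_i.
Proof. exact: mhomU. Qed.
Fact rescaleC c : rescale c%:MP = c%:MP. Proof. exact: mhomC. Qed.
Fact rescaleX i : rescale 'X_i = delta%:MP * 'X_i. Proof. exact: mhomU. Qed.

Fact restprojX i : restproj 'X_i = restvar i.
Proof. exact: mhomU. Qed.
Fact restprojC c : restproj c%:MP = c%:MP.
Proof. exact: mhomC. Qed.
Fact restproj_restvar i : restproj (restvar i) = restvar i.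
Proof.
rewrite /restvar; case E: (preim i); rewrite ?rmorph0 // restprojX.
by rewrite /restvar E.
Qed.

(* [F] only involves the variables outside the rows of the pivot minor *)
Definition is_rest (F : SR) := restproj F = F.

Fact is_restC c : is_rest c%:MP. Proof. exact: restprojC. Qed.
Fact is_restM F G : is_rest F -> is_rest G -> is_rest (F * G).
Proof. by rewrite /is_rest rmorphM /= => -> ->. Qed.
Fact is_restD F G : is_rest F -> is_rest G -> is_rest (F + G).
Proof. by rewrite /is_rest rmorphD /= => -> ->. Qed.
Fact is_rest_sum (I : Type) (s : seq I) (P : pred I) (F : I -> SR) :
  (forall i, P i -> is_rest (F i)) -> is_rest (\sum_(i <- s | P i) F i).
Proof.
move=> H; apply: (big_ind is_rest) => //; last exact: is_restD.
exact: rmorph0.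
Qed.
Fact is_rest_form c : is_rest (restform c).
Proof.
apply: is_rest_sum => i _; apply: is_restM; first exact: is_restC.
exact: restproj_restvar.
Qed.
Fact is_rest_pivotval a : is_rest (pivotval a).
Proof.
rewrite /is_rest rmorphN /=; congr (- _); apply: is_rest_sum => c _.
by apply: is_restM; [exact: is_rest_form|exact: is_restC].
Qed.

Lemma linform_split c : linform (g c) =
  \sum_a (N a c)%:MP * 'X_(f a) + restform c.
Proof.
rewrite /linform /restform (bigID (mem (codom f))) /=; congr (_ + _).
  rewrite (eq_bigl (mem [set f a | a : 'I_r])) /=; last first.
    move=> i; apply/codomP/imsetP => [[a ->]|[a _ ->]]; exists a => //.
  rewrite big_imset /=; last by move=> a b _ _ /f_inj.
  by rewrite big_mkcond; apply: eq_bigr => a _; rewrite mxE.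
rewrite [RHS](bigID (mem (codom f))) /= [X in _ = X + _]big1 ?add0r.
  apply: eq_bigr => i Hi; rewrite /restvar; case E: (preim i) => [a|//].
  by case/negP: Hi; rewrite -(preimP E) codom_f.
by move=> i /codomP [a ->]; rewrite /restvar preim_f mulr0.
Qed.

Lemma eliminate_linform c : eliminate (linform (g c)) = 0.
Proof.
rewrite linform_split rmorphD /= rmorph_sum /=.
have -> : eliminate (restform c) = delta%:MP * restform c.
  rewrite /restform rmorph_sum /= mulr_sumr; apply: eq_bigr => i _.
  rewrite rmorphM /= eliminateC mulrCA; congr (_ * _).
  by rewrite /restvar; case E: (preim i); rewrite ?rmorph0 ?mulr0 // eliminateX E.
rewrite (eq_bigr (fun a => - \sum_c' restform c' * ((\adj N c' a) * N a c)%:MP)); last first.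
  move=> a _; rewrite rmorphM /= eliminateC eliminateX preim_f /pivotval.
  rewrite mulrN mulr_sumr; congr (- _); apply: eq_bigr => c' _.
  by rewrite mpolyCM; ring.
rewrite sumrN exchange_big /= (eq_bigr (fun c' => restform c' * ((delta *+ (c' == c))%:MP))).
  rewrite (bigD1 c) //= eqxx mulr1n big1 ?addr0.
    by rewrite mulrC addNr.
  by move=> c' /negPf ->; rewrite mulr0n mpolyC0 mulr0.
move=> c' _; rewrite -mulr_sumr; congr (_ * _).
rewrite -raddf_sum /=; congr (_%:MP).
by have /matrixP /(_ c' c) := mul_adj_mx N; rewrite !mxE.
Qed.

Lemma eliminate_linJ F : J F -> eliminate F = 0.
Proof.
rewrite /J /linJ -map_comp => /inI_sumP [h [_ ->]].
rewrite rmorph_sum /= big1 // => a _.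
by rewrite rmorphM /= eliminate_linform mulr0.
Qed.

Lemma rescale_inj F : rescale F = 0 -> F = 0.
Proof.
have E G mm : (rescale G)@_mm = delta ^+ mdeg mm * G@_mm.
  rewrite [in LHS](mpolyE G) [in RHS](mpolyE G) rmorph_sum /= !raddf_sum /= mulr_sumr.
  apply: eq_bigr => m1 _.
  rewrite -[in LHS]mul_mpolyC -[in RHS]mul_mpolyC rmorphM /= rescaleC /rescale mhomX !mcoeffCM.
  rewrite (eq_bigr (fun i => (delta ^+ m1 i)%:MP * 'X_i ^+ m1 i)); last first.
    by move=> i _; rewrite exprMn rmorphXn /=.
  rewrite big_split /= -mpolyXE_id -rmorph_prod /= prodrXr mcoeffCM mcoeffX.
  by rewrite -mdegE; case: eqP => [->|]; rewrite ?mulr0 //; ring.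
move=> H; apply/mpolyP => mm; rewrite mcoeff0.
have /eqP := congr1 (mcoeff mm) H; rewrite E mcoeff0 mulf_eq0.
by rewrite expf_eq0 (negPf delta0) andbF => /eqP.
Qed.

(** With [linJ_elim], this says that inverting delta turns the quotient by the pivot forms into the
    polynomial ring in the non-pivot variables. *)
Lemma linJ_rest F : is_rest F -> J F -> F = 0.
Proof.
move=> restF /eliminate_linJ H; apply: rescale_inj; rewrite -restF.
transitivity (eliminate (restproj F)); last by rewrite restF.
apply: (mpoly_rmorph_eq (f := rescale \o restproj) (g := eliminate \o restproj)) => [c|i] /=.
  by rewrite restprojC rescaleC eliminateC.
rewrite restprojX /restvar; case E: (preim i); first by rewrite !rmorph0.
by rewrite rescaleX eliminateX E.
Qed.

Lemma linJ_elim F : exists n F', is_rest F' /\ J ((delta ^+ n)%:MP * F - F').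
Proof.
pose P F := exists n F', is_rest F' /\ J ((delta ^+ n)%:MP * F - F').
have PC c : P c%:MP.
  exists 0%N, c%:MP; split; first exact: is_restC.
  by rewrite mpolyC1 mul1r subrr; exact: inI0.
have PX i : P 'X_i.
  case E: (preim i) => [a|]; last first.
    exists 0%N, 'X_i; rewrite mpolyC1 mul1r subrr; split; last exact: inI0.
    by rewrite /is_rest restprojX /restvar E.
  exists 1%N, (pivotval a); split; first exact: is_rest_pivotval.
  have -> : (delta ^+ 1)%:MP * 'X_i - pivotval a =
      \sum_c (\adj N c a)%:MP * linform (g c).
    transitivity (\sum_b (\sum_c (N b c * \adj N c a)%:MP) * 'X_(f b) - pivotval a).
      congr (_ - _); rewrite expr1 (bigD1 a) //= [X in _ + X]big1 ?addr0.
        rewrite -(preimP E); congr (_ * _); rewrite -raddf_sum /=; congr (_%:MP).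
        by have /matrixP /(_ a a) := mul_mx_adj N; rewrite !mxE eqxx mulr1n.
      move=> b /negPf ba; rewrite -raddf_sum /=.
      have /matrixP /(_ b a) := mul_mx_adj N; rewrite !mxE ba mulr0n => ->.
      by rewrite mpolyC0 mul0r.
    under [RHS]eq_bigr => c _ do rewrite linform_split mulrDr mulr_sumr.
    rewrite big_split /= /pivotval opprK; congr (_ + _); last first.
      by apply: eq_bigr => c _; rewrite mulrC.
    rewrite exchange_big /=; apply: eq_bigr => b _; rewrite mulr_suml.
    by apply: eq_bigr => c _; rewrite mpolyCM; ring.
  apply: inI_sum => c _; apply: inIM; apply: mem_inI.
  by rewrite -map_comp; apply/mapP; exists c; rewrite ?mem_enum.
have PM F1 F2 : P F1 -> P F2 -> P (F1 * F2).
  move=> [n1 [G1 [r1 J1]]] [n2 [G2 [r2 J2]]]; exists (n1 + n2)%N, (G1 * G2).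
  split; first exact: is_restM.
  have -> : (delta ^+ (n1 + n2))%:MP * (F1 * F2) - G1 * G2 =
    (delta ^+ n2)%:MP * F2 * ((delta ^+ n1)%:MP * F1 - G1)
    + G1 * ((delta ^+ n2)%:MP * F2 - G2) by rewrite exprD mpolyCM; ring.
  by apply: inID; apply: inIM.
have PD F1 F2 : P F1 -> P F2 -> P (F1 + F2).
  move=> [n1 [G1 [r1 J1]]] [n2 [G2 [r2 J2]]]; exists (n1 + n2)%N,
    ((delta ^+ n2)%:MP * G1 + (delta ^+ n1)%:MP * G2).
  split; first by apply: is_restD; apply: is_restM => //; exact: is_restC.
  have -> : (delta ^+ (n1 + n2))%:MP * (F1 + F2) -
     ((delta ^+ n2)%:MP * G1 + (delta ^+ n1)%:MP * G2) =
    (delta ^+ n2)%:MP * ((delta ^+ n1)%:MP * F1 - G1)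
    + (delta ^+ n1)%:MP * ((delta ^+ n2)%:MP * F2 - G2) by rewrite exprD mpolyCM; ring.
  by apply: inID; apply: inIM.
elim/mpolyind: F => [|c mm p _ _ IH]; first by rewrite -mpolyC0; exact: PC.
apply: (PD) IH; rewrite -mul_mpolyC; apply: (PM) => //; rewrite mpolyXE_id.
have P1 : P 1 by rewrite -mpolyC1; exact: PC.
apply: (big_ind P) => // i _; elim: (mm i) => [|n IHn]; rewrite ?expr0 //.
by rewrite exprS; apply: (PM).
Qed.

End Elimination.
Definition lin_prime cs := forall F G,
  linJ cs (F * G) -> linJ cs F \/ linJ cs G.

Hypothesis phi_inj : forall w : 'cV_d, phi *m w = 0 -> w = 0.

Lemma cols_minor r (g : 'I_r -> 'I_d) : injective g ->
  exists f : 'I_r -> 'I_m, injective f /\ \det (mxsub f g phi) != 0.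
Proof.
move=> g_inj; have [w Hw|f [f_inj Hf]] := @minor_of_injective _ _ _ (colsub g phi).
  pose v : 'cV_d := \col_c \sum_(a | g a == c) w a 0.
  have v0 : v = 0.
    apply: phi_inj; rewrite -{}[RHS]Hw; apply/colP => i; rewrite !mxE.
    rewrite (partition_big g xpredT) //=; apply: eq_bigr => c _.
    rewrite !mxE mulr_sumr; apply: eq_bigr => a /eqP <-.
    by rewrite mxE.
  apply/colP => a; have := congr1 (fun u : 'cV_d => u (g a) 0) v0.
  by rewrite !mxE (big_pred1 a) // => b; rewrite /= (inj_eq g_inj).
exists f; split=> //; congr (\det _ != 0): Hf.
by apply/matrixP => i j; rewrite !mxE.
Qed.

(** Derivatives at T = 0 read off the linear coefficients of a relation. They would give a vector in
    the kernel of [phi] whose entry at c is 1. *)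
Lemma linform_notin c cs : c \notin cs -> ~ linJ cs (linform c).
Proof.
move=> ccs /inI_sumP [h [h0 E]].
have D (a : SR) i c' : (a * linform c')^`M(i).@[fun _ => 0] =
    a.@[fun _ => 0] * phi i c'.
  have ev0 : (linform c').@[fun _ => 0] = 0.
    rewrite /linform raddf_sum big1 // => j _.
    by rewrite /= mevalM mevalXU mulr0.
  have evD : (linform c')^`M(i).@[fun _ => 0] = phi i c'.
    rewrite /linform (raddf_sum (mderiv i)) (raddf_sum (meval _)) (bigD1 i) //=.
    rewrite [X in _ + X]big1 ?addr0.
      rewrite mderiv_mulC mevalM mevalC mderivX mnm1E eqxx.
      have -> : (U_(i) - U_(i) = 0 :> 'X_{1..m})%MM by apply/mnmP => j; rewrite mnmBE subnn mnm0E.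
      by rewrite mpolyX0 scale1r meval1 mulr1.
    move=> j ji; rewrite mderiv_mulC mevalM mderivX mnm1E (negPf ji).
    by rewrite scale0r meval0 mulr0.
  by rewrite mderivM mevalD !mevalM ev0 evD mulr0 add0r.
pose v : 'cV_d := \col_c' ((c' == c)%:R - (h c').@[fun _ => 0]).
have v0 : v = 0.
  apply: phi_inj; apply/colP => i; rewrite !mxE.
  have := congr1 (fun F : SR => F^`M(i).@[fun _ => 0]) E.
  rewrite -[linform c]mul1r D meval1 mul1r (raddf_sum (mderiv i)) (raddf_sum (meval _)) /= => E1.
  under eq_bigr => j _ do rewrite mxE mulrBr.
  rewrite sumrB (bigD1 c) //= eqxx mulr1 big1 ?addr0.
    rewrite E1; apply/eqP; rewrite subr_eq0; apply/eqP; apply: eq_bigr => j _.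
    by rewrite D mulrC.
  by move=> j /negPf ->; rewrite mulr0.
have := congr1 (fun u : 'cV_d => u c 0) v0; rewrite !mxE eqxx h0 // meval0 subr0.
by apply/eqP; exact: oner_neq0.
Qed.

(** Up to powers of delta, F and G are polynomials in the non-pivot variables over a domain, and
    there their product is 0. Torsion-freeness removes the powers. *)
Lemma lin_prime_torsion_free cs : uniq cs ->
  (forall F r, r != 0 -> linJ cs (r%:MP * F) -> linJ cs F) -> lin_prime cs.
Proof.
move=> Ucs TF F G HFG.
pose g (a : 'I_(size cs)) := tnth (in_tuple cs) a.
have g_inj : injective g by move=> a b; apply: tuple_uniqP.
have Ecs : map g (enum 'I_(size cs)) = cs by rewrite -[RHS](map_tnth_enum (in_tuple cs)).
have [f [f_inj delta0]] := cols_minor g_inj.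
have [n1 [F' [rF JF]]] := linJ_elim g f_inj F.
have [n2 [G' [rG JG]]] := linJ_elim g f_inj G.
rewrite Ecs in JF JG.
have : F' * G' = 0.
  apply: (linJ_rest f_inj delta0); first exact: is_restM.
  rewrite Ecs; have : linJ cs (((\det (mxsub f g phi)) ^+ n1)%:MP * F * (((\det (mxsub f g phi)) ^+ n2)%:MP * G)).
    by rewrite mulrACA; apply: inIM.
  apply: (inI_eq _).1.
  set u := _ * F in JF *; set v := _ * G in JG *.
  have -> : u * v - F' * G' = v * (u - F') + F' * (v - G') by ring.
  by apply: inID; apply: inIM.
move=> /eqP; rewrite mulf_eq0 => /orP [] /eqP E; rewrite E subr0 in JF JG; [left|right].
  by apply: TF JF; rewrite expf_neq0.
by apply: TF JG; rewrite expf_neq0.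
Qed.

End LinearForms.

(** * Torsion modulo linear forms *)

Lemma common_multiplier (A : comNzRingType) (Q : A -> Prop) (I : eqType) (r : seq I)
    (J : I -> A -> Prop) :
  prime_ideal Q -> (forall i, is_ideal (J i)) ->
  (forall i, i \in r -> exists2 w, ~ Q w & J i w) ->
  exists2 w, ~ Q w & forall i, i \in r -> J i w.
Proof.
move=> [idQ [Q1 Qpr]] idJ; elim: r => [|i r IH] H; first by exists 1.
have [w nQw Hw] := IH (fun j jr => H j (mem_behead (s := i :: r) jr)).
have [u nQu Hu] := H i (mem_head i r).
exists (w * u) => [/Qpr [] //|j]; rewrite inE => /orP [/eqP ->|/Hw Jw].
  by have [_ [_ M]] := idJ i; apply: M.
by rewrite mulrC; have [_ [_ M]] := idJ j; apply: M.
Qed.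

(** * Polynomials in separate variables *)

Section Variables.
Variables (k : fieldType) (d : nat).
Local Notation R := {mpoly k[d]}.
Implicit Types (Y Z : {set 'I_d}) (j : 'I_d) (P : R -> Prop).

Definition projv Y : R -> R :=
  mhom (@mpolyC d k) (fun i => if i \in Y then 'X_i else 0).
HB.instance Definition _ Y := GRing.RMorphism.copy (projv Y)
  (mhom (@mpolyC d k) (fun i => if i \in Y then 'X_i else 0)).
Definition only_vars Y (a : R) := projv Y a = a.

Lemma projvC Y c : projv Y c%:MP = c%:MP. Proof. exact: mhomC. Qed.
Lemma projvX Y i : projv Y 'X_i = if i \in Y then 'X_i else 0.
Proof. exact: mhomU. Qed.

Lemma only_varsT a : only_vars [set: 'I_d] a.
Proof.
apply: (mpoly_rmorph_eq (f := projv [set: 'I_d]) (g := idfun)) => [c|i] /=.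
  exact: projvC.
by rewrite projvX inE.
Qed.

Lemma only_vars0 a : only_vars set0 a -> exists c, a = c%:MP.
Proof.
move=> <-; exists a@_0; apply: (mpoly_rmorph_eq (f := projv set0)
  (g := @mpolyC d k \o mcoeff 0%MM)) => [c|i] /=.
  by rewrite projvC mcoeffC eqxx mulr1.
by rewrite projvX inE mcoeffX mnm1_eq0 mpolyC0.
Qed.

Definition asuni j : R -> {poly R} :=
  mhom (polyC \o @mpolyC d k) (fun i => if i == j then 'X else ('X_i : R)%:P).
HB.instance Definition _ j := GRing.RMorphism.copy (asuni j)
  (mhom (polyC \o @mpolyC d k) (fun i => if i == j then 'X else ('X_i : R)%:P)).

Lemma asuniC j c : asuni j c%:MP = (c%:MP)%:P.
Proof. exact: mhomC. Qed.
Lemma asuniX j i : asuni j 'X_i = if i == j then 'X else ('X_i)%:P.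
Proof. exact: mhomU. Qed.

Lemma asuniK j a : (asuni j a).['X_j] = a.
Proof.
apply: (mpoly_rmorph_eq (f := horner_eval 'X_j \o asuni j) (g := idfun)) => [c|i] /=.
  by rewrite asuniC /horner_eval hornerC.
rewrite asuniX /horner_eval; case: eqP => [->|_]; by rewrite ?hornerX ?hornerC.
Qed.

Lemma asuni_const Y j a : j \notin Y -> only_vars Y a -> asuni j a = a%:P.
Proof.
move=> jY <-.
apply: (mpoly_rmorph_eq (f := asuni j \o projv Y) (g := polyC \o projv Y)) => [c|i] /=.
  by rewrite projvC asuniC.
rewrite projvX; case: ifP => iY; last by rewrite !rmorph0.
by rewrite asuniX; case: eqP jY => [<-|//]; rewrite iY.
Qed.

Lemma asuni_coef Z j a l : only_vars (j |: Z) a -> only_vars Z (asuni j a)`_l.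
Proof.
move=> Ha; suff E : map_poly (projv Z) (asuni j a) = asuni j a.
  by rewrite /only_vars -coef_map E.
rewrite -Ha.
apply: (mpoly_rmorph_eq (f := map_poly (projv Z) \o asuni j \o projv (j |: Z))
  (g := asuni j \o projv (j |: Z))) => [c|i] /=.
  by rewrite projvC asuniC map_polyC /= projvC.
rewrite projvX in_setU1; case: eqP => [->|ij] /=.
  by rewrite asuniX eqxx map_polyX.
case: ifP => iZ; last by rewrite !rmorph0.
by rewrite asuniX; case: eqP => // _; rewrite map_polyC /= projvX iZ.
Qed.

Section SeparateVariables.
Variables (P : R -> Prop) (Z : {set 'I_d}) (p : 'I_d -> R).
Hypothesis primeP : prime_ideal P.
Hypothesis PZ : forall a, only_vars Z a -> P a -> a = 0.
Hypothesis p0 : forall j, j \notin Z -> p j != 0.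
Hypothesis pZ : forall j, j \notin Z -> only_vars (j |: Z) (p j).

(** The [p i] with i in [js] do not involve x_j, so membership in their ideal is tested on the
    coefficients in x_j. The leading coefficient of [p j] is a nonzero polynomial in Z, hence
    outside P; descending through the coefficients of a, one of its powers is a suitable w. *)
Lemma separate_regular j js a : j \notin Z -> j \notin js ->
  (forall i, i \in js -> i \notin Z) ->
  inI (map p js) (p j * a) -> exists2 w, ~ P w & inI (map p js) (w * a).
Proof.
move=> jZ jjs jsZ Hpa.
have [idP [P1 Ppr]] := primeP.
have Hcoef b l : inI (map p js) b -> inI (map p js) (asuni j b)`_l.
  move=> /inI_sumP [h [h0 ->]]; rewrite rmorph_sum /= coef_sum.
  rewrite (eq_bigr (fun i => (asuni j (h i))`_l * p i)).
    by apply: sum_inI => i /h0 ->; rewrite rmorph0 coef0.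
  move=> i _; rewrite rmorphM /=; case: (boolP (i \in js)) => [ijs|/h0 ->]; last first.
    by rewrite rmorph0 mul0r !coef0 mul0r.
  rewrite (asuni_const (Y := i |: Z) _ (pZ (jsZ i ijs))) ?coefMC //.
  by rewrite in_setU1 negb_or jZ andbT; apply: contraNneq jjs => ->.
pose q := asuni j (p j); pose A := asuni j a.
have q0 : q != 0 by apply: contraNneq (p0 jZ) => E; rewrite -(asuniK j (p j)) -/q E horner0.
pose D := (size q).-1.
have nPlc : ~ P q`_D.
  move=> /(PZ (asuni_coef _ (pZ jZ))) /eqP; rewrite -/q.
  by rewrite -[q`_D]/(lead_coef q) lead_coef_eq0 (negPf q0).
have C n l : (size A <= n + l)%N ->
    exists2 w, ~ P w & forall l', (l <= l')%N -> inI (map p js) (w * A`_l').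
  elim: n l => [|n IH] l Hl.
    by exists 1 => // l' ll'; rewrite nth_default ?mulr0; [exact: inI0|exact: leq_trans Hl ll'].

  have [|w nPw Hw] := IH l.+1; first by rewrite addnS -addSn.
  exists (w * q`_D) => [/Ppr [] //|l']; rewrite leq_eqVlt => /orP [/eqP <-|ll']; last first.
    by rewrite mulrAC; apply: inIMr; apply: Hw.
  have : inI (map p js) (w * (q * A)`_(D + l)).
    by apply: inIM; rewrite /q /A -rmorphM /=; apply: Hcoef.
  rewrite coefM (bigD1 (inord D)) //= inordK; last by lia.
  rewrite addKn mulrDr mulrA => H.
  rewrite -(addrK (w * \sum_(i < (D + l).+1 | i != inord D) q`_i * A`_(D + l - i)) (w * q`_D * A`_l)).
  apply: inIB => //; rewrite mulr_sumr; apply: inI_sum => i iD.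
  case: (ltngtP i D) => [lt|gt|E].
  - by rewrite mulrCA; apply: inIM; apply: Hw; rewrite ltn_subRL ltn_add2r.
  - by rewrite [q`_i]nth_default ?mul0r ?mulr0; [exact: inI0|exact: leq_trans (leqSpred _) gt].
  - by case/eqP: iD; apply: val_inj; rewrite /= inordK // ltnS leq_addr.
have [|w nPw Hw] := C (size A) 0%N; first by rewrite addn0.
exists w => //; rewrite -(asuniK j a) -/A horner_coef mulr_sumr.
by apply: inI_sum => i _; rewrite mulrA; apply: inIMr; apply: Hw.
Qed.

End SeparateVariables.

Lemma inI_mpolyC m (gs : seq R) (F : {mpoly R[m]}) :
  inI (map (@mpolyC m R) gs) F <-> forall mm, inI gs F@_mm.
Proof.
split=> [|H].
  elim: gs F => [|g gs IH] F /=; first by move=> -> mm; rewrite mcoeff0.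
  move=> [b /IH H] mm; exists b@_mm.
  by have := H mm; rewrite mcoeffB mulrC mcoeffCM mulrC.
rewrite (mpolyE F); apply: inI_sum => mm _; rewrite -mul_mpolyC.
by apply: inIMr; apply: (inI_rmorph (@mpolyC m R)).
Qed.

End Variables.

Lemma rank_colsub (K : fieldType) m d s (M : 'M[K]_(m, d)) (g : 'I_s -> 'I_d) :
  injective g -> (\rank M <= \rank (colsub g M) + (d - s))%N.
Proof.
move=> g_inj; rewrite -[\rank M]mxrank_tr -[X in (_ <= X + _)%N]mxrank_tr.
set A := (colsub g M)^T.
pose h (i : 'I_#|~: [set g a | a : 'I_s]|) : 'I_d := enum_val i.
pose B := rowsub h M^T.
have sub : (M^T <= A + B)%MS.
  apply/row_subP => i; case: (boolP (i \in [set g a | a : 'I_s])) => [/imsetP [a _ ->]|Hi].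
    apply: submx_trans (addsmxSl _ _).
    have -> : row (g a) M^T = row a A by apply/rowP => j; rewrite !mxE.
    exact: row_sub.
  have Hi' : i \in ~: [set g a | a : 'I_s] by rewrite inE.
  apply: submx_trans (addsmxSr _ _).
  have -> : row i M^T = row (enum_rank_in Hi' i) B.
    by apply/rowP => j; rewrite !mxE /h enum_rankK_in.
  exact: row_sub.
apply: leq_trans (mxrankS sub) _; apply: leq_trans (mxrank_adds_leqif A B) _.
rewrite leq_add2l; apply: leq_trans (rank_leq_row B) _.
have := cardsC [set g a | a : 'I_s].
by rewrite card_imset // !card_ord; lia.
Qed.

(** * The torsion dichotomy *)

Section TorsionFree.
Variables (k : fieldType) (m d : nat).
Local Notation R := {mpoly k[d]}.
Variable phi : 'M[R]_(m, d).
Local Notation SR := {mpoly R[m]}.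
Local Notation J := (linJ phi).

Hypothesis phi_inj : forall w : 'cV_d, phi *m w = 0 -> w = 0.
(* the rank form of the condition [G_d] *)
Hypothesis rank_phi : forall (P : R -> Prop) (Z : {set 'I_d}) (K : fieldType)
    (chi : {rmorphism R -> K}),
  prime_ideal P -> (forall a, chi a = 0 <-> P a) ->
  (0 < #|Z|)%N -> (#|Z| < d)%N -> (forall a, only_vars Z a -> P a -> a = 0) ->
  (#|Z| < \rank (map_mx chi phi))%N.

Lemma max_indep (I : R -> Prop) : (forall a, only_vars set0 a -> I a -> a = 0) ->
  exists Z : {set 'I_d}, (forall a, only_vars Z a -> I a -> a = 0) /\
    forall j, j \notin Z -> exists a, [/\ only_vars (j |: Z) a, I a & a != 0].
Proof.
move=> I0.
pose ok (Z : {set 'I_d}) := boolp.asbool (forall a, only_vars Z a -> I a -> a = 0).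
have ok0 : ok set0 by apply/boolp.asboolP.
case: (arg_maxnP (fun Z : {set 'I_d} => #|Z|) ok0) => Z /boolp.asboolP okZ maxZ.
exists Z; split=> // j jZ; apply: boolp.contrapT => H.
have /maxZ : ok (j |: Z).
  apply/boolp.asboolP => a Ha Ia; apply/eqP; apply: boolp.contrapT => /negP a0.
  by apply: H; exists a.
by rewrite cardsU1 jZ add1n => /(leq_trans (ltnSn _)); rewrite ltnn.
Qed.

Lemma torsion_dichotomy cs F r0 : uniq cs ->
  (forall cs', uniq cs' -> {subset cs' <= cs} -> (size cs' < size cs)%N ->
     lin_prime phi cs') ->
  r0 != 0 -> J cs (r0%:MP * F) ->
  J cs F \/ (size cs = d /\
    forall j, exists a, [/\ only_vars [set j] a, a != 0 & J cs (a%:MP * F)]).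
Proof.
move=> Ucs IH r00 Hr0; case: (boolp.EM (J cs F)) => [|nJF]; [by left|right].
pose I (a : R) : Prop := J cs (a%:MP * F).
have idI : is_ideal I.
  split; first by rewrite /I mpolyC0 mul0r; exact: inI0.
  split=> [a b|a b]; rewrite /I ?mpolyCD ?mpolyCM ?mulrDl; first exact: inID.
  by rewrite -mulrA; apply: inIM.
have I0 a : only_vars set0 a -> I a -> a = 0.
  move=> /only_vars0 [c ->] Ic; case: (eqVneq c 0) => [->|c0]; first exact: mpolyC0.
  case: nJF; have -> : F = ((c^-1)%:MP)%:MP * ((c%:MP)%:MP * F).
    by rewrite mulrA -!mpolyCM mulVf // !mpolyC1 mul1r.
  exact: inIM.
have [Z [indZ depZ]] := max_indep I0.
have /boolp.choice [p Hp] : forall j, exists a, j \notin Z ->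
    [/\ only_vars (j |: Z) a, I a & a != 0].
  move=> j; case: (boolP (j \in Z)) => jZ; first by exists 0.
  by have [a Ha] := depZ j jZ; exists a.
have ZT : (#|Z| < d)%N.
  rewrite -[X in (_ < X)%N]card_ord -cardsT proper_card //.
  rewrite properT; apply: contraNneq r00 => ZT; apply/eqP; apply: indZ => //.
  by rewrite ZT; exact: only_varsT.
case: (boolP ((size cs == d) && (Z == set0))) => [/andP [/eqP sz /eqP Z0]|case2].
  split=> // j; have [|H1 H2 H3] := Hp j; first by rewrite Z0 inE.
  by exists (p j); split=> //; rewrite Z0 setU0 in H1.
(* The contradiction aimed at: F becomes zero modulo the forms after localising at a prime P that
   contains its annihilator I. *)
exfalso.
pose W0 (a : R) : Prop := only_vars Z a /\ a != 0.
have [|a b [Za a0] [Zb b0]|a Ia [Za a0]|P [primeP IP PW]] := @prime_avoiding {mpoly k[d]} I W0 idI.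
- by split; [rewrite /only_vars rmorph1|exact: oner_neq0].
- by split; [rewrite /only_vars rmorphM /= Za Zb|rewrite mulf_neq0].
- by case/eqP: a0; apply: indZ.
have PZ a : only_vars Z a -> P a -> a = 0.
  by move=> Za /PW H; apply/eqP; apply: boolp.contrapT => /negP a0; apply: H.
have [K [chi chiP]] := residue_field primeP.
pose g1 (a : 'I_(size cs)) := tnth (in_tuple cs) a.
have g1_inj : injective g1 by move=> a b; apply: tuple_uniqP.
(* A nonzero minor of maximal size modulo P lifts to a delta that is a unit at P; the pivot
   variables can be eliminated there. *)
pose M := colsub g1 (map_mx chi phi).
have [f [g0 [f_inj g0_inj det0]]] := minor_of_rank M.
pose g a := g1 (g0 a).
have g_inj : injective g by move=> a b /g1_inj /g0_inj.
have Eminor : mxsub f g0 M = map_mx chi (mxsub f g phi).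
  by apply/matrixP => i j; rewrite !mxE.
have delta0 : \det (mxsub f g phi) != 0.
  by apply: contraNneq det0 => E; rewrite Eminor det_map_mx E rmorph0.
have nPdelta n : ~ P (\det (mxsub f g phi) ^+ n).
  move=> /chiP /eqP; rewrite rmorphXn /= expf_eq0 -det_map_mx -Eminor (negPf det0).
  by rewrite andbF.
pose cs1 := map g (enum 'I_(\rank M)).
pose cs2 := filter (fun c => c \notin cs1) cs.
have Ucs1 : uniq cs1 by rewrite map_inj_uniq // enum_uniq.
have sub1 : {subset cs1 <= cs}.
  by move=> c /mapP [a _ ->]; rewrite /g /g1; exact: mem_tnth.
have Ucs21 : uniq (cs2 ++ cs1).
  rewrite cat_uniq filter_uniq // Ucs1 andbT; apply/hasPn => c Hc.
  by rewrite mem_filter Hc.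
have mem21 : cs2 ++ cs1 =i cs.
  move=> c; rewrite mem_cat mem_filter; case: (boolP (c \in cs1)) => //= [/sub1 -> //|].
  by rewrite orbF.
have size21 : (size cs2 + \rank M = size cs)%N.
  have /perm_size := uniq_perm Ucs21 Ucs mem21.
  by rewrite size_cat size_map size_enum_ord.
have J21 G : J cs G <-> J (cs2 ++ cs1) G.
  by split; apply: inI_subset => x /mapP [c Hc ->]; apply: map_f; rewrite ?mem21 // -mem21.
have szcs : (size cs <= d)%N.
  by have /card_uniqP <- := Ucs; have := max_card (mem cs); rewrite card_ord.
(* the remaining columns are fewer than the parameters *)
have few : (size cs2 < #|~: Z|)%N.
  rewrite cardsCs setCK card_ord.
  (* For Z empty the excluded case leaves fewer than d columns. Otherwise |Z| < rank M + (d - size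
     cs), and size cs2 = size cs - rank M. *)
  case: (posnP #|Z|) => [Z0|Zpos].
    move/eqP: (Z0); rewrite cards_eq0 => Z0'; rewrite Z0' andbT in case2.
    by move: case2 szcs size21; lia.
  have H1 : (#|Z| < \rank (map_mx chi phi))%N := rank_phi primeP chiP Zpos ZT PZ.
  have H2 : (\rank (map_mx chi phi) <= \rank M + (d - size cs))%N := rank_colsub _ g1_inj.
  have := leq_trans H1 H2; move: szcs size21 ZT; clear.
  by move: (size cs) (size cs2) (\rank M) #|Z| => s1 s2 r z; lia.
pose W (x : SR) := exists2 w, ~ P w & x = w%:MP.
have W1 : W 1 by exists 1; [exact: primeP.2.1|rewrite mpolyC1].
have WM (x y : SR) : W x -> W y -> W (x * y).
  move=> [w nPw ->] [v nPv ->]; exists (w * v); last by rewrite mpolyCM.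
  by move=> /primeP.2.2 [].
pose ys := [seq (p j)%:MP | j <- enum (~: Z)] : seq SR.
have wregys : wreg W (map (linform phi) cs1) ys.
  have : all (fun j => j \notin Z) (enum (~: Z)).
    by apply/allP => j; rewrite mem_enum inE.
  rewrite /ys; elim: (enum _) (enum_uniq (mem (~: Z))) => [//|j js IHj] /= /andP [jjs Ujs].
  move=> /andP [jZ jsZ]; split; first exact: IHj.
  have jsZ' i : i \in js -> i \notin Z by move/(allP jsZ).
  move=> a /inI_cat [b Hb Hab].
  have [h [h0 Eb]] := inI_sumP (F := fun i => (p i)%:MP) Hb.
  have /boolp.choice [ne Hne] : forall i, exists ne : nat * SR, is_rest f ne.2 /\
      J cs1 ((\det (mxsub f g phi) ^+ ne.1)%:MP * h i - ne.2).
    by move=> i; have [n [e He]] := linJ_elim phi g f_inj (h i); exists (n, e).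
  have [n [a' [ra' Ja']]] := linJ_elim phi g f_inj a.
  set delta := \det (mxsub f g phi) in delta0 nPdelta Hne Ja' *.
  (* A common power of delta moves a and the relevant h i into the non-pivot variables. There a
     congruence modulo the pivot forms is an equality, and coefficients in R can be compared. *)
  pose e := (n + \sum_i (ne i).1)%N.
  pose a2 := (delta ^+ (e - n))%:MP * a'.
  pose h2 i := (if i \in js then (delta ^+ (e - (ne i).1))%:MP * (ne i).2 else 0) : SR.
  have ra2 : is_rest f a2 by apply: is_restM => //; exact: is_restC.
  have rh2 i : is_rest f (h2 i).
    rewrite /h2; case: ifP => _; last exact: rmorph0.
    by apply: is_restM; [exact: is_restC|exact: (Hne i).1].
  have scale l : (l <= e)%N -> (delta ^+ e = delta ^+ (e - l) * delta ^+ l).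
    by move=> le; rewrite -exprD subnK.
  have Ja2 : J cs1 ((delta ^+ e)%:MP * a - a2).
    rewrite /a2 (scale n) ?leq_addr // mpolyCM -mulrA -mulrBr.
    by apply: inIM.
  have Jh2 i : J cs1 ((delta ^+ e)%:MP * h i - h2 i).
    rewrite /h2; case: ifP => ijs; last by rewrite h0 ?ijs // mulr0 subr0; exact: inI0.
    rewrite (scale (ne i).1) ?mpolyCM -?mulrA -?mulrBr; last first.
      by rewrite /e (bigD1 i) //= addnCA leq_addr.
    by apply: inIM; exact: (Hne i).2.
  have E : (p j)%:MP * a2 = \sum_i h2 i * (p i)%:MP.
    apply/eqP; rewrite -subr_eq0; apply/eqP; apply: (linJ_rest f_inj delta0).
      rewrite /is_rest rmorphB /=; congr (_ - _).
        by apply: is_restM => //; exact: is_restC.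
      by apply: is_rest_sum => i _; apply: is_restM => //; exact: is_restC.
    rewrite -/cs1.
    have -> : (p j)%:MP * a2 - \sum_i h2 i * (p i)%:MP =
       (delta ^+ e)%:MP * ((p j)%:MP * a - b)
       - (p j)%:MP * ((delta ^+ e)%:MP * a - a2)
       + \sum_i ((delta ^+ e)%:MP * h i - h2 i) * (p i)%:MP.
      under [X in _ = _ + X]eq_bigr => i _ do rewrite mulrBl -mulrA.
      by rewrite sumrB -mulr_sumr -Eb; ring.
    apply: inID; first by apply: inIB; apply: inIM.
    by apply: inI_sum => i _; apply: inIMr; exact: Jh2.
  have /inI_mpolyC Hcoef : inI (map (@mpolyC m R) (map p js)) ((p j)%:MP * a2).
    rewrite E -map_comp; apply: sum_inI => i ijs.
    by rewrite /h2 (negPf ijs).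
  have [w nPw Hw] : exists2 w, ~ P w & forall mm, mm \in msupp a2 -> inI (map p js) (w * a2@_mm).
    apply: (common_multiplier primeP) => [mm|mm _].
      split; first by rewrite mul0r; exact: inI0.
      split=> [u v|u v]; first by rewrite mulrDl; exact: inID.
      by rewrite -mulrA; exact: inIM.
    have := Hcoef mm; rewrite mcoeffCM.
    apply: (separate_regular primeP PZ) => //.
      by move=> i iZ; have [] := Hp i iZ.
    by move=> i iZ; have [] := Hp i iZ.
  exists ((w * delta ^+ e)%:MP).
    by exists (w * delta ^+ e) => // /primeP.2.2 [//|]; exact: nPdelta.
  have -> : (w * delta ^+ e)%:MP * a = w%:MP * a2 + w%:MP * ((delta ^+ e)%:MP * a - a2).
    by rewrite mpolyCM; ring.
  apply: inID; last by apply: inI_catr; apply: inIM.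
  apply: inI_catl; rewrite map_comp; apply/inI_mpolyC => mm; rewrite mcoeffCM.
  case: (boolP (mm \in msupp a2)) => [/Hw //|/memN_msupp_eq0 ->].
  by rewrite mulr0; exact: inI0.
(* Fewer columns generate a prime ideal by the induction hypothesis, and it does not contain a
   further form. *)
have reg : regseq (map (linform phi) cs1) (map (linform phi) cs2).
  have : {subset cs2 <= cs} by move=> c; rewrite mem_filter => /andP [].
  have : (size cs2 + size cs1 <= size cs)%N.
    by rewrite /cs1 size_map size_enum_ord size21.
  elim: (cs2) Ucs21 => [//|c cs' IHc] /= /andP [ccs U] sz sub.
  have sub' : {subset cs' <= cs} by move=> x xcs; apply: sub; rewrite inE xcs orbT.
  split; first by apply: IHc => //; exact: ltnW.
  move=> a; rewrite -map_cat => Ha.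
  have pr : lin_prime phi (cs' ++ cs1).
    apply: IH => //; last by rewrite size_cat.
    by move=> x; rewrite mem_cat => /orP [/sub'|/sub1].
  by case: (pr _ _ Ha) => // /(linform_notin phi_inj ccs).
have szys : size ys = #|~: Z| by rewrite size_map -cardE.
(* F is a 0-cocycle for the [p j]. Vanishing in degree 0 yields w outside P with wF in the ideal, so
   w lies in I, which is contained in P. *)
have := kvan_regseq WM (kvan_wreg W1 WM wregys) reg (i := 0%N).
rewrite add0n size_map szys => /(_ few) /(_ (kcst F) (klev_kcst F)).
case=> [s _|x [b [[w nPw ->] lb Hb]]].
  rewrite kosD_kcst mulrC; apply: (kvec_in (P := fun y => inI _ (y * F))).
    by rewrite mul0r; exact: inI0.
  move=> y /mapP [j]; rewrite mem_enum inE => jZ ->; rewrite -map_cat.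
  by apply/J21; have [] := Hp j jZ.
have := Hb (nseq (size ys) false); rewrite size_nseq => /(_ erefl).
rewrite kosD0; last by move=> t; apply: lb.
rewrite subr0 /kcst has_nseq andbF -map_cat => /J21 Iw.
exact/nPw/IP.
Qed.

End TorsionFree.

(** * The Rees ideal as a torsion ideal *)

Lemma ideal_genP (A : comNzRingType) r (g : 'I_r -> A) a :
  ideal_gen g a <-> exists u : 'I_r -> A, a = \sum_i g i * u i.
Proof.
split=> [|[u ->]].
  apply: (span_ind (P := fun a => exists u : 'I_r -> A, a = \sum_i g i * u i)) => [|_ [i ->]].
    split; first by exists (fun _ => 0); rewrite big1 // => i _; rewrite mulr0.
    split=> [_ _ [u ->] [v ->]|c _ [u ->]].
      exists (fun i => u i + v i); rewrite -big_split; apply: eq_bigr => i _ /=.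
      by rewrite mulrDr.
    exists (fun i => c * u i); rewrite mulr_sumr; apply: eq_bigr => i _ /=.
    by rewrite mulrCA.
  exists (fun j => (j == i)%:R); rewrite (bigD1 i) //= eqxx mulr1 big1 ?addr0 //.
  by move=> j /negPf ->; rewrite mulr0.
have [I0 [ID IM]] := span_ideal (fun q => exists i, q = g i).
apply: (big_ind (ideal_gen g)) => // i _; rewrite mulrC; apply: IM.
by apply: span_gen; exists i.
Qed.

Section ReesTorsion.
Variables (R : idomainType) (d : nat).
Variables (alpha : 'rV[R]_(d.+1)) (phi : 'M[R]_(d.+1, d)).
Hypothesis phi_inj : forall w : 'cV_d, phi *m w = 0 -> w = 0.
Hypothesis alpha0 : alpha != 0.
Hypothesis alpha_phi : alpha *m phi = 0.

Definition rees_map : {mpoly R[d.+1]} -> {poly R} :=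
  mhom polyC (fun j => (alpha 0 j)%:P * 'X).
HB.instance Definition _ := GRing.RMorphism.copy rees_map
  (mhom polyC (fun j => (alpha 0 j)%:P * 'X)).

Fact rees_mapC c : rees_map c%:MP = c%:P. Proof. exact: mhomC. Qed.
Fact rees_mapX j : rees_map 'X_j = (alpha 0 j)%:P * 'X. Proof. exact: mhomU. Qed.

Lemma rees_linJall F : linJ phi (enum 'I_d) F -> rees_map F = 0.
Proof.
move=> /inI_sumP [h [_ ->]]; rewrite rmorph_sum /= big1 // => c _; rewrite rmorphM /=.
suff -> : rees_map (linform phi c) = 0 by rewrite mulr0.
rewrite rmorph_linform /=.
have /matrixP /(_ 0 c) := alpha_phi; rewrite !mxE => E.
rewrite (eq_bigr (fun i => (alpha 0 i * phi i c)%:P * 'X)); last first.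
  by move=> i _; rewrite rees_mapC rees_mapX polyCM mulrCA mulrA.
by rewrite -mulr_suml -raddf_sum E mul0r.
Qed.

(** Inverting a maximal minor delta leaves a single variable ['X_i0], sent to alpha_i0 t. As
    alpha_i0 is nonzero, the Rees map is injective on polynomials in it, so its kernel is the
    delta-torsion. *)
Lemma rees_torsion : exists f : 'I_d -> 'I_d.+1, \det (rowsub f phi) != 0 /\
  forall F, rees_map F = 0 -> exists n, linJ phi (enum 'I_d) ((\det (rowsub f phi) ^+ n)%:MP * F).
Proof.
have [f [f_inj det0]] := cols_minor phi_inj (g := id) (fun a b E => E).
exists f; split=> // F HF.
have [i0 Hi0] : exists i0, forall i, (i == i0) = (i \notin codom f).
  have : #|~: [set f a | a : 'I_d]| = 1%N.
    by rewrite cardsCs setCK card_imset // !card_ord subSnn.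
  move=> /eqP /cards1P [i0 Ei0]; exists i0 => i.
  have := in_set1 i i0; rewrite -Ei0 inE => <-; congr (~~ _).
  by apply/imsetP/codomP => [[a _ ->]|[a ->]]; exists a.
(* If this entry were 0, the others would be killed by a square matrix of nonzero determinant, and
   alpha would be 0. *)
have a0 : alpha 0 i0 != 0.
  apply: contraNneq alpha0 => a0; apply/eqP.
  have af : colsub f alpha = 0.
    have E : colsub f alpha *m rowsub f phi = 0.
      apply/rowP => c; have /matrixP /(_ 0 c) := alpha_phi; rewrite !mxE => E0.
      rewrite -[RHS]E0 [RHS](bigD1 i0) //= a0 mul0r add0r.
      rewrite [RHS](eq_bigl (mem [set f a | a : 'I_d])) /=; last first.
        move=> i; rewrite Hi0 negbK; apply/codomP/imsetP => [[a ->]|[a _ ->]]; by exists a.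
      rewrite [RHS]big_imset /=; last by move=> a b _ _ /f_inj.
      by apply: eq_big => // a _; rewrite !mxE.
    have := congr1 (fun u => u *m \adj (rowsub f phi)) E.
    rewrite mul0mx -mulmxA mul_mx_adj mul_mx_scalar => /eqP.
    by rewrite scalemx_eq0 [\det _ == 0](negPf det0) => /eqP.
  apply/rowP => i; rewrite mxE; case: (eqVneq i i0) => [->//|].
  rewrite Hi0 negbK => /codomP [a ->].
  by have /rowP /(_ a) := af; rewrite !mxE.
have [n [F' [rF' JF']]] := linJ_elim phi id f_inj F.
rewrite map_id in JF'.
suff F'0 : F' = 0 by exists n; rewrite F'0 subr0 in JF'.
have : rees_map F' = 0.
  have := rees_linJall JF'; rewrite rmorphB /= rmorphM /= HF mulr0 sub0r => /eqP.
  by rewrite oppr_eq0 => /eqP.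
pose u : {rmorphism {mpoly R[d.+1]} -> {poly R}} :=
  mhom polyC (fun i => if i == i0 then 'X else 0).
pose v : {rmorphism {poly R} -> {mpoly R[d.+1]}} :=
  horner_eval 'X_i0 \o map_poly (@mpolyC d.+1 R).
have restE i : restvar R f i = if i == i0 then 'X_i else 0.
  rewrite /restvar Hi0; case: pickP => [a /eqP <-|H]; first by rewrite codom_f.
  case: (boolP (i \in codom f)) => // /codomP [a E]; by have := H a; rewrite E eqxx.
have E1 : rees_map F' = (u F') \Po ((alpha 0 i0)%:P * 'X).
  suff E : rees_map \o restproj f =1
      comp_poly ((alpha 0 i0)%:P * 'X) \o u \o restproj f.
    by rewrite -rF'; exact: E.
  apply: mpoly_rmorph_eq => [c|i] /=.
    by rewrite restprojC rees_mapC /u mhomC comp_polyC.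
  rewrite restprojX restE; case: eqP => [->|_]; last by rewrite !rmorph0.
  by rewrite rees_mapX /u mhomU eqxx comp_polyX.
have E2 : F' = v (u F').
  suff E : restproj f =1 v \o u \o restproj f.
    by rewrite -rF'; exact: E.
  apply: mpoly_rmorph_eq => [c|i] /=.
    by rewrite restprojC /u mhomC /v /= /horner_eval map_polyC hornerC.
  rewrite !restprojX restE; case: eqP => [->|_]; last by rewrite !rmorph0.
  by rewrite /u mhomU eqxx /v /= /horner_eval map_polyX hornerX.
rewrite E1 => /eqP; rewrite comp_poly_eq0; last first.
  by rewrite size_mulX ?polyC_eq0 // size_polyC a0.
by move=> /eqP E; rewrite E2 E rmorph0.
Qed.

End ReesTorsion.

(** * From [G_d] to ranks of [phi] *)

Section AlmostLinear.
Variables (k : fieldType) (d : nat).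
Local Notation R := {mpoly k[d]}.
Variables (alpha : 'rV[R]_(d.+1)) (phi : 'M[R]_(d.+1, d)).
Local Notation I := (ideal_gen (fun j => alpha 0 j)).

Lemma vars_alg_indep (P : R -> Prop) (Z : {set 'I_d}) : 
  (forall a, only_vars Z a -> P a -> a = 0) ->
  alg_indep P (fun i : 'I_#|Z| => 'X_(enum_val i)).
Proof.
move=> PZ q Pq.
pose y (i : 'I_#|Z|) : R := 'X_(enum_val i).
have q0 : evp y q = 0.
  have E : projv Z \o evp y =1 evp y.
    apply: mpoly_rmorph_eq => [c|i] /=.
      by rewrite /evp [mhom _ _ _]mhomC projvC.
    by rewrite /evp [mhom _ _ _]mhomU projvX enum_valP.
  by apply: PZ => //; exact: E.
(* The inverse substitution below needs an element of Z as its default value, so empty Z is treated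
   apart. *)
case: (posnP #|Z|) => [Z0|Zpos].
  have Ec : q = (q@_0)%:MP.
    apply/mpolyP => mm; rewrite mcoeffC.
    have -> : mm = 0%MM by apply/mnmP => i; move: (ltn_ord i); rewrite {2}Z0.
    by rewrite eqxx mulr1.
  move: q0; rewrite Ec /evp mhomC => /eqP; rewrite mpolyC_eq0 => /eqP ->.
  exact: mpolyC0.
have [z Zz] : exists z, z \in Z by apply/set0Pn; rewrite -card_gt0.
pose back : {rmorphism R -> {mpoly k[#|Z|]}} :=
  mhom (@mpolyC #|Z| k) (fun i => 'X_(enum_rank_in Zz i)).
have E : back \o evp y =1 idfun.
  apply: mpoly_rmorph_eq => [c|i] /=.
    by rewrite /evp [mhom _ y _]mhomC [LHS]mhomC.
  by rewrite /evp [mhom _ y _]mhomU [LHS]mhomU enum_valK_in.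
by rewrite -[q]E /= q0 rmorph0.
Qed.

Lemma dim_ge_height : ideal_height_eq I 2 -> (2 <= d)%N.
Proof.
move=> [[P [primeP [_ [ht2 _]]]] _].
have P0 : forall a, only_vars set0 a -> P a -> a = 0.
  move=> a /only_vars0 [c ->] Pc; case: (eqVneq c 0) => [->|c0]; first exact: mpolyC0.
  have [[_ [_ PM]] [P1 _]] := primeP.
  by case: P1; rewrite -mpolyC1 -(mulVf c0) mpolyCM; apply: PM.
by have := ht_alg_indep_le ht2 (vars_alg_indep P0); rewrite cards0 addn0.
Qed.

Hypothesis exact_alpha :
  forall v : 'cV_(d.+1), alpha *m v = 0 -> exists w : 'cV_d, v = phi *m w.

(** Writing g through alpha, and s alpha through g, gives matrices such that s - GH kills alpha and
    hence factors through [phi]. Over K the scalar s is invertible, so the ranks of GH and of [phi]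
    add up to at least d + 1. *)
Lemma mu_loc_rank (P : R -> Prop) (K : fieldType) (chi : {rmorphism R -> K}) r :
  (forall a, chi a = 0 <-> P a) -> mu_loc_le I P r ->
  (d.+1 <= r + \rank (map_mx chi phi))%N.
Proof.
move=> chiP [g [Ig [s [nPs Hs]]]].
have /boolp.choice [G HG] : forall i, exists u, g i = \sum_j alpha 0 j * u j.
  by move=> i; apply/ideal_genP.
have /boolp.choice [H HH] : forall j, exists u, s * alpha 0 j = \sum_i g i * u i.
  move=> j; apply/ideal_genP; apply: Hs; apply: span_gen; by exists j.
pose Gm := \matrix_(j < d.+1, i < r) G i j.
pose Hm := \matrix_(i < r, j < d.+1) H j i.
pose V := s%:M - Gm *m Hm.
have aV : alpha *m V = 0.
  rewrite mulmxBr mul_mx_scalar mulmxA; apply/rowP => j; rewrite !mxE.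
  rewrite HH; apply/eqP; rewrite subr_eq0; apply/eqP; apply: eq_bigr => i _.
  rewrite !mxE HG; congr (_ * _); apply: eq_bigr => l _; by rewrite mxE.
have /boolp.choice [w Hw] : forall j, exists w : 'cV_d, col j V = phi *m w.
  move=> j; apply: exact_alpha.
  by rewrite colE mulmxA aV mul0mx.
pose Wm := \matrix_(i < d, j < d.+1) w j i 0.
have EV : V = phi *m Wm.
  apply/matrixP => i j; have := congr1 (fun u : 'cV_d.+1 => u i 0) (Hw j).
  rewrite [LHS]mxE => ->; rewrite !mxE; apply: eq_bigr => l _; by rewrite mxE.
have Es : (s%:M = Gm *m Hm + phi *m Wm)%R by rewrite -EV addrC subrK.
have : \rank (map_mx chi s%:M : 'M_d.+1) = d.+1.
  rewrite map_scalar_mx mxrank_unit // unitmxE det_scalar unitrX // unitfE.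
  by apply/negP => /eqP /chiP.
rewrite Es map_mxD !map_mxM => {1}<-.
apply: leq_trans (mxrank_add _ _) _; apply: leq_add; first exact: mulmx_max_rank.
exact: mxrankM_maxl.
Qed.

Hypothesis G_d : G_cond I d.

(** If P contains I, then ht P is at most d - |Z| < d and [G_d] bounds the number of generators by
    ht P; otherwise I_P is the unit ideal, with one generator. [mu_loc_rank] turns both bounds into
    ranks. *)
Lemma rank_of_G_cond (P : R -> Prop) (Z : {set 'I_d}) (K : fieldType)
    (chi : {rmorphism R -> K}) :
  prime_ideal P -> (forall a, chi a = 0 <-> P a) ->
  (0 < #|Z|)%N -> (#|Z| < d)%N -> (forall a, only_vars Z a -> P a -> a = 0) ->
  (#|Z| < \rank (map_mx chi phi))%N.
Proof.
move=> primeP chiP Zpos Zd PZ.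
have [h [hth hd]] := height_exists primeP (vars_alg_indep PZ).
case: (boolp.EM (subI I P)) => [IP|nIP].
  have hd' : (h < d)%N by lia.
  have := mu_loc_rank chiP (G_d primeP IP hth hd').
  by move: (\rank _) => rk; lia.
have [a [Ia nPa]] : exists a, I a /\ ~ P a.
  apply: boolp.contrapT => H; apply: nIP => a Ia; apply: boolp.contrapT => nPa.
  by apply: H; exists a.
have : mu_loc_le I P 1.
  exists (fun _ => a); split=> //; exists a; split=> // b _.
  by apply/ideal_genP; exists (fun _ => b); rewrite big_ord1.
move=> /(mu_loc_rank chiP); move: (\rank _) => rk; lia.
Qed.

Hypothesis phi_inj : forall w : 'cV_d, phi *m w = 0 -> w = 0.

Lemma lin_prime_proper cs : uniq cs -> (size cs < d)%N -> lin_prime phi cs.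
Proof.
move=> Ucs szcs; have [N] := ubnP (size cs); elim: N cs Ucs szcs => // N IH cs Ucs szcs.
rewrite ltnS => szN; apply: lin_prime_torsion_free => // F r r0 Hr.
have [|//|[E _]] := torsion_dichotomy phi_inj rank_of_G_cond Ucs _ r0 Hr.
  by move=> cs' U' _ lt; apply: IH => //; [exact: ltn_trans lt szcs|exact: leq_trans lt szN].
by rewrite E ltnn in szcs.
Qed.

Definition linJall := linJ phi (enum 'I_d).

Lemma linJall_sat F r : r != 0 -> linJall (r%:MP * F) ->
  forall j, exists a, [/\ only_vars [set j] a, a != 0 & linJall (a%:MP * F)].
Proof.
move=> r0 Hr j.
have [|JF|[_ //]] := torsion_dichotomy phi_inj rank_of_G_cond (enum_uniq 'I_d) _ r0 Hr.
  by move=> cs' U' _; rewrite size_enum_ord; apply: lin_prime_proper.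
exists 1; split; [by rewrite /only_vars rmorph1|exact: oner_neq0|].
by rewrite mpolyC1 mul1r.
Qed.

Hypothesis alpha0 : alpha != 0.
Hypothesis alpha_phi : alpha *m phi = 0.

Lemma rees_saturated F : rees_map alpha F = 0 ->
  forall j, exists a, [/\ only_vars [set j] a, a != 0 & linJall (a%:MP * F)].
Proof.
move=> HF; have [f [det0 H]] := rees_torsion phi_inj alpha0 alpha_phi; have [n Hn] := H F HF.
by apply: linJall_sat Hn; rewrite expf_neq0.
Qed.

End AlmostLinear.

(** * Bigraded rings *)

(* A bigrading: [gsupp q F] says that all the homogeneous components of [F] have
   their bidegrees in [q], and [gfilt q F] is the sum of these components. *)
Record bigrading (S : idomainType) := Bigrading {
  gsupp : (nat -> nat -> bool) -> S -> bool;
  gfilt : (nat -> nat -> bool) -> S -> S;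
  gfiltD : forall q F G, gfilt q (F + G) = gfilt q F + gfilt q G;
  gfilt_id : forall q F, gsupp q F -> gfilt q F = F;
  gfilt_out : forall q F, gsupp (fun x y => ~~ q x y) F -> gfilt q F = 0;
  gsupp_filt : forall q F, gsupp q (gfilt q F);
  gsupp_true : forall (q : nat -> nat -> bool) F, (forall x y, q x y) -> gsupp q F;
  gsupp0 : forall q, gsupp q 0;
  gsupp1 : gsupp (fun x y => (x == 0%N) && (y == 0%N)) 1;
  gsuppD : forall q F G, gsupp q F -> gsupp q G -> gsupp q (F + G);
  gsuppN : forall q F, gsupp q F -> gsupp q (- F);
  gsupp_sub : forall (q q' : nat -> nat -> bool) F,
    (forall x y, q x y -> q' x y) -> gsupp q F -> gsupp q' F;
  gsuppM : forall (q q' q'' : nat -> nat -> bool) F G, gsupp q F -> gsupp q' G ->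
    (forall x y x' y', q x y -> q' x' y' -> q'' (x + x')%N (y + y')%N) ->
    gsupp q'' (F * G);
  gfiltM : forall q a b h F, gsupp (fun x y => (x == a) && (y == b)) h ->
    gfilt q (h * F) = h * gfilt (fun x y => q (a + x)%N (b + y)%N) F }.

Section GradedLemmas.
Variables (S : idomainType) (gr : bigrading S).
Local Notation wsupp := (gsupp gr).
Local Notation wfilt := (gfilt gr).
Implicit Types (F G h : S) (q : nat -> nat -> bool).

Definition whomog a b F := wsupp (fun x y => (x == a) && (y == b)) F.

Lemma gfilt0 q : wfilt q 0 = 0.
Proof. by apply: gfilt_id; exact: gsupp0. Qed.

Lemma gfiltB q F G : wfilt q (F - G) = wfilt q F - wfilt q G.
Proof.
rewrite gfiltD; congr (_ + _); apply/eqP; rewrite -subr_eq0 opprK -gfiltD addNr.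
by rewrite gfilt0.
Qed.

Lemma gsuppB q F G : wsupp q F -> wsupp q G -> wsupp q (F - G).
Proof. by move=> HF HG; apply: gsuppD => //; apply: gsuppN. Qed.

Lemma gsupp_sum q (I : Type) (r : seq I) (P : pred I) (F : I -> S) :
  (forall i, P i -> wsupp q (F i)) -> wsupp q (\sum_(i <- r | P i) F i).
Proof. by move=> H; apply: (big_ind (wsupp q)); [exact: gsupp0|exact: gsuppD|]. Qed.

Lemma whomogM a b a' b' F G : whomog a b F -> whomog a' b' G ->
  whomog (a + a')%N (b + b')%N (F * G).
Proof.
move=> HF HG; apply: (gsuppM HF HG) => x y x' y'.
by move=> /andP [/eqP -> /eqP ->] /andP [/eqP -> /eqP ->]; rewrite !eqxx.
Qed.

Lemma inI_wfilt gs q F : (forall g, g \in gs -> exists a b, whomog a b g) ->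
  inI gs F -> inI gs (wfilt q F).
Proof.
elim: gs q F => [|g gs IH] q F H /=; first by move=> ->; rewrite gfilt0.
have [a [b Hg]] := H g (mem_head _ _).
move=> [u /IH Hu]; exists (wfilt (fun x y => q (a + x)%N (b + y)%N) u).
have := Hu q (fun g' Hg' => H g' (mem_behead (s := g :: gs) Hg')).
by rewrite gfiltB [u * g]mulrC (gfiltM _ _ Hg) mulrC.
Qed.

Lemma whomog_prod (I : Type) (r : seq I) (a b : I -> nat) (F : I -> S) :
  (forall i, whomog (a i) (b i) (F i)) ->
  whomog (\sum_(i <- r) a i) (\sum_(i <- r) b i) (\prod_(i <- r) F i).
Proof.
move=> H; elim: r => [|i r IH]; rewrite ?big_nil ?big_cons; first exact: gsupp1.
exact: whomogM.
Qed.

Lemma whomogX a b F i : whomog a b F -> whomog (i * a)%N (i * b)%N (F ^+ i).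
Proof.
move=> HF; elim: i => [|i IH]; first by rewrite expr0; exact: gsupp1.
by rewrite exprS !mulSn; exact: whomogM.
Qed.

Lemma whomog_det n (M : 'M[S]_n) (a b : 'I_n -> nat) :
  (forall i j, whomog (a j) (b j) (M i j)) ->
  whomog (\sum_j a j) (\sum_j b j) (\det M).
Proof.
move=> HM; rewrite -det_tr; apply: gsupp_sum => s _; rewrite mulr_sign.
have H : whomog (\sum_j a j) (\sum_j b j) (\prod_i M^T i (s i)).
  by apply: whomog_prod => i; rewrite mxE.
by case: (s : bool); [exact: gsuppN|].
Qed.

Lemma rmorph_whomog (k : comNzRingType) N (h : {rmorphism {mpoly k[N]} -> S})
    (a b : 'I_N -> nat) a0 b0 (p : {mpoly k[N]}) :
  (forall c, whomog 0 0 (h c%:MP)) -> (forall i, whomog (a i) (b i) (h 'X_i)) ->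
  (forall m, m \in msupp p -> (\sum_i m i * a i = a0)%N /\ (\sum_i m i * b i = b0)%N) ->
  whomog a0 b0 (h p).
Proof.
move=> hC hX Hp; rewrite [p]mpolyE rmorph_sum big_seq; apply: gsupp_sum => m /Hp [<- <-].
rewrite -mul_mpolyC rmorphM /=.
rewrite -[(\sum_i m i * a i)%N]add0n -[(\sum_i m i * b i)%N]add0n.
apply: whomogM; first exact: hC.
rewrite mpolyXE_id rmorph_prod; apply: whomog_prod => i.
by rewrite rmorphXn; exact: whomogX.
Qed.

End GradedLemmas.

Section Bigraded.
Variables (k : idomainType) (N : nat) (w1 w2 : 'X_{1..N} -> nat).
Hypothesis w1D : forall m m', w1 (m + m')%MM = (w1 m + w1 m')%N.
Hypothesis w2D : forall m m', w2 (m + m')%MM = (w2 m + w2 m')%N.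
Local Notation S := {mpoly k[N]}.
Implicit Types (F G h : S) (q : nat -> nat -> bool).

Definition wsupp q F := all (fun m => q (w1 m) (w2 m)) (msupp F).
Definition wfilt q F : S := \sum_(m <- msupp F | q (w1 m) (w2 m)) F@_m *: 'X_[m].

Lemma wsuppP q F :
  reflect (forall m, m \in msupp F -> q (w1 m) (w2 m)) (wsupp q F).
Proof. exact: allP. Qed.

Lemma mcoeff_wfilt q F m : (wfilt q F)@_m = if q (w1 m) (w2 m) then F@_m else 0.
Proof.
rewrite /wfilt raddf_sum /=; case: (boolP (m \in msupp F)) => [mF|mF]; last first.
  rewrite big1_seq ?memN_msupp_eq0 ?if_same // => m' /andP [_ m'F].
  by rewrite mcoeffZ mcoeffX; case: eqP mF => [<-|_ _]; rewrite ?m'F // mulr0.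
rewrite big_mkcond (bigD1_seq m) ?msupp_uniq //= big1 ?addr0 => [|m' /negPf mm'].
  by case: ifP => // _; rewrite mcoeffZ mcoeffX eqxx mulr1.
by case: ifP => // _; rewrite mcoeffZ mcoeffX mm' mulr0.
Qed.

Lemma wfiltD q F G : wfilt q (F + G) = wfilt q F + wfilt q G.
Proof.
apply/mpolyP => m; rewrite mcoeffD !mcoeff_wfilt mcoeffD.
by case: ifP; rewrite ?addr0.
Qed.

Lemma wfilt_id q F : wsupp q F -> wfilt q F = F.
Proof.
move=> /wsuppP H; apply/mpolyP => m; rewrite mcoeff_wfilt; case: ifP => // Hm.
by rewrite memN_msupp_eq0 //; apply/negP => /H; rewrite Hm.
Qed.

Lemma wfilt_out q F : wsupp (fun x y => ~~ q x y) F -> wfilt q F = 0.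
Proof.
move=> /wsuppP H; apply/mpolyP => m; rewrite mcoeff_wfilt mcoeff0; case: ifP => // Hm.
by rewrite memN_msupp_eq0 //; apply/negP => /H; rewrite Hm.
Qed.

Lemma wsupp_filt q F : wsupp q (wfilt q F).
Proof.
by apply/wsuppP => m; rewrite mcoeff_msupp mcoeff_wfilt; case: ifP; rewrite ?eqxx.
Qed.

Lemma wsupp0 q : wsupp q 0. Proof. by rewrite /wsupp msupp0. Qed.

Lemma wsupp_true q F : (forall x y, q x y) -> wsupp q F.
Proof. by move=> H; apply/wsuppP. Qed.

Lemma wsuppD q F G : wsupp q F -> wsupp q G -> wsupp q (F + G).
Proof.
move=> /wsuppP HF /wsuppP HG; apply/wsuppP => m /msuppD_le.
by rewrite mem_cat => /orP [/HF|/HG].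
Qed.

Lemma wsuppN q F : wsupp q F -> wsupp q (- F).
Proof. by move=> /wsuppP HF; apply/wsuppP => m; rewrite (perm_mem (msuppN F)) => /HF. Qed.

Lemma wsupp_sub q q' F : (forall x y, q x y -> q' x y) -> wsupp q F -> wsupp q' F.
Proof. by move=> H /wsuppP HF; apply/wsuppP => m /HF /H. Qed.

Lemma wsuppM q q' q'' F G : wsupp q F -> wsupp q' G ->
  (forall x y x' y', q x y -> q' x' y' -> q'' (x + x')%N (y + y')%N) ->
  wsupp q'' (F * G).
Proof.
move=> /wsuppP HF /wsuppP HG H; apply/wsuppP => m /msuppM_le /allpairsP [[a b] /= [aF bG ->]].
by rewrite w1D w2D; apply: H; [exact: HF|exact: HG].
Qed.

Lemma wfiltM q a b h F : wsupp (fun x y => (x == a) && (y == b)) h ->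
  wfilt q (h * F) = h * wfilt (fun x y => q (a + x)%N (b + y)%N) F.
Proof.
move=> Hh; elim/mpolyind: F => [|c m p _ _ IH]; first by rewrite mulr0 ![wfilt _ 0]wfilt_id ?mulr0 //; exact: wsupp0.
rewrite mulrDr !wfiltD mulrDr -IH; congr (_ + _).
have Hm (q0 : nat -> nat -> bool) : q0 (w1 m) (w2 m) -> wsupp q0 (c *: 'X_[m]).
  by move=> Hq; apply/wsuppP => m' /msuppZ_le; rewrite msuppX inE => /eqP ->.
have Hhm : wsupp (fun x y => (x == a + w1 m)%N && (y == b + w2 m)%N) (h * (c *: 'X_[m])).
  apply: (wsuppM Hh (Hm (fun x y => (x == w1 m) && (y == w2 m)) _)).
    by rewrite !eqxx.
  by move=> x y x' y' /andP [/eqP -> /eqP ->] /andP [/eqP -> /eqP ->]; rewrite !eqxx.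
case: (boolP (q (a + w1 m)%N (b + w2 m)%N)) => Hq.
  have -> : wfilt q (h * (c *: 'X_[m])) = h * (c *: 'X_[m]).
    by apply: wfilt_id; apply: wsupp_sub Hhm => X Y /andP [/eqP -> /eqP ->].
  congr (_ * _); apply/esym/wfilt_id.
  exact: (Hm (fun x y => q (a + x)%N (b + y)%N)).
rewrite wfilt_out; last by apply: wsupp_sub Hhm => X Y /andP [/eqP -> /eqP ->].
rewrite wfilt_out ?mulr0 //.
exact: (Hm (fun x y => ~~ q (a + x)%N (b + y)%N)).
Qed.

Lemma wsupp1 : wsupp (fun x y => (x == 0%N) && (y == 0%N)) 1.
Proof.
apply/wsuppP => m; rewrite msupp1 inE => /eqP ->.
by have := w1D 0%MM 0%MM; have := w2D 0%MM 0%MM; rewrite addm0; lia.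
Qed.

Definition mpoly_bigrading : bigrading S :=
  Bigrading wfiltD wfilt_id wfilt_out wsupp_filt wsupp_true wsupp0 wsupp1
    wsuppD wsuppN wsupp_sub wsuppM wfiltM.

End Bigraded.

(** * Almost linear bigraded forms *)

Section LastColumn.
Variables (A : comNzRingType) (e : nat) (B : 'M[A]_(e.+1)).

(** The signed maximal minors of the columns before the last; [detlast u] is the determinant with
    the last column replaced by u. *)
Definition dlast r : A := cofactor B r ord_max.
Definition detlast (u : 'I_e.+1 -> A) : A := \sum_r u r * dlast r.
Let repl (u : 'I_e.+1 -> A) := \matrix_(i, j) if j == ord_max then u i else B i j.

Lemma detlastE u : detlast u = \det (repl u).
Proof.
rewrite (expand_det_col _ ord_max); apply: eq_bigr => i _; rewrite mxE eqxx.
congr (_ * (_ * \det _)); apply/matrixP => a b; rewrite !mxE.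
by rewrite eq_sym (negPf (neq_lift _ _)).
Qed.

Lemma detlast_col j : j != ord_max -> detlast (B ^~ j) = 0.
Proof.
move=> jl; rewrite detlastE -det_tr (determinant_alternate jl) // => i.
by rewrite !mxE eqxx (negPf jl).
Qed.

Lemma detlastB u v : detlast u - detlast v = detlast (fun i => u i - v i).
Proof. by rewrite -sumrB; apply: eq_bigr => i _; rewrite mulrBl. Qed.

Lemma detlast_cramer (v u : 'I_e.+1 -> A) m :
  v m * detlast u = (\sum_i v i * u i) * (\adj (repl u)) ord_max m +
    \sum_(j | j != ord_max) (\sum_i v i * B i j) * (\adj (repl u)) j m.
Proof.
pose V := \row_i v i.
have -> : v m * detlast u = (V *m (repl u *m \adj (repl u))) 0 m.
  by rewrite mul_mx_adj mul_mx_scalar !mxE detlastE mulrC.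
rewrite mulmxA mxE (bigD1 ord_max) //=; congr (_ + _).
  by rewrite mxE; congr (_ * _); apply: eq_bigr => i _; rewrite !mxE eqxx.
apply: eq_bigr => j /negPf jl; rewrite mxE; congr (_ * _).
by apply: eq_bigr => i _; rewrite !mxE jl.
Qed.

(** Vectors with two nonzero entries carry the Koszul relations: they present v_i D_j - v_j D_i as a
    value of [detlast]. *)
Lemma detlast_pair a b i j : i != j ->
  detlast (fun l => if l == i then a else if l == j then b else 0) =
  a * dlast i + b * dlast j.
Proof.
move=> ij; rewrite /detlast (bigD1 i) //= (bigD1 j) ?(eq_sym j) //= !eqxx.
rewrite (negPf ij) big1 ?addr0 // => l /andP [/negPf -> /negPf ->].
by rewrite mul0r.
Qed.

Lemma sum_pair (v : 'I_e.+1 -> A) a b i j : i != j ->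
  \sum_l v l * (if l == i then a else if l == j then b else 0) = v i * a + v j * b.
Proof.
move=> ij; rewrite (bigD1 i) //= (bigD1 j) ?(eq_sym j) //= !eqxx.
rewrite (negPf ij) big1 ?addr0 // => l /andP [/negPf -> /negPf ->].
by rewrite mulr0.
Qed.

End LastColumn.

Section AlmostLinearIdeal.
Variables (S : idomainType) (gr : bigrading S).
Local Notation wsupp := (gsupp gr).
Local Notation wfilt := (gfilt gr).
Local Notation whomog := (whomog gr).
Local Notation xhom a := (wsupp (fun X _ => X == a)).
Variables (e n : nat) (x L : 'I_e.+1 -> S) (B : 'M[S]_(e.+1)).
Local Notation xs := (map x (enum 'I_e.+1)).
Hypothesis n_gt0 : (0 < n)%N.
Hypothesis x_hom : forall i, whomog 1 0 (x i).
Hypothesis x_neq0 : forall i, x i != 0.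
Hypothesis x_reg : wreg (eq 1) [::] xs.
Hypothesis x_span : forall F, wsupp (fun X _ => 0 < X)%N F -> inI xs F.
Hypothesis const_unit : forall F, whomog 0 0 F -> F != 0 -> exists G, F * G = 1.
Hypothesis L_lin : forall j, j != ord_max -> whomog 1 1 (L j).
Hypothesis L_last : whomog n 1 (L ord_max).
Hypothesis L_prime : forall cs, uniq cs -> (size cs < e.+1)%N -> forall F G,
  inI (map L cs) (F * G) -> inI (map L cs) F \/ inI (map L cs) G.
Hypothesis L_notin : forall c cs, c \notin cs -> ~ inI (map L cs) (L c).
Hypothesis B_L : forall j, \sum_r x r * B r j = L j.
Hypothesis B_lin : forall r j, j != ord_max -> whomog 0 1 (B r j).

Definition others : seq 'I_e.+1 := [seq c <- enum 'I_e.+1 | c != ord_max].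
(** The form of degree n stands at the head: it is divided out first, and the tail is the ideal
    L'. *)
Definition Lall : seq S := map L (ord_max :: others).
Local Notation L' := (map L others).

Fact others_uniq : uniq others.
Proof. by rewrite filter_uniq // enum_uniq. Qed.
Fact last_others_uniq : uniq (ord_max :: others).
Proof. by rewrite /= others_uniq mem_filter eqxx. Qed.
Fact size_others : size others = e.
Proof.
have : perm_eq (ord_max :: others) (enum 'I_e.+1).
  apply: uniq_perm; [exact: last_others_uniq|exact: enum_uniq|].
  by move=> c; rewrite inE mem_filter mem_enum /= andbT; case: eqP.
by move/perm_size; rewrite size_enum_ord => -[].
Qed.
Fact size_xs : size xs = e.+1. Proof. by rewrite size_map size_enum_ord. Qed.

Lemma L'_hom g : g \in L' -> whomog 1 1 g.
Proof. by move=> /mapP [c]; rewrite mem_filter => /andP [cl _] ->; exact: L_lin. Qed.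

Lemma L'_exhom g : g \in L' -> exists a b, whomog a b g.
Proof. by move=> /L'_hom; exists 1%N, 1%N. Qed.

Lemma L'_prime F G : inI L' (F * G) -> inI L' F \/ inI L' G.
Proof. by apply: L_prime; [exact: others_uniq|rewrite size_others]. Qed.

Lemma L_regseq cs : uniq cs -> regseq [::] (map L cs).
Proof.
elim: cs => //= c cs IH /andP [ccs U]; split; first exact: IH.
rewrite cats0 => a /L_prime [//||/(L_notin ccs) //|//].
have /card_uniqP Uc : uniq (c :: cs) by rewrite /= ccs.
by have := max_card (mem (c :: cs)); rewrite card_ord Uc.
Qed.

Lemma xs_filt0 F : inI xs F -> wfilt (fun X _ => X == 0%N) F = 0.
Proof.
move=> /inI_sumP [h [_ ->]].
apply: (big_ind (fun F => wfilt (fun X _ => X == 0%N) F = 0)).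
- exact: gfilt0.
- by move=> u v; rewrite gfiltD => -> ->; rewrite addr0.
move=> i _; rewrite mulrC (gfiltM _ _ (x_hom i)) gfilt_out ?mulr0 //.
by apply: gsupp_true => X Y; rewrite add1n.
Qed.

Lemma xs_hom0 F : inI xs F -> xhom 0 F -> F = 0.
Proof. by move=> /xs_filt0 E /gfilt_id <-. Qed.

Lemma L_in_xs c : inI xs (L c).
Proof.
rewrite -B_L; apply: inI_sum => r _; apply: inIMr; apply: mem_inI.
by apply: map_f; rewrite mem_enum.
Qed.

Lemma L'_in_xs F : inI L' F -> inI xs F.
Proof. by apply: inI_sub => _ /mapP [c _ ->]; exact: L_in_xs. Qed.

Lemma L'_hom0 F : inI L' F -> xhom 0 F -> F = 0.
Proof. by move=> /L'_in_xs; exact: xs_hom0. Qed.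

Lemma x_notin_L' i : ~ inI L' (x i).
Proof.
move=> /inI_sumP [h [h0 E]]; case/eqP: (x_neq0 i).
have Hx : wsupp (fun _ Y => Y == 0%N) (x i) by apply: gsupp_sub (x_hom i) => X Y /andP [].
rewrite -(gfilt_id Hx) E.
apply: (big_ind (fun F => wfilt (fun _ Y => Y == 0%N) F = 0)).
- exact: gfilt0.
- by move=> u v; rewrite gfiltD => -> ->; rewrite addr0.
move=> j _; case: (boolP (j \in others)) => [|/h0 ->]; last by rewrite mul0r gfilt0.
rewrite mem_filter => /andP [jl _].
rewrite mulrC (gfiltM _ _ (L_lin jl)) gfilt_out ?mulr0 //.
by apply: gsupp_true => X Y; rewrite add1n.
Qed.

Lemma wsupp_kosD q ys c s : (forall y, y \in ys -> whomog 1 0 y) ->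
  (forall t, wsupp q (c t)) -> wsupp (fun X Y => (0 < X)%N && q X.-1 Y) (kosD ys c s).
Proof.
elim: ys c s => [|y ys IH] c [|[] s] Hys Hc /=; try exact: gsupp0.
  apply: gsuppB.
    apply: (gsuppM (Hys y (mem_head _ _)) (Hc _)).
    by move=> X Y X' Y' /andP [/eqP -> /eqP ->].
  by apply: IH => [z zys|t]; [apply: Hys; rewrite inE zys orbT|exact: Hc].
by apply: IH => [z zys|t]; [apply: Hys; rewrite inE zys orbT|exact: Hc].
Qed.

(** The quotient by g can be cut down to the bidegrees it must have: the differential adds (1,0),
    division by g subtracts (a,b). *)
Lemma kos_step (q q1 : nat -> nat -> bool) a b g gs c s : whomog a b g ->
  (forall h, h \in gs -> exists a b, whomog a b h) ->
  (forall t, wsupp q (c t)) ->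
  (forall X Y, (0 < a + X)%N -> q (a + X).-1 (b + Y)%N -> q1 X Y) ->
  inI (g :: gs) (kosD xs c s) ->
  exists2 u, wsupp q1 u & inI gs (kosD xs c s - g * u).
Proof.
move=> Hg Hgs Hc Hq [u Hu].
have HD : wsupp (fun X Y => (0 < X)%N && q X.-1 Y) (kosD xs c s).
  by apply: wsupp_kosD => // _ /mapP [i _ ->]; exact: x_hom.
exists (wfilt (fun X Y => (0 < a + X)%N && q (a + X).-1 (b + Y)%N) u).
  by apply: gsupp_sub (gsupp_filt _ _ _) => X Y /andP [H1 H2]; apply: Hq.
have := inI_wfilt (fun X Y => (0 < X)%N && q X.-1 Y) Hgs Hu.
by rewrite gfiltB gfilt_id // [u * g]mulrC (gfiltM _ _ Hg).
Qed.

(* The local cohomology of [S/(L)] vanishes in x-degree at least [n], the sum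
   of the (degree - 1) of the forms [L_j]. *)
Lemma colon_high_degree F a : (n <= a)%N -> xhom a F ->
  (forall i, inI Lall (x i * F)) -> inI Lall F.
Proof.
move=> na aF HF.
(* The x-degree while j forms are still to be divided out: a at the start, a + 1 - n after the form
   of degree n, and unchanged by linear forms. It ends positive because n <= a, so the residue lies
   in (x). *)
pose P j := if j == e.+1 then xhom a else wsupp (fun X _ => X + n == a.+1)%N.
have Plow j : (j <= e)%N -> P j = wsupp (fun X _ => X + n == a.+1)%N.
  by move=> je; rewrite /P ltn_eqF // ltnS.
have HD s : inI Lall (kosD xs (kcst F) s).
  rewrite kosD_kcst mulrC; apply: (kvec_in (P := fun y => inI Lall (y * F))).
    by rewrite mul0r; exact: inI0.
  by move=> _ /mapP [i _ ->].
have szL : size Lall = e.+1 by rewrite /= size_map size_others.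
have lev : klev (size xs - size Lall)%N (kcst F).
  by rewrite size_xs szL subnn; exact: klev_kcst.
have [|||||||E PE KE] := @kres_exists _ xs Lall P (kcst F).
- by move=> j; rewrite /P; case: ifP => _; exact: gsupp0.
- by rewrite size_xs szL.
- exact: L_regseq last_others_uniq.
- move=> g gs' pre c s E Pc Hc.
  case: pre E => [|p pre] [Eg Egs].
    rewrite -Eg -Egs in Pc Hc *; rewrite size_map size_others in Pc *.
    rewrite Plow //.
    apply: (kos_step L_last L'_exhom (q := fun X _ => X == a)) Hc => [t|X Y _ /eqP <-].
      by have := Pc t; rewrite /P eqxx.
    by rewrite addnC prednK // addn_gt0 n_gt0.
  have sub h : h \in g :: gs' -> h \in L' by move=> hg; rewrite Egs mem_cat hg orbT.
  have lt : (size gs' < e)%N.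
    have := congr1 size Egs; rewrite size_map size_others size_cat /=; lia.
  have Hg : whomog 1 1 g by apply: L'_hom; apply: sub; rewrite mem_head.
  have Hgs h : h \in gs' -> exists a b, whomog a b h.
    by move=> hg; apply: L'_exhom; apply: sub; rewrite inE hg orbT.
  rewrite Plow; last exact: ltnW.
  apply: (kos_step Hg Hgs (q := fun X _ => X + n == a.+1)%N) Hc => [t|X Y _ //].
  by have := Pc t; rewrite Plow.
- exact: lev.
- move=> s; rewrite szL /P eqxx /kcst; case: ifP => _ //; exact: gsupp0.
- by move=> s _; exact: HD.
have Ex : inI xs E.
  apply: x_span; apply: gsupp_sub PE => X Y; rewrite -addn1 => /eqP; lia.
have [|b [lb Hb]] := kres_coboundary x_reg _ (L_regseq last_others_uniq) lev KE Ex.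
  by rewrite size_xs szL.
have := Hb (nseq e.+1 false); rewrite size_nseq size_xs => /(_ erefl).
rewrite /kcst has_nseq andbF kosD0 ?subr0 // => t.
by apply: lb; rewrite -/Lall size_xs szL subnn.
Qed.

Local Notation D := (dlast B).

Lemma dlast_hom r : whomog 0 e (D r).
Proof.
rewrite /dlast /cofactor -signr_odd mulr_sign.
have H : whomog 0 e (\det (row' r (col' ord_max B))).
  have := @whomog_det _ gr _ (row' r (col' ord_max B)) (fun _ => 0%N) (fun _ => 1%N).
  rewrite !sum_nat_const card_ord muln0 muln1; apply=> i j; rewrite !mxE.
  by apply: B_lin; rewrite eq_sym neq_lift.
by case: ifP => _ //; exact: gsuppN.
Qed.

Lemma dlast_hom0 r : xhom 0 (D r).
Proof. by apply: gsupp_sub (dlast_hom r) => X Y /andP []. Qed.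

(** Cramer's rule puts [x ord_max * detlast B u] into L', and the variable cancels because L' is
    prime. *)
Lemma detlast_syzygy u : inI L' (\sum_i x i * u i) -> inI L' (detlast B u).
Proof.
move=> Hu; suff : inI L' (x ord_max * detlast B u).
  by case/L'_prime => [/x_notin_L'|].
rewrite detlast_cramer; apply: inID; first exact: inIMr.
apply: inI_sum => j jl; apply: inIMr; rewrite B_L; apply: mem_inI; apply: map_f.
by rewrite mem_filter jl mem_enum.
Qed.

Lemma x_dlast i j : inI L' (x i * D j - x j * D i).
Proof.
case: (eqVneq i j) => [->|ij]; first by rewrite subrr; exact: inI0.
have -> : x i * D j - x j * D i =
    detlast B (fun l => if l == j then x i else if l == i then - x j else 0).
  by rewrite detlast_pair 1?eq_sym // mulNr.
apply: detlast_syzygy; rewrite sum_pair 1?eq_sym //.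
have -> : x j * x i + x i * - x j = 0 by ring.
exact: inI0.
Qed.

(** C models the part of x-degree 0. A kernel vector over C is a relation between the linear forms;
    as the other forms generate a prime ideal inside (x), each coefficient lies in (x) and has
    x-degree 0, so it is 0. *)
Lemma dlast_exists (C : idomainType) (io : {rmorphism C -> S}) (pr : {rmorphism S -> C}) :
  cancel io pr -> (forall c, xhom 0 (io c)) -> (forall F, xhom 0 F -> io (pr F) = F) ->
  exists r, D r != 0.
Proof.
move=> ioK io0 prK.
pose M := \matrix_(r < e.+1, j < e) pr (B r (lift ord_max j)).
have lift_last j : lift ord_max j != ord_max :> 'I_e.+1 by rewrite eq_sym neq_lift.
have EM r j : io (M r j) = B r (lift ord_max j).
  rewrite mxE prK //; apply: gsupp_sub (B_lin r (lift_last j)) => X Y /andP [] //.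
have io_inj c : io c = 0 -> c = 0 by move=> E; rewrite -(ioK c) E rmorph0.
have [w Mw|f [f_inj det0]] := @minor_of_injective _ _ _ M.
  apply/colP => c; rewrite mxE; apply: io_inj.
  pose cs := [seq lift ord_max j | j <- enum 'I_e & j != c].
  have Ucs : uniq cs by rewrite (map_inj_uniq (@lift_inj _ _)) filter_uniq // enum_uniq.
  have ccs : lift ord_max c \notin cs.
    by apply/mapP => -[j]; rewrite mem_filter => /andP [jc _] /lift_inj E; rewrite E eqxx in jc.
  have szcs : (size cs < e.+1)%N.
    by rewrite size_map; apply: leq_ltn_trans (size_subseq (filter_subseq _ _)) _; rewrite size_enum_ord.
  have E : \sum_j io (w j 0) * L (lift ord_max j) = 0.
    under eq_bigr => j _ do rewrite -B_L mulr_sumr.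
    rewrite exchange_big big1 // => r _.
    transitivity (x r * io ((M *m w) r 0)); last by rewrite Mw mxE rmorph0 mulr0.
    rewrite mxE rmorph_sum mulr_sumr; apply: eq_bigr => j _.
    by rewrite rmorphM EM; ring.
  have : inI (map L cs) (L (lift ord_max c) * io (w c 0)).
    rewrite (bigD1 c) //= in E.
    have -> : L (lift ord_max c) * io (w c 0) =
        - \sum_(j | j != c) io (w j 0) * L (lift ord_max j).
      by apply/eqP; rewrite -addr_eq0 mulrC E.
    apply: inIN; apply: inI_sum => j jc; apply: inIM; apply: mem_inI; apply: map_f.
    by apply: map_f; rewrite mem_filter jc mem_enum.
  case/(L_prime Ucs szcs) => [/(L_notin ccs) //|Hin].
  apply: xs_hom0; last exact: io0.
  by apply: inI_sub Hin => _ /mapP [j _ ->]; exact: L_in_xs.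
(* For the row r0 missed by the minor, [D r0] is this minor up to sign: a kernel vector of the
   completed matrix vanishes on the columns of the minor, then, by row r0, in its last
   coordinate. *)
have [r0 Hr0] : exists r0, r0 \notin codom f.
  apply: boolp.contrapT => H.
  have : (#|'I_e.+1| <= #|codom f|)%N.
    apply: subset_leq_card; apply/subsetP => r _; apply: boolp.contrapT => /negP Hr.
    by apply: H; exists r.
  by rewrite (card_codom f_inj) !card_ord ltnn.
exists r0; pose u (i : 'I_e.+1) : S := (i == r0)%:R.
have -> : D r0 = detlast B u.
  rewrite /detlast (bigD1 r0) //= /u eqxx mul1r big1 ?addr0 // => i /negPf ->.
  by rewrite mul0r.
rewrite detlastE -det_tr; apply/negP => /det0P [v v0 Hv].
have Ev i : u i * v 0 ord_max + \sum_j io (M i j) * v 0 (lift ord_max j) = 0.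
  move/rowP/(_ i): Hv; rewrite !mxE (bigD1_ord ord_max) //= => E; rewrite -[RHS]E.
  rewrite !mxE eqxx mulrC; congr (_ + _); apply: eq_bigr => j _.
  by rewrite !mxE (negPf (lift_last j)) prK 1?mulrC //;
    apply: gsupp_sub (B_lin i (lift_last j)) => X Y /andP [].
pose w := \col_j v 0 (lift ord_max j).
have w0 : w = 0.
  pose Mf := map_mx io (rowsub f M).
  have : Mf *m w = 0.
    apply/colP => a; rewrite !mxE -[RHS](Ev (f a)).
    rewrite /u [f a == r0]negbTE; last by apply: contraNneq Hr0 => <-; exact: codom_f.
    by rewrite mul0r add0r; apply: eq_bigr => j _; rewrite !mxE.
  move/(congr1 (mulmx (\adj Mf))); rewrite mulmxA mul_adj_mx mulmx0 mul_scalar_mx.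
  move=> /eqP; rewrite scalemx_eq0 det_map_mx => /orP [/eqP /io_inj E|/eqP //].
  by rewrite E eqxx in det0.
have vl j : v 0 (lift ord_max j) = 0 by have /colP /(_ j) := w0; rewrite !mxE.
case/eqP: v0; apply/rowP => i; rewrite mxE.
case: (unliftP ord_max i) => [j|] ->; first exact: vl.
have := Ev r0; rewrite /u eqxx mul1r big1 ?addr0 // => j _.
by rewrite vl mulr0.
Qed.

Hypothesis dlast_neq0 : exists r, D r != 0.

Lemma dlast_notin : exists r, D r != 0 /\ ~ inI L' (D r).
Proof.
have [r Dr] := dlast_neq0; exists r; split=> // /L'_hom0 /(_ (dlast_hom0 r)) E.
by rewrite E eqxx in Dr.
Qed.

(* Hilbert-Burch for the first [e] columns of [B]: the residue of the vector of
   minors is a unit, and the residue of [w] determines [w] up to L'. *)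
Lemma left_kernel (w : 'I_e.+1 -> S) : (forall i, xhom 0 (w i)) ->
  (forall j, j != ord_max -> \sum_i w i * B i j = 0) ->
  exists c, xhom 0 c /\ forall i, w i = c * D i.
Proof.
move=> w0 wB.
(* By Cramer's rule every w_m annihilates the difference of the two sides; if w_i = w_j = 0 there is
   nothing to prove. *)
have wD i j : w i * D j = w j * D i.
  case: (eqVneq i j) => [->//|ij].
  pose u l := if l == j then w i else if l == i then - w j else 0.
  have Hm m : w m * (w i * D j - w j * D i) = 0.
    have -> : w i * D j - w j * D i = detlast B u.
      by rewrite /u detlast_pair 1?eq_sym // mulNr.
    rewrite detlast_cramer /u sum_pair 1?eq_sym //.
    have -> : w j * w i + w i * - w j = 0 by ring.
    by rewrite mul0r add0r big1 // => l /wB ->; rewrite mul0r.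
  apply/eqP; rewrite -subr_eq0; apply/eqP.
  have [wi|wi] := eqVneq (w i) 0; last first.
    by have /eqP := Hm i; rewrite mulf_eq0 (negPf wi) => /eqP.
  have [wj|wj] := eqVneq (w j) 0; last first.
    by have /eqP := Hm j; rewrite mulf_eq0 (negPf wj) => /eqP.
  by rewrite wi wj !mul0r subrr.
(* Both w and x are proportional to D modulo the prime L', and some D_r is not in L'. This makes w a
   Koszul cocycle. *)
have xw i j : inI L' (x i * w j - x j * w i).
  have [r [_ Dr]] := dlast_notin.
  suff /L'_prime [/Dr []|//] : inI L' (D r * (x i * w j - x j * w i)).
  have -> : D r * (x i * w j - x j * w i) =
    w j * (x i * D r - x r * D i) - w i * (x j * D r - x r * D j)
    + x r * (w j * D i - w i * D j) by ring.
  rewrite (wD j i) subrr mulr0 addr0.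
  by apply: inIB; apply: inIM; exact: x_dlast.
have nthx (v : 'I_e.+1 -> S) l : (map v (enum 'I_e.+1))`_l =
    if (l < e.+1)%N then v (inord l) else 0.
  case: ifP => Hl; last by rewrite nth_default // size_map size_enum_ord leqNgt Hl.
  rewrite (nth_map ord_max) ?size_enum_ord //; congr v; apply: val_inj.
  by rewrite /= nth_enum_ord // inordK.
have cocycle v : (forall i j, inI L' (x i * v j - x j * v i)) ->
    forall s, inI L' (kosD xs (kvec (map v (enum 'I_e.+1))) s).
  move=> Hv s; apply: kosD_kvec => [|i j]; first by rewrite !size_map.
  rewrite !nthx; case: ifP => _; case: ifP => _ //; rewrite ?mulr0 ?mul0r ?subrr //; exact: inI0.
have lev : (size xs - size L' = 1)%N by rewrite size_xs size_map size_others subSnn.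
have szL : (size L' <= size xs)%N by rewrite size_xs size_map size_others.
have regL := L_regseq others_uniq.
have [|||||||ew _ Kw] := @kres_exists _ xs L' (fun _ _ => True) (kvec (map w (enum 'I_e.+1))).
- by [].
- exact: szL.
- exact: regL.
- move=> g gs' pre c s _ _ [u Hu]; exists u => //; by rewrite mulrC.
- by rewrite lev; exact: klev_kvec.
- by [].
- by move=> s _; exact: cocycle.
(* The residue [eD] of the vector of minors is a constant, for degree reasons. *)
pose P j := whomog 0 j.
have [|||||||eD PD KD] := @kres_exists _ xs L' P (kvec (map D (enum 'I_e.+1))).
- by move=> j; exact: gsupp0.
- exact: szL.
- exact: regL.
- move=> g gs' pre c s E Pc Hc.
  have sub h : h \in g :: gs' -> h \in L' by move=> hg; rewrite E mem_cat hg orbT.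
  have Hg : whomog 1 1 g by apply: L'_hom; apply: sub; rewrite mem_head.
  have Hgs h : h \in gs' -> exists a b, whomog a b h.
    by move=> hg; apply: L'_exhom; apply: sub; rewrite inE hg orbT.
  by apply: (kos_step Hg Hgs Pc) Hc => X Y _; rewrite add1n.
- by rewrite lev; exact: klev_kvec.
- move=> s; rewrite size_map size_others.
  apply: (kvec_in (P := fun F => whomog 0 e F)); first exact: gsupp0.
  by move=> _ /mapP [i _ ->]; exact: dlast_hom.
- by move=> s _; apply: cocycle => i j; exact: x_dlast.
have unit_vec i : exists s, size s = size xs /\
    forall v : 'I_e.+1 -> S, kvec (map v (enum 'I_e.+1)) s = v i.
  exists (nseq i false ++ true :: nseq (e.+1 - i.+1) false); split.
    by rewrite size_cat /= !size_nseq size_xs; have := ltn_ord i; lia.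
  move=> v; have := @kvec_nth _ (map v (enum 'I_e.+1)) i.
  rewrite size_map size_enum_ord => -> //; rewrite nthx ltn_ord.
  by congr v; apply: val_inj; rewrite /= inordK.
have coboundary c E : klev 1 c -> kres xs L' c E -> inI xs E ->
    forall s, size s = size xs -> inI xs (c s).
  move=> lc0 Kc Ec s sz; have lc : klev (size xs - size L')%N c by rewrite lev.
  have [b [_ Hb]] := kres_coboundary x_reg szL regL lc Kc Ec.
  rewrite -(subrK (kosD xs b s) (c s)); apply: inID; first exact/L'_in_xs/Hb.
  exact: kosD_inI.
(* With residue zero, D would be a coboundary modulo L', hence inside (x), although it has x-degree
   0 and is nonzero. *)
have eD0 : eD != 0.
  apply/eqP => E; have [r /eqP Dr] := dlast_neq0; apply: Dr.
  have [s [sz Hs]] := unit_vec r; apply: xs_hom0; last exact: dlast_hom0.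
  rewrite -Hs; apply: (coboundary _ eD) => //; first exact: klev_kvec.
  by rewrite E; exact: inI0.
have [v Ev] := const_unit PD eD0.
(* With this c the residue of w - cD is zero, so w - cD lies in (x); its component of x-degree 0
   gives the equality. *)
pose c := v * ew.
exists (wfilt (fun X _ => X == 0%N) c); split; first exact: gsupp_filt.
move=> i; have [s [sz Hs]] := unit_vec i.
have := kres_lin 1 (- c) Kw KD.
have -> : 1 * ew + - c * eD = 0.
  by rewrite /c mulNr -mulrA [ew * eD]mulrC mulrA [v * eD]mulrC Ev !mul1r subrr.
move=> /coboundary H; have := H (klev_lin _ _ (@klev_kvec _ _) (@klev_kvec _ _)) (inI0 _) s sz.
rewrite !Hs mul1r mulNr => /xs_filt0; rewrite gfiltB (gfilt_id (w0 i)).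
rewrite [c * _]mulrC (gfiltM _ _ (dlast_hom i)) mulrC => /eqP.
by rewrite subr_eq0 => /eqP.
Qed.

(* [sigma] substitutes for [x] the maximal minors of the linear columns of [B];
   it kills L' because the vector of minors is proportional to [x] modulo L'. *)
Variable sigma : {rmorphism S -> S}.
Hypothesis sigma_x : forall i, sigma (x i) = D i.
Hypothesis sigma_id : forall F, xhom 0 F -> sigma F = F.
Hypothesis sigma_hom0 : forall F, xhom 0 (sigma F).
Let f := sigma (L ord_max).

Lemma xhom_decompose a F : xhom a.+1 F ->
  exists u, (forall i, xhom a (u i)) /\ F = \sum_i x i * u i.
Proof.
move=> aF; have /x_span /inI_sumP [h [_ E]] : wsupp (fun X _ => 0 < X)%N F.
  by apply: gsupp_sub aF => X _ /eqP ->.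
exists (fun i => wfilt (fun X _ => 1 + X == a.+1)%N (h i)); split.
  by move=> i; apply: gsupp_sub (gsupp_filt _ _ _) => X _; rewrite add1n eqSS.
rewrite -[LHS](gfilt_id aF) [in LHS]E.
rewrite (big_morph (wfilt _) (gfiltD gr _) (gfilt0 gr _)).
by apply: eq_bigr => i _; rewrite mulrC (gfiltM _ _ (x_hom i)).
Qed.

Lemma sigma_sum u : sigma (\sum_i x i * u i) = \sum_i D i * sigma (u i).
Proof. by rewrite rmorph_sum; apply: eq_bigr => i _; rewrite rmorphM sigma_x. Qed.

(** Modulo L' the vectors x and D are proportional, so the values of a form of x-degree a at them
    are in the ratio x_j^a : D_j^a. *)
Lemma sigma_cong a F : xhom a F -> forall j, inI L' (D j ^+ a * F - x j ^+ a * sigma F).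
Proof.
elim: a F => [|a IH] F aF j.
  by rewrite !expr0 !mul1r sigma_id // subrr; exact: inI0.
have [u [au E]] := xhom_decompose aF; rewrite [in sigma F]E [in _ * F]E sigma_sum.
rewrite !mulr_sumr -sumrB; apply: inI_sum => i _.
have -> : D j ^+ a.+1 * (x i * u i) - x j ^+ a.+1 * (D i * sigma (u i)) =
   D j ^+ a * u i * (x i * D j - x j * D i) +
   x j * D i * (D j ^+ a * u i - x j ^+ a * sigma (u i)) by rewrite !exprS; ring.
by apply: inID; apply: inIM; [exact: x_dlast|exact: IH].
Qed.

Lemma sigma_eq0 a F : xhom a F -> sigma F = 0 -> inI L' F.
Proof.
move=> aF F0; have [r [_ Dr]] := dlast_notin.
have := sigma_cong aF r; rewrite F0 mulr0 subr0.
elim: a {aF} => [|a IH]; first by rewrite expr0 mul1r.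
by rewrite exprS -mulrA => /L'_prime [/Dr //|/IH].
Qed.

Lemma f_neq0 : f != 0.
Proof.
apply/eqP => f0; have Hg : xhom n (L ord_max) by apply: gsupp_sub L_last => X Y /andP [].
have := sigma_eq0 Hg f0; apply: L_notin.
by rewrite mem_filter eqxx.
Qed.

Lemma sigma_L' F : inI L' F -> sigma F = 0.
Proof.
move=> /inI_sumP [h [h0 ->]]; rewrite rmorph_sum big1 // => j _; rewrite rmorphM.
case: (boolP (j \in others)) => [|/h0 ->]; last by rewrite rmorph0 mul0r.
rewrite mem_filter => /andP [jl _]; rewrite -B_L sigma_sum.
rewrite (eq_bigr (fun i => B i j * D i)); last first.
  move=> i _; rewrite mulrC sigma_id //.
  by apply: gsupp_sub (B_lin i jl) => X Y /andP [].
by rewrite -[\sum_i _]/(detlast B (B ^~ j)) detlast_col // mulr0.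
Qed.

Definition fdvd G := exists2 c, xhom 0 c & G = f * c.

Lemma sigma_Lall F : inI Lall F -> fdvd (sigma F).
Proof.
move=> [u /sigma_L']; rewrite rmorphB rmorphM => /eqP; rewrite subr_eq0 => /eqP ->.
by exists (sigma u); [exact: sigma_hom0|rewrite mulrC].
Qed.

(** The quotients w_j of D_j G by f satisfy the same linear relations as the minors, so
    [left_kernel] gives w = cD, and cancelling some D_r gives G = fc. *)
Lemma fdvd_minors G : xhom 0 G -> (forall j, fdvd (D j * G)) -> fdvd G.
Proof.
move=> G0 /(fun H j => boolp.cid2 (H j)) H.
pose w j := s2val (H j).
have w0 j : xhom 0 (w j) by rewrite /w; case: (H j).
have Ew j : D j * G = f * w j by rewrite /w; case: (H j).
have [j jl|c [c0 Ec]] := left_kernel w0.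
  apply: (mulfI f_neq0); rewrite mulr0 mulr_sumr.
  rewrite (eq_bigr (fun i => G * (B i j * D i))).
    by rewrite -mulr_sumr -[\sum_i _]/(detlast B (B ^~ j)) detlast_col // mulr0.
  by move=> i _; rewrite mulrA -Ew; ring.
exists c => //; have [r Dr] := dlast_neq0.
by apply: (mulfI Dr); rewrite Ew Ec; ring.
Qed.

(** Induction on the sum of the exponents: passing from F to x_i F lowers the i-th exponent by
    one. *)
Lemma saturation_ind (X : S -> Prop) : (forall F, inI Lall F -> X F) ->
  (forall F, (forall i, X (x i * F)) -> X F) ->
  forall (M : 'I_e.+1 -> nat) F, (forall j, inI Lall (x j ^+ M j * F)) -> X F.
Proof.
move=> X0 XS M F; have [K] := ubnP (\sum_j M j)%N.
elim: K M F => // K IH M F; rewrite ltnS => HK HM.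
case: (boolP [exists j, M j == 0%N]) => [/existsP [j /eqP Mj]|].
  by apply: X0; have := HM j; rewrite Mj expr0 mul1r.
rewrite negb_exists => /forallP M0; apply: XS => i.
apply: (IH (fun j => if j == i then (M j).-1 else M j)).
  apply: leq_trans HK; rewrite (bigD1 i) //= [X in (_ < X)%N](bigD1 i) //= eqxx.
  rewrite -addSn prednK ?lt0n // leq_add2l.
  by apply: leq_sum => j /negPf ->.
move=> j; case: eqP => [->|_].
  by rewrite mulrA -exprSr prednK ?lt0n //; exact: HM.
by rewrite mulrCA; apply: inIM; exact: HM.
Qed.

Variable A : S -> Prop.
Hypothesis A_ideal : is_ideal A.
Hypothesis A_prime : forall F G, A (F * G) -> A F \/ A G.
Hypothesis A_L : forall j, A (L j).
Hypothesis A_x : forall j, ~ A (x j).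
Hypothesis A_sat : forall a F, xhom a F -> A F ->
  forall j, exists M, inI Lall (x j ^+ M * F).

Lemma xhom_xM i a F : xhom a F -> xhom a.+1 (x i * F).
Proof.
move=> aF; apply: (gsuppM (x_hom i) aF) => X Y X' Y' /andP [/eqP -> _] /eqP ->.
by rewrite add1n.
Qed.

Lemma A_high_degree a F : A F -> xhom a F -> (n <= a)%N -> inI Lall F.
Proof.
move=> AF aF na; have /boolp.choice [M HM] := A_sat aF AF.
apply: (saturation_ind (X := fun F => forall a, xhom a F -> (n <= a)%N -> inI Lall F)) HM a aF na.
  by [].
move=> G IH b bG nb; apply: (colon_high_degree nb bG) => i.
by apply: (IH i b.+1); [exact: xhom_xM|exact: leqW].
Qed.

Lemma A_sigma a F : A F -> xhom a F -> fdvd (sigma F).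
Proof.
move=> AF aF; have /boolp.choice [M HM] := A_sat aF AF.
apply: (saturation_ind (X := fun F => fdvd (sigma F))) HM => [G|G IH].
  exact: sigma_Lall.
apply: fdvd_minors; first exact: sigma_hom0.
by move=> j; have := IH j; rewrite rmorphM sigma_x.
Qed.

Lemma A_low_degree a F F0 : A F -> xhom a F -> xhom a F0 -> sigma F0 = f ->
  exists G, inI L' (F - G * F0).
Proof.
move=> AF aF aF0 E0; have [c c0 Ec] := A_sigma AF aF; exists c.
apply: (sigma_eq0 (a := a)).
  apply: gsuppB => //; apply: (gsuppM c0 aF0) => X _ X' _ /eqP -> /eqP ->.
  by rewrite add0n.
by rewrite rmorphB rmorphM E0 (sigma_id c0) Ec mulrC subrr.
Qed.

Lemma A_degree0 G : A G -> xhom 0 G -> fdvd G.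
Proof. by move=> AG G0; rewrite -(sigma_id G0); apply: A_sigma AG G0. Qed.

(** By [sigma_cong], x_j^n f is congruent to D_j^n times the last form, hence in A; the prime A
    contains no variable x_j. *)
Lemma A_f : A f.
Proof.
have [A0 [AD AM]] := A_ideal.
have AL' F : inI L' F -> A F.
  move=> /inI_sumP [h [_ ->]]; apply: (big_ind A) => // j _.
  by apply: (AM); exact: A_L.
have Hg : xhom n (L ord_max) by apply: gsupp_sub L_last => X Y /andP [].
have : A (x ord_max ^+ n * f).
  have -> : x ord_max ^+ n * f = D ord_max ^+ n * L ord_max +
     (-1) * (D ord_max ^+ n * L ord_max - x ord_max ^+ n * f) by ring.
  apply: (AD); apply: (AM); first exact: A_L.
  by apply: AL'; exact: sigma_cong.
elim: (n) => [|m IH]; first by rewrite expr0 mul1r.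
by rewrite exprS -mulrA => /A_prime [/A_x //|/IH].
Qed.

Lemma lower_degree a F : xhom a.+1 F -> sigma F = f ->
  exists u, [/\ F = \sum_i x i * u i, xhom a (detlast B u) & sigma (detlast B u) = f].
Proof.
move=> aF E; have [u [au Eu]] := xhom_decompose aF; exists u; split=> //.
  apply: gsupp_sum => i _; apply: (gsuppM (au i) (dlast_hom0 i)).
  by move=> X _ X' _ /eqP -> /eqP ->; rewrite addn0.
rewrite -E Eu sigma_sum rmorph_sum; apply: eq_bigr => i _.
by rewrite rmorphM (sigma_id (dlast_hom0 i)) mulrC.
Qed.

End AlmostLinearIdeal.

(** * The bigraded ring k[x, T] *)

Lemma rmorph_closed n (k S : comNzRingType) (h : {rmorphism {mpoly k[n]} -> S})
    (P : S -> Prop) :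
  (forall u v, P u -> P v -> P (u + v)) -> (forall u v, P u -> P v -> P (u * v)) ->
  (forall c, P (h c%:MP)) -> (forall i, P (h 'X_i)) -> forall p, P (h p).
Proof.
move=> PD PM PC PX; elim/mpolyind => [|c m p _ _ IH]; first by rewrite -mpolyC0.
rewrite rmorphD /=; apply: (PD) => //; rewrite -mul_mpolyC rmorphM /=; apply: (PM) => //.
have P1 : P 1 by rewrite -(rmorph1 h) -mpolyC1.
rewrite mpolyXE_id rmorph_prod; apply: (big_ind P) => // i _.
by rewrite rmorphXn; elim: (m i) => // l H; rewrite exprS; apply: PM.
Qed.

Lemma vars_regular (k : fieldType) N (js : seq 'I_N) : uniq js ->
  wreg (eq (1 : {mpoly k[N]})) [::] [seq 'X_j | j <- js].
Proof.
elim: js => //= j js IH /andP [jjs U]; split; first exact: IH.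
rewrite cats0 => a Ha; exists 1 => //; rewrite mul1r.
pose Y : {set 'I_N} := ~: [set i | i \in js].
have proj0 (F : {mpoly k[N]}) : inI [seq 'X_j | j <- js] F -> projv Y F = 0.
  move=> /inI_sumP [h [h0 ->]]; rewrite rmorph_sum /= big1 // => i _; rewrite rmorphM /= projvX !inE.
  by case: ifP => [ijs|_]; rewrite ?mulr0 // h0 // rmorph0 mul0r.
have projE (F : {mpoly k[N]}) : inI [seq 'X_j | j <- js] (F - projv Y F).
  apply: (rmorph_closed (h := idfun) (P := fun F => inI _ (F - projv Y F))) => [u v Hu Hv|u v Hu Hv|c|i] /=.
  - by rewrite rmorphD /= opprD addrACA; exact: inID.
  - have -> : u * v - projv Y (u * v) = u * (v - projv Y v) + (u - projv Y u) * projv Y v.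
      by rewrite rmorphM /=; ring.
    by apply: inID; [exact: inIM|exact: inIMr].
  - by rewrite projvC subrr; exact: inI0.
  - rewrite projvX !inE; case: ifP => [_|/negbFE ijs]; first by rewrite subrr; exact: inI0.
    by rewrite subr0; apply: mem_inI; exact: map_f.
have := proj0 _ Ha; rewrite rmorphM /= projvX !inE jjs => /eqP.
rewrite mulf_eq0 -msupp_eq0 msuppX /= => /eqP a0.
by rewrite -(subr0 a) -a0.
Qed.

Section Variables.
Variables (k : fieldType) (d : nat).
Local Notation R := {mpoly k[d]}.
Local Notation S := {mpoly k[d + d.+1]}.
Local Notation x := (@xS k d).
Local Notation T := (@TS k d).
Local Notation RtoS := (@RtoS k d).
Local Notation TtoS := (@TtoS k d).

HB.instance Definition _ :=
  GRing.RMorphism.copy RtoS (comp_mpoly [tuple x i | i < d]).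
HB.instance Definition _ :=
  GRing.RMorphism.copy TtoS (comp_mpoly [tuple T j | j < d.+1]).

Lemma RtoSC c : RtoS c%:MP = c%:MP. Proof. exact: comp_mpolyC. Qed.
Lemma RtoSX i : RtoS 'X_i = x i.
Proof. by rewrite /RtoS comp_mpolyXU -tnth_nth tnth_mktuple. Qed.
Lemma TtoSC c : TtoS c%:MP = c%:MP. Proof. exact: comp_mpolyC. Qed.
Lemma TtoSX j : TtoS 'X_j = T j.
Proof. by rewrite /TtoS comp_mpolyXU -tnth_nth tnth_mktuple. Qed.

Definition xT_cases (A : Type) (u : 'I_d -> A) (v : 'I_d.+1 -> A) (i : 'I_(d + d.+1)) : A :=
  match split i with inl a => u a | inr j => v j end.

Lemma xT_casesx A u v a : @xT_cases A u v (lshift _ a) = u a.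
Proof. by rewrite /xT_cases -[lshift _ _]/(unsplit (inl _ a)) unsplitK. Qed.
Lemma xT_casesT A u v j : @xT_cases A u v (rshift _ j) = v j.
Proof. by rewrite /xT_cases -[rshift _ _]/(unsplit (inr _ j)) unsplitK. Qed.

Lemma xT_ind (P : 'I_(d + d.+1) -> Prop) :
  (forall a, P (lshift _ a)) -> (forall j, P (rshift _ j)) -> forall i, P i.
Proof. by move=> Hx HT i; case: (split_ordP i) => a ->. Qed.

Lemma S_rmorph_eq (A : comNzRingType) (f g : {rmorphism S -> A}) :
  (forall c, f c%:MP = g c%:MP) -> (forall a, f (x a) = g (x a)) ->
  (forall j, f (T j) = g (T j)) -> f =1 g.
Proof. by move=> HC Hx HT; apply: mpoly_rmorph_eq => // i; elim/xT_ind: i. Qed.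

Definition ofSR : {mpoly R[d.+1]} -> S := mhom RtoS T.
HB.instance Definition _ := GRing.RMorphism.copy ofSR (mhom RtoS T).
Lemma ofSRC c : ofSR c%:MP = RtoS c. Proof. exact: mhomC. Qed.
Lemma ofSRX j : ofSR 'X_j = T j. Proof. exact: mhomU. Qed.

Let cst : {rmorphism k -> {mpoly R[d.+1]}} := @mpolyC d.+1 R \o @mpolyC d k.
Let vars : 'I_(d + d.+1) -> {mpoly R[d.+1]} :=
  xT_cases (fun a => ('X_a)%:MP) (fun j => 'X_j).
Definition toSR : S -> {mpoly R[d.+1]} := mhom cst vars.
HB.instance Definition _ := GRing.RMorphism.copy toSR (mhom cst vars).
Lemma toSRC c : toSR c%:MP = c%:MP%:MP. Proof. exact: mhomC. Qed.
Lemma toSRx a : toSR (x a) = ('X_a)%:MP.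
Proof. by rewrite /toSR mhomU /vars xT_casesx. Qed.
Lemma toSRT j : toSR (T j) = 'X_j.
Proof. by rewrite /toSR mhomU /vars xT_casesT. Qed.

Lemma toSR_RtoS r : toSR (RtoS r) = r%:MP.
Proof.
apply: (mpoly_rmorph_eq (f := toSR \o RtoS) (g := @mpolyC d.+1 R)) => [c|i] /=.
  by rewrite RtoSC toSRC.
by rewrite RtoSX toSRx.
Qed.

Lemma ofSRK : cancel ofSR toSR.
Proof.
apply: (mpoly_rmorph_eq (f := toSR \o ofSR) (g := idfun)) => [c|i] /=.
  by rewrite ofSRC toSR_RtoS.
by rewrite ofSRX toSRT.
Qed.

Lemma toSRK : cancel toSR ofSR.
Proof.
apply: (S_rmorph_eq (f := ofSR \o toSR) (g := idfun)) => [c|a|j] /=.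
- by rewrite toSRC ofSRC RtoSC.
- by rewrite toSRx ofSRC RtoSX.
- by rewrite toSRT ofSRX.
Qed.

Lemma ofSR_linform (phi : 'M[R]_(d.+1, d)) c : ofSR (linform phi c) = Tphi phi c.
Proof.
by rewrite rmorph_linform /=; apply: eq_bigr => i _; rewrite ofSRC ofSRX mulrC.
Qed.

Lemma toSR_Tphi (phi : 'M[R]_(d.+1, d)) c : toSR (Tphi phi c) = linform phi c.
Proof. by rewrite -ofSR_linform ofSRK. Qed.

Lemma inI_Tphi (phi : 'M[R]_(d.+1, d)) cs F :
  inI (map (Tphi phi) cs) F <-> linJ phi cs (toSR F).
Proof.
split=> [/(inI_rmorph toSR)|/(inI_rmorph ofSR)]; rewrite -map_comp.
  by rewrite (eq_map (g := linform phi)) // => c /=; rewrite toSR_Tphi.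
by rewrite /= toSRK (eq_map (g := Tphi phi)) // => c /=; rewrite ofSR_linform.
Qed.

(** The target k[x,t] is compared with R[t] through the injective map [muni], which singles out the
    last variable. *)
Lemma rees_ideal_map (alpha : 'rV[R]_(d.+1)) F :
  rees_ideal alpha F <-> rees_map alpha (toSR F) = 0.
Proof.
pose ev : {rmorphism S -> {mpoly k[d.+1]}} :=
  comp_mpoly [tuple rees_images alpha i | i < d + d.+1].
have evi i : ev 'X_i = rees_images alpha i.
  by rewrite /ev /= comp_mpolyXU -tnth_nth tnth_mktuple.
have muX i : muni ('X_(widen_ord (leqnSn d) i) : {mpoly k[d.+1]}) = ('X_i)%:P.
  rewrite /muni mmapX mmap1U; case: splitP => [j|j] /= E; last first.
    by have := ltn_ord i; rewrite E; lia.
  by congr ('X_ _)%:P; apply: val_inj.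
have muR (r : R) : muni (RtoRt r) = r%:P.
  pose w : {rmorphism R -> {mpoly k[d.+1]}} :=
    comp_mpoly [tuple 'X_(widen_ord (leqnSn d) i) | i < d].
  have E : @muni d k \o w =1 @polyC R.
    apply: mpoly_rmorph_eq => [c|i] /=; first by rewrite comp_mpolyC muniC.
    by rewrite comp_mpolyXU -tnth_nth tnth_mktuple muX.
  exact: E.
have E G : muni (ev G) = rees_map alpha (toSR G).
  apply: (S_rmorph_eq (f := @muni d k \o ev) (g := rees_map alpha \o toSR)) => [c|a|j] /=.
  - by rewrite toSRC rees_mapC /ev /= comp_mpolyC muniC.
  - rewrite toSRx rees_mapC evi /rees_images.
    by rewrite -[lshift _ _]/(unsplit (inl _ a)) unsplitK muX.
  - rewrite toSRT rees_mapX evi /rees_images.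
    rewrite -[rshift _ _]/(unsplit (inr _ j)) unsplitK rmorphM /= muR.
    congr (_ * _); rewrite /muni mmapX mmap1U; case: splitP => [i|i] //= E.
    by have := ltn_ord i; rewrite -E ltnn.
rewrite -E; split=> [H|H]; first by rewrite -[ev F]/(F \mPo _) H rmorph0.
by apply: muni_inj; rewrite rmorph0.
Qed.

End Variables.

Section Grading.
Variables (k : fieldType) (d : nat).
Local Notation R := {mpoly k[d]}.
Local Notation S := {mpoly k[d + d.+1]}.
Local Notation x := (@xS k d).
Local Notation T := (@TS k d).
Local Notation RtoS := (@RtoS k d).
Local Notation TtoS := (@TtoS k d).
Local Notation xs := (map x (enum 'I_d)).

Lemma xdegD (m m' : 'X_{1..d + d.+1}) : xdeg (m + m')%MM = (xdeg m + xdeg m')%N.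
Proof. by rewrite -big_split; apply: eq_bigr => i _; rewrite mnmDE. Qed.
Lemma TdegD (m m' : 'X_{1..d + d.+1}) : Tdeg (m + m')%MM = (Tdeg m + Tdeg m')%N.
Proof. by rewrite -big_split; apply: eq_bigr => i _; rewrite mnmDE. Qed.

(** The first weight is constantly 0, so that lemmas on bigradings also apply to k[T]. *)
Definition T_grading : bigrading {mpoly k[d.+1]} :=
  @mpoly_bigrading k d.+1 (fun _ => 0%N) mdeg (fun _ _ => erefl) (@mdegD _).
Local Notation Twhomog := (whomog T_grading).
Definition xT_grading : bigrading S := mpoly_bigrading k xdegD TdegD.
Local Notation gr := xT_grading.
Local Notation whomog := (whomog gr).
Local Notation xhom a := (gsupp gr (fun X _ => X == a)).

Lemma bihomP a b F : reflect (bihom a b F) (whomog a b F).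
Proof.
apply: (iffP (wsuppP _ _ _ _)) => H m mF; have := H m mF.
  by move=> /andP [/eqP -> /eqP ->].
by move=> [-> ->]; rewrite !eqxx.
Qed.

Lemma whomogC c : whomog 0 0 c%:MP.
Proof.
apply/bihomP => m; rewrite msuppC; case: ifP => // _; rewrite inE => /eqP ->.
by rewrite /xdeg /Tdeg !big1 // => i _; rewrite mnmE.
Qed.

Lemma x_whomog i : whomog 1 0 (x i).
Proof.
apply/bihomP => m; rewrite msuppX inE => /eqP ->; rewrite /xdeg /Tdeg; split.
  rewrite (bigD1 i) //= mnmE eqxx big1 // => j /negPf ji; rewrite mnmE.
  by rewrite (inj_eq (@lshift_inj _ _)) eq_sym ji.
by rewrite big1 // => j _; rewrite mnmE eq_lrshift.
Qed.

Lemma T_whomog j : whomog 0 1 (T j).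
Proof.
apply/bihomP => m; rewrite msuppX inE => /eqP ->; rewrite /xdeg /Tdeg; split.
  by rewrite big1 // => i _; rewrite mnmE eq_rlshift.
rewrite (bigD1 j) //= mnmE eqxx big1 // => i /negPf ji; rewrite mnmE.
by rewrite (inj_eq (@rshift_inj _ _)) eq_sym ji.
Qed.

Lemma x_neq0 i : x i != 0.
Proof. by rewrite -msupp_eq0 msuppX. Qed.

Lemma x_regular : wreg (eq 1) [::] xs.
Proof.
have -> : xs = [seq 'X_j | j <- map (lshift d.+1) (enum 'I_d)] by rewrite -map_comp.
by apply: vars_regular; rewrite (map_inj_uniq (@lshift_inj _ _)) enum_uniq.
Qed.

Lemma x_spans F : gsupp gr (fun X _ => 0 < X)%N F -> inI xs F.
Proof.
move=> /wsuppP H; rewrite [F]mpolyE big_seq; apply: inI_sum => m /H xm.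
have [i mi] : exists i, (0 < m (lshift d.+1 i))%N.
  apply: boolp.contrapT => Hm; move: xm; rewrite /xdeg big1 // => i _.
  by apply/eqP; rewrite -leqn0 leqNgt; apply/negP => Hi; apply: Hm; exists i.
have -> : F@_m *: 'X_[m] = F@_m *: 'X_[m - U_(lshift d.+1 i)] * x i.
  rewrite -scalerAl -mpolyXD; congr (_ *: 'X_[_]).
  apply/mnmP => j; rewrite mnmDE mnmBE mnmE; case: eqP => [<-|_]; lia.
by apply: inIM; apply: mem_inI; apply: map_f; rewrite mem_enum.
Qed.

Lemma whomog00_unit F : whomog 0 0 F -> F != 0 -> exists G, F * G = 1.
Proof.
move=> /bihomP H F0; have EF : F = (F@_0)%:MP.
  apply/mpolyP => m; rewrite mcoeffC; case: (eqVneq m 0%MM) => [->|m0].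
    by rewrite mulr1.
  rewrite mulr0; apply/eqP; rewrite -[_ == _]negbK -mcoeff_msupp; apply: contra m0.
  move=> /H [Hx HT]; apply/eqP/mnmP => i; rewrite mnmE; apply/eqP; rewrite -leqn0.
  elim/xT_ind: i => j.
    by rewrite -[X in (_ <= X)%N]Hx /xdeg (bigD1 j) //= leq_addr.
  by rewrite -[X in (_ <= X)%N]HT /Tdeg (bigD1 j) //= leq_addr.
exists (F@_0)^-1%:MP; rewrite {1}EF -mpolyCM mulfV //.
by apply: contra F0 => /eqP E; rewrite EF E mpolyC0.
Qed.

Lemma RtoS_whomog a r : homog_of a r -> whomog a 0 (RtoS r).
Proof.
move=> H; apply: (rmorph_whomog (a := fun _ => 1%N) (b := fun _ => 0%N)) => [c|i|m /H <-].
- by rewrite /= RtoSC; exact: whomogC.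
- by rewrite /= RtoSX; exact: x_whomog.
- split; last by rewrite big1 // => i _; rewrite muln0.
  by rewrite mdegE; apply: eq_bigr => i _; rewrite muln1.
Qed.

Lemma Tphi_whomog a (phi : 'M[R]_(d.+1, d)) j :
  (forall i, homog_of a (phi i j)) -> whomog a 1 (Tphi phi j).
Proof.
move=> H; apply: gsupp_sum => i _.
exact: (@whomogM _ gr 0 1 a 0 _ _ (T_whomog i) (RtoS_whomog (H i))).
Qed.

Definition Tpart : S -> {mpoly k[d.+1]} :=
  mhom (@mpolyC d.+1 k) (xT_cases (fun _ => 0) (fun j => 'X_j)).
HB.instance Definition _ := GRing.RMorphism.copy Tpart
  (mhom (@mpolyC d.+1 k) (xT_cases (fun _ => 0) (fun j => 'X_j))).
Lemma TpartC c : Tpart c%:MP = c%:MP. Proof. exact: mhomC. Qed.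
Lemma Tpartx a : Tpart (x a) = 0.
Proof. by rewrite /Tpart mhomU xT_casesx. Qed.
Lemma TpartT j : Tpart (T j) = 'X_j.
Proof. by rewrite /Tpart mhomU xT_casesT. Qed.

Lemma TtoSK : cancel TtoS Tpart.
Proof.
have E : Tpart \o TtoS =1 idfun.
  by apply: mpoly_rmorph_eq => [c|i] /=; rewrite ?TtoSC ?TpartC // TtoSX TpartT.
exact: E.
Qed.

Lemma TtoS_xhom q : xhom 0 (TtoS q).
Proof.
apply: (rmorph_closed (P := fun F => xhom 0 F)) => [u v Hu Hv|u v Hu Hv|c|i] /=.
- exact: (gsuppD Hu Hv).
- by apply: (gsuppM Hu Hv) => X _ X' _ /eqP -> /eqP ->.
- by rewrite TtoSC; apply: gsupp_sub (whomogC c) => X Y /andP [].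
- by rewrite TtoSX; apply: gsupp_sub (T_whomog i) => X Y /andP [].
Qed.

Lemma TpartK F : xhom 0 F -> TtoS (Tpart F) = F.
Proof.
move=> /wsuppP H; rewrite [in RHS](mpolyE F) [in LHS](mpolyE F) !rmorph_sum big_seq [RHS]big_seq.
apply: eq_bigr => m /H /eqP m0.
rewrite -mul_mpolyC !rmorphM /= TpartC TtoSC; congr (_ * _).
rewrite mpolyXE_id !rmorph_prod; apply: eq_bigr => i _; rewrite !rmorphXn /=.
elim/xT_ind: i => j; last by rewrite TpartT TtoSX.
suff -> : m (lshift d.+1 j) = 0%N by rewrite !expr0.
by apply/eqP; rewrite -leqn0 -[X in (_ <= X)%N]m0 /xdeg (bigD1 j) //= leq_addr.
Qed.

Lemma sum_xT (m : 'X_{1..d + d.+1}) (u : 'I_d -> nat) v :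
  (\sum_i m i * xT_cases u v i =
   \sum_i m (lshift d.+1 i) * u i + \sum_j m (rshift d j) * v j)%N.
Proof.
by rewrite big_split_ord; congr (_ + _)%N; apply: eq_bigr => i _; rewrite ?xT_casesx ?xT_casesT.
Qed.

Lemma Tpart_homog F n : whomog 0 n F -> homog_of n (Tpart F).
Proof.
move=> /bihomP H.
have TC (c : k) : Twhomog 0 0 c%:MP.
  by apply/wsuppP => m; rewrite msuppC; case: ifP => // _; rewrite inE => /eqP ->; rewrite mdeg0.
have : Twhomog 0 n (Tpart F).
  apply: (rmorph_whomog (a := fun _ => 0%N) (b := xT_cases (fun _ => 0%N) (fun _ => 1%N))) => [c|i|m /H [_ <-]].
  - by rewrite /= TpartC; exact: TC.
  - elim/xT_ind: i => j; rewrite ?xT_casesx ?xT_casesT /=.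
      by rewrite Tpartx; exact: (gsupp0 T_grading).
    by rewrite TpartT; apply/wsuppP => m; rewrite msuppX inE => /eqP ->; rewrite mdeg1 !eqxx.
  split; first by rewrite big1 // => i _; rewrite muln0.
  rewrite sum_xT big1 // => [|i _]; last by rewrite muln0.
  by apply: eq_bigr => j _; rewrite muln1.
by move=> /wsuppP HF m /HF /eqP.
Qed.

End Grading.
Arguments gsupp : simpl never.
Arguments gfilt : simpl never.

Lemma xcomp_sum (k : fieldType) d (F : {mpoly k[d + d.+1]}) :
  exists K, F = \sum_(b < K) gfilt (xT_grading k d) (fun X _ => X == b) F.
Proof.
exists (\max_(m <- msupp F) xdeg m).+1; apply/mpolyP => m; rewrite raddf_sum /=.
under eq_bigr => b _ do rewrite mcoeff_wfilt.
case: (boolP (m \in msupp F)) => mF; last first.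
  by rewrite memN_msupp_eq0 // big1 // => b _; rewrite if_same.
have lt : (xdeg m < (\max_(m <- msupp F) xdeg m).+1)%N.
  by rewrite ltnS; apply: leq_bigmax_seq.
rewrite (bigD1 (Ordinal lt)) //= eqxx big1 ?addr0 // => b bm.
by case: eqP => // E; case/eqP: bm; apply: val_inj.
Qed.

(** * The Rees ideal: primality, grading and saturation *)

Section ReesIdeal.
Variables (k : fieldType) (e n : nat).
Local Notation d := e.+1.
Local Notation R := {mpoly k[d]}.
Local Notation S := {mpoly k[d + d.+1]}.
Variables (alpha : 'rV[R]_(d.+1)) (phi : 'M[R]_(d.+1, d)).
Local Notation x := (@xS k d).
Local Notation RtoS := (@RtoS k d).
Local Notation L := (Tphi phi).
Local Notation gr := (xT_grading k d).
Local Notation whomog := (whomog gr).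
Local Notation xhom a := (gsupp gr (fun X _ => X == a)).
Local Notation A := (rees_ideal alpha).
Hypothesis alpha0 : alpha != 0.
Hypothesis alpha_phi : alpha *m phi = 0.
Hypothesis exact_alpha :
  forall v : 'cV_(d.+1), alpha *m v = 0 -> exists w : 'cV_d, v = phi *m w.
Hypothesis phi_inj : forall w : 'cV_d, phi *m w = 0 -> w = 0.
Hypothesis phi_lin : forall i (j : 'I_d), (j < e)%N -> homog_of 1 (phi i j).
Hypothesis phi_last : forall i (j : 'I_d), j = e :> nat -> homog_of n (phi i j).
Hypothesis G_d : G_cond (ideal_gen (fun j => alpha 0 j)) d.

Lemma L_lin j : j != ord_max -> whomog 1 1 (L j).
Proof.
move=> jl; apply: Tphi_whomog => i; apply: phi_lin.
by rewrite ltn_neqAle -ltnS ltn_ord andbT; apply: contra jl => /eqP E; apply/eqP/val_inj.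
Qed.

Lemma L_last : whomog n 1 (L ord_max).
Proof. by apply: Tphi_whomog => i; apply: phi_last. Qed.

Lemma L_prime cs : uniq cs -> (size cs < d)%N -> forall F G,
  inI (map L cs) (F * G) -> inI (map L cs) F \/ inI (map L cs) G.
Proof.
move=> U szcs F G /inI_Tphi; rewrite rmorphM /=.
by move=> /(lin_prime_proper exact_alpha G_d phi_inj U szcs) [H|H]; [left|right];
  apply/inI_Tphi.
Qed.

Lemma L_notin c cs : c \notin cs -> ~ inI (map L cs) (L c).
Proof. by move=> ccs /inI_Tphi; rewrite toSR_Tphi; exact: linform_notin. Qed.

Lemma inI_Lall F : inI (Lall L) F <-> inI (map L (enum 'I_d)) F.
Proof.
split; apply: inI_subset => _ /mapP [j _ ->]; apply: map_f; rewrite ?mem_enum //.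
by rewrite inE mem_filter mem_enum andbT; case: eqP.
Qed.

Lemma A_ideal : is_ideal A.
Proof.
split; first by apply/rees_ideal_map; rewrite !rmorph0.
split=> [a b /rees_ideal_map Ha /rees_ideal_map Hb|r a /rees_ideal_map Ha]; apply/rees_ideal_map.
  by rewrite !rmorphD /= Ha Hb addr0.
by rewrite !rmorphM /= Ha mulr0.
Qed.

Lemma A_prime F G : A (F * G) -> A F \/ A G.
Proof.
move=> /rees_ideal_map; rewrite !rmorphM /= => /eqP; rewrite mulf_eq0.
by case/orP => /eqP H; [left|right]; apply/rees_ideal_map.
Qed.

Lemma A_Lall F : inI (Lall L) F -> A F.
Proof.
by move=> /inI_Lall /inI_Tphi H; apply/rees_ideal_map; exact: rees_linJall H.
Qed.

Lemma A_L j : A (L j).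
Proof. by apply: A_Lall; apply/inI_Lall; apply: mem_inI; apply: map_f; rewrite mem_enum. Qed.

Lemma A_RtoS r : A (RtoS r) -> r = 0.
Proof.
move=> /rees_ideal_map; rewrite toSR_RtoS rees_mapC => /eqP.
by rewrite polyC_eq0 => /eqP.
Qed.

Lemma A_x j : ~ A (x j).
Proof. by rewrite -RtoSX => /A_RtoS /eqP; rewrite -msupp_eq0 msuppX. Qed.

Lemma A_expr F l : A (F ^+ l) -> A F.
Proof.
elim: l => [|l IH]; last by rewrite exprS => /A_prime [].
by rewrite expr0 -(rmorph1 RtoS) => /A_RtoS /eqP; rewrite oner_eq0.
Qed.

Lemma Lall_whomog g : g \in Lall L -> exists a b, whomog a b g.
Proof.
move=> /mapP [j _ ->]; case: (eqVneq j ord_max) => [->|/L_lin H].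
  by exists n, 1%N; exact: L_last.
by exists 1%N, 1%N.
Qed.

(** The hypotheses give homogeneity of [phi] rather than of alpha, so the grading of A is obtained
    from its description as the delta-torsion modulo (L), where the minor delta is homogeneous
    because the columns of [phi] are. *)
Lemma A_xcomp b F : A F -> A (gfilt gr (fun X _ => X == b) F).
Proof.
have [f [det0 Hf]] := rees_torsion phi_inj alpha0 alpha_phi.
move=> /rees_ideal_map /Hf [l].
set delta := \det _ in det0 *.
have [N HN] : exists N, whomog N 0 (RtoS delta).
  exists (\sum_(j < d) if (j < e)%N then 1 else n)%N.
  have -> : RtoS delta = \det (map_mx RtoS (rowsub f phi)) by rewrite det_map_mx.
  have := @whomog_det _ gr _ (map_mx RtoS (rowsub f phi))
    (fun j : 'I_d => if (j < e)%N then 1%N else n) (fun _ => 0%N).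
  rewrite big1_eq; apply=> i j; rewrite !mxE; apply: RtoS_whomog.
  case: ifP => [/phi_lin //|je]; apply: phi_last.
  by apply/eqP; rewrite eqn_leq -ltnS ltn_ord leqNgt je.
have := whomogX l HN; rewrite muln0 -rmorphXn /= => Hl H.
have {}H : inI (Lall L) (RtoS (delta ^+ l) * F).
  by apply/inI_Lall/inI_Tphi; rewrite rmorphM /= toSR_RtoS.
have := inI_wfilt (fun X _ => X == (l * N + b)%N) Lall_whomog H.
rewrite (gfiltM _ _ Hl).
have -> : (fun X (_ : nat) => (l * N + X == l * N + b)%N) = (fun X _ => X == b).
  by apply: boolp.funext => X; apply: boolp.funext => _; rewrite eqn_add2l.
move=> /A_Lall /A_prime [] //; rewrite rmorphXn => /A_expr /A_RtoS E.
by rewrite E eqxx in det0.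
Qed.

(** A nonzero polynomial in x_j alone annihilates F modulo (L). As F and the generators are
    homogeneous, so does its leading term, a unit times a power of x_j. *)
Lemma A_sat a F : xhom a F -> A F -> forall j, exists M, inI (Lall L) (x j ^+ M * F).
Proof.
move=> aF /rees_ideal_map HF j.
have [p [pj p0 Hp]] := rees_saturated exact_alpha G_d phi_inj alpha0 alpha_phi HF j.
have {Hp} H : inI (Lall L) (RtoS p * F).
  by apply/inI_Lall/inI_Tphi; rewrite rmorphM /= toSR_RtoS.
pose q := asuni j p; have qp : q.['X_j] = p by exact: asuniK.
have q0 : q != 0 by apply: contraNneq p0 => q0; rewrite -qp q0 horner0.
have qC l : exists c, q`_l = c%:MP.
  by apply: only_vars0; apply: asuni_coef; rewrite setU0.
exists (size q).-1.
have hom l : whomog l 0 (RtoS q`_l * x j ^+ l).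
  have [c ->] := qC l; rewrite RtoSC.
  have := whomogM (whomogC _ c) (whomogX l (x_whomog k j)).
  by rewrite muln0 muln1.
have := inI_wfilt (fun X _ => X == (size q).-1 + a)%N Lall_whomog H.
rewrite -{1}qp horner_coef rmorph_sum mulr_suml.
rewrite (big_morph _ (gfiltD gr _) (gfilt0 gr _)).
have lt : ((size q).-1 < size q)%N by rewrite prednK // size_poly_gt0.
rewrite (bigD1 (Ordinal lt)) //= big1 ?addr0 => [|l /eqP lq].
  rewrite rmorphM rmorphXn /= RtoSX (gfiltM _ _ (hom _)) gfilt_id; last first.
    by apply: gsupp_sub aF => X _ /eqP ->.
  have [c Ec] := qC (size q).-1; rewrite Ec RtoSC -mulrA => H1.
  have E1 : (c^-1)%:MP * c%:MP = 1 :> S.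
    rewrite -mpolyCM mulVf ?mpolyC1 //.
    by apply: contraNneq q0 => c0; rewrite -lead_coef_eq0 /lead_coef Ec c0 mpolyC0.
  have := @inIM _ (Lall L) (c^-1)%:MP _ H1.
  by have -> : (c^-1)%:MP * (c%:MP * (x j ^+ (size q).-1 * F)) = x j ^+ (size q).-1 * F
    by rewrite (mulrA (c^-1)%:MP c%:MP) E1 mul1r.
rewrite rmorphM rmorphXn /= RtoSX (gfiltM _ _ (hom _)) gfilt_out ?mulr0 //.
apply: gsupp_sub aF => X _ /eqP ->; rewrite eqn_add2r.
by apply/eqP => E; apply: lq; apply: val_inj.
Qed.

End ReesIdeal.

(** * Iterated Jacobian duals *)

Section PlusIdeal.
Variable A : comNzRingType.
Implicit Types P Q : A -> Prop.

Lemma plusIl P Q a : P a -> plusI P Q a.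
Proof. by move=> Pa; apply: span_gen; left. Qed.
Lemma plusIr P Q a : Q a -> plusI P Q a.
Proof. by move=> Qa; apply: span_gen; right. Qed.

Lemma plusI_split P Q a : is_ideal P -> is_ideal Q -> plusI P Q a ->
  exists2 p, P p & Q (a - p).
Proof.
move=> [P0 [PD PM]] [Q0 [QD QM]].
apply: (span_ind (P := fun a => exists2 p, P p & Q (a - p))) => [|g [Pg|Qg]]; last by exists 0; rewrite ?subr0.
- split; first by exists 0; rewrite ?subr0.
  split=> [u v [p Pp Qp] [q Pq Qq]|r u [p Pp Qp]].
    by exists (p + q); [exact: PD|rewrite opprD addrACA; exact: QD].
  by exists (r * p); [exact: PM|rewrite -mulrBr; exact: QM].
- by exists g; rewrite ?subrr.
Qed.

End PlusIdeal.

Section JacobianDuals.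
Variables (k : fieldType) (e n : nat).
Local Notation d := e.+1.
Local Notation R := {mpoly k[d]}.
Local Notation S := {mpoly k[d + d.+1]}.
Variables (alpha : 'rV[R]_(d.+1)) (phi : 'M[R]_(d.+1, d)).
Local Notation x := (@xS k d).
Local Notation T := (@TS k d).
Local Notation xs := (map x (enum 'I_d)).
Local Notation L := (Tphi phi).
Local Notation L' := (map L (others e)).
Local Notation gr := (xT_grading k d).
Local Notation whomog := (whomog gr).
Local Notation xhom a := (gsupp gr (fun X _ => X == a)).
Local Notation A := (rees_ideal alpha).
Hypothesis alpha0 : alpha != 0.
Hypothesis alpha_phi : alpha *m phi = 0.
Hypothesis exact_alpha :
  forall v : 'cV_(d.+1), alpha *m v = 0 -> exists w : 'cV_d, v = phi *m w.
Hypothesis phi_inj : forall w : 'cV_d, phi *m w = 0 -> w = 0.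
Hypothesis phi_lin : forall i (j : 'I_d), (j < e)%N -> homog_of 1 (phi i j).
Hypothesis phi_last : forall i (j : 'I_d), j = e :> nat -> homog_of n (phi i j).
Hypothesis G_d : G_cond (ideal_gen (fun j => alpha 0 j)) d.
Hypothesis n_gt0 : (0 < n)%N.

Let x_hom := x_whomog k (d := d).
Let xneq0 := x_neq0 k (d := d).
Let x_reg := x_regular k d.
Let x_span := @x_spans k d.
Let const_unit := @whomog00_unit k d.
Let Llin := L_lin phi_lin.
Let Llast := L_last phi_last.
Let Lprime := L_prime exact_alpha phi_inj G_d.
Let Lnotin := L_notin phi_inj.
Let Aideal := A_ideal alpha.
Let Aprime := @A_prime _ _ alpha.
Let AL := A_L alpha_phi.
Let Ax := @A_x _ _ alpha.
Let Asat := A_sat alpha0 alpha_phi exact_alpha phi_inj phi_lin phi_last G_d.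
Let Axcomp := A_xcomp alpha0 alpha_phi phi_inj phi_lin phi_last.

Lemma A_sum (I : Type) (r : seq I) (P : pred I) (F : I -> S) :
  (forall i, P i -> A (F i)) -> A (\sum_(i <- r | P i) F i).
Proof. by have [A0 [AD _]] := Aideal; move=> H; apply: (big_ind A). Qed.

Lemma Lideal_Lall F : Lideal phi F <-> inI (Lall L) F.
Proof.
split=> [/ideal_genP [u ->]|/inI_Lall /inI_sumP [h [_ ->]]].
  apply/inI_Lall; apply: inI_sum => j _; apply: inIMr; apply: mem_inI.
  by apply: map_f; rewrite mem_enum.
by apply/ideal_genP; exists h; apply: eq_bigr => j _; rewrite mulrC.
Qed.

Lemma xideal_xs F : xideal F <-> inI xs F.
Proof.
split=> [/ideal_genP [u ->]|/inI_sumP [h [_ ->]]].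
  apply: inI_sum => j _; apply: inIMr; apply: mem_inI.
  by apply: map_f; rewrite mem_enum.
by apply/ideal_genP; exists h; apply: eq_bigr => j _; rewrite mulrC.
Qed.

Lemma A_high (a : nat) F : A F -> xhom a F -> (n <= a)%N -> Lideal phi F.
Proof.
move=> AF aF na; apply/Lideal_Lall.
exact: (A_high_degree n_gt0 x_hom x_reg x_span Llin Llast Lprime Lnotin Asat AF aF na).
Qed.

(** A monomial of degree n lifts every x-component to degree at least n, where A and (L) agree.
    Conversely, a power of one variable cancels modulo the prime A. *)
Lemma A_colon : eqI A (colonI (Lideal phi) (@xpow k d n)).
Proof.
move=> F; split=> [AF q|HF]; last first.
  have /HF : @xpow k d n (x ord0 ^+ n).
    apply: span_gen; exists (fun _ => ord0).
    by rewrite big_const_ord iter_mulr_1.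
  move=> /Lideal_Lall /(A_Lall alpha_phi) /Aprime [//|].
  by move=> /A_expr /Ax.
have [L0 [LD LM]] := span_ideal (fun q => exists i, q = L i).
apply: (span_ind (P := fun q => Lideal phi (F * q))) => [|_ [g ->]].
  split; first by rewrite mulr0.
  by split=> [u v|r u]; rewrite ?mulrDr 1?mulrCA; [exact: LD|exact: LM].
have [K ->] := xcomp_sum F; rewrite mulr_suml.
apply: (big_ind (Lideal phi)) => // b _.
set Fb := gfilt _ _ F; set q0 := \prod_l _.
have q0_hom : whomog n 0 q0.
  have := @whomog_prod _ gr _ (index_enum 'I_n) (fun _ => 1%N) (fun _ => 0%N) _ (fun l => x_hom (g l)).
  by rewrite sum_nat_const card_ord muln1 big1_eq.
apply: (@A_high (b + n)%N); last by rewrite leq_addl.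
  by rewrite mulrC; apply: (Aideal.2.2); exact: Axcomp.
apply: (gsuppM (gsupp_filt gr _ F) q0_hom) => X _ X' _ /eqP -> /andP [/eqP -> _].
by rewrite eqxx.
Qed.

Lemma whomog_decompose a b F : whomog a.+1 b F ->
  exists u : 'I_d -> S, (forall i, whomog a b (u i)) /\ F = \sum_i x i * u i.
Proof.
move=> aF; have /x_span /inI_sumP [h [_ E]] : gsupp gr (fun X _ => 0 < X)%N F.
  by apply: gsupp_sub aF => X Y /andP [/eqP ->].
exists (fun i => gfilt gr (fun X Y => (1 + X == a.+1)%N && (0 + Y == b)%N) (h i)); split.
  by move=> i; apply: gsupp_sub (gsupp_filt gr _ _) => X Y; rewrite add1n eqSS.
rewrite -[LHS](gfilt_id aF) [in LHS]E.
rewrite (big_morph _ (gfiltD gr _) (gfilt0 gr _)).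
by apply: eq_bigr => i _; rewrite mulrC (gfiltM _ _ (x_hom i)).
Qed.

Lemma L_neq0 j : L j != 0.
Proof. by apply/eqP => /(@Lnotin j [::]); apply. Qed.

Lemma jacobian_dual_exists : exists B : 'M[S]_d,
  (forall j, \sum_r x r * B r j = L j) /\
  (forall r j, j != ord_max -> whomog 0 1 (B r j)).
Proof.
have /boolp.choice [u Hu] : forall j, exists u : 'I_d -> S,
    (j != ord_max -> forall r, whomog 0 1 (u r)) /\ L j = \sum_i x i * u i.
  move=> j; case: (eqVneq j ord_max) => [->|/Llin /whomog_decompose [u [Hu E]]]; last by exists u.
  have [u [_ E]] : exists u : 'I_d -> S, (forall i, whomog n.-1 1 (u i)) /\
      L ord_max = \sum_i x i * u i by apply: whomog_decompose; rewrite prednK.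
  by exists u.
exists (\matrix_(r, j) u j r); split=> [j|r j jl].
  by rewrite (Hu j).2; apply: eq_bigr => r _; rewrite mxE.
by rewrite mxE; apply: (Hu j).1.
Qed.

Section SpecialFiber.
Variable B : 'M[S]_d.
Hypothesis B_L : forall j, \sum_r x r * B r j = L j.
Hypothesis B_lin : forall r j, j != ord_max -> whomog 0 1 (B r j).

Definition sigma : S -> S := mhom (@mpolyC (d + d.+1) k) (xT_cases (dlast B) T).
HB.instance Definition _ := GRing.RMorphism.copy sigma
  (mhom (@mpolyC (d + d.+1) k) (xT_cases (dlast B) T)).

Lemma sigmaC c : sigma c%:MP = c%:MP. Proof. exact: mhomC. Qed.
Lemma sigma_x i : sigma (x i) = dlast B i.
Proof. by rewrite /sigma mhomU xT_casesx. Qed.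
Lemma sigma_T j : sigma (T j) = T j.
Proof. by rewrite /sigma mhomU xT_casesT. Qed.

Lemma sigma_id F : xhom 0 F -> sigma F = F.
Proof.
move=> /TpartK <-; have E : sigma \o (@TtoS k d) =1 @TtoS k d.
  by apply: mpoly_rmorph_eq => [c|i] /=; rewrite ?TtoSC ?sigmaC // TtoSX sigma_T.
exact: E.
Qed.

Lemma sigma_hom0 F : xhom 0 (sigma F).
Proof.
apply: (rmorph_closed (P := fun F => xhom 0 F)) => [u v Hu Hv|u v Hu Hv|c|i] /=.
- exact: (gsuppD Hu Hv).
- by apply: (gsuppM Hu Hv) => X _ X' _ /eqP -> /eqP ->.
- by rewrite sigmaC; apply: gsupp_sub (whomogC _ c) => X Y /andP [].
elim/xT_ind: i => j.
  by rewrite sigma_x; apply: gsupp_sub (dlast_hom B_lin j) => X Y /andP [].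
by rewrite sigma_T; apply: gsupp_sub (T_whomog k j) => X Y /andP [].
Qed.

(** Each x_i becomes a minor of T-degree e; for the last form this gives ne + 1, the degree of f. *)
Lemma sigma_whomog a b F : whomog a b F -> whomog 0 (a * e + b)%N (sigma F).
Proof.
move=> /bihomP H.
apply: (rmorph_whomog (a := fun _ => 0%N) (b := xT_cases (fun _ => e) (fun _ => 1%N))) => [c|i|m /H [<- <-]].
- by rewrite /= sigmaC; exact: whomogC.
- elim/xT_ind: i => j; rewrite ?xT_casesx ?xT_casesT /=.
    by rewrite sigma_x; exact: dlast_hom.
  by rewrite sigma_T; exact: T_whomog.
split; first by rewrite big1 // => i _; rewrite muln0.
rewrite sum_xT -big_distrl /=; congr (_ + _)%N.
by apply: eq_bigr => j _; rewrite muln1.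
Qed.

Let f := sigma (L ord_max).

Lemma dlast_neq0 : exists r, dlast B r != 0.
Proof.
exact: (dlast_exists x_hom Lprime Lnotin B_L B_lin (@TtoSK k d) (@TtoS_xhom k d) (@TpartK k d)).
Qed.

Lemma special_fiber : exists f : {mpoly k[d.+1]},
     f != 0 /\ homog_of (n * (d - 1) + 1)%N f /\
     forall q : {mpoly k[d.+1]},
       plusI A (@xideal k d) (TtoS q) <-> ideal_span (fun p => p = f) q.
Proof.
have f_hom : whomog 0 (n * e + 1)%N f by apply: sigma_whomog; exact: Llast.
have Tf : TtoS (Tpart f) = f by apply: TpartK; exact: sigma_hom0.
exists (Tpart f); split.
  have f0 : f != 0 := f_neq0 x_hom xneq0 x_span Llin Llast Lprime Lnotin B_L B_lin
    dlast_neq0 sigma_x sigma_id.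
  by apply: contraNneq f0 => E; rewrite -Tf E rmorph0.
split; first by rewrite subSS subn0; exact: Tpart_homog f_hom.
move=> q; split.
  move=> /plusI_split [||a Aa /xideal_xs Hxs].
  - exact: Aideal.
  - exact: span_ideal.
  (* Since q - a lies in (x), the component of a in x-degree 0 is q itself. *)
  have := Axcomp 0 Aa.
  have := xs_filt0 x_hom Hxs; rewrite gfiltB (gfilt_id (TtoS_xhom q)) => /eqP.
  rewrite subr_eq0 => /eqP <- Aq.
  have [c _ E] := A_degree0 n_gt0 x_hom xneq0 x_reg x_span const_unit Llin Llast Lprime Lnotin
    B_L B_lin dlast_neq0 sigma_x sigma_id sigma_hom0 Asat Aq (TtoS_xhom q).
  have -> : q = Tpart c * Tpart f by rewrite -[LHS]TtoSK E rmorphM mulrC.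
  by exists [:: (Tpart c, Tpart f)]; split=> [p|]; [rewrite inE => /eqP ->|rewrite big_seq1].
move=> Hq; apply: plusIl; move: Hq.
have [A0 [AD AM]] := Aideal.
apply: (span_ind (P := fun q => A (TtoS q))) => [|_ ->].
  split; first by rewrite rmorph0.
  by split=> [u v|r u]; rewrite ?rmorphD ?rmorphM /=; [exact: AD|exact: AM].
rewrite Tf.
exact: (A_f x_hom xneq0 x_span Llin Llast Lprime B_L sigma_x sigma_id Aideal Aprime AL Ax).
Qed.

Section IteratedDuals.
Variables (c : nat -> nat) (Bc : 'I_d -> nat -> S).
Hypothesis Bc_B : forall r (j : 'I_d), Bc r j = B r j.
Hypothesis JD : jacobian_duals phi n c Bc.
Local Notation minors i := (minors_ideal (c i) Bc).

Lemma cols_mono i j : (1 <= i)%N -> (i <= j)%N -> (j <= n)%N -> (c i <= c j)%N.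
Proof.
move=> i0; elim: j => [|j IH]; first by rewrite leqn0 => /eqP ->.
rewrite leq_eqVlt => /orP [/eqP -> //|]; rewrite ltnS => ij jn.
apply: leq_trans (IH ij (ltnW jn)) _.
have [_ [_ [_ /(_ j.+1) []]]] := JD; last by [].
by rewrite jn !ltnS (leq_trans i0 ij).
Qed.

Lemma minors_mono i j F : (1 <= i)%N -> (i <= j)%N -> (j <= n)%N ->
  minors i F -> minors j F.
Proof.
move=> i0 ij jn; apply: span_ind => [|_ [g [g_inj [gc ->]]]]; first exact: span_ideal.
apply: span_gen; exists g; split=> //; split=> // s.
exact: leq_trans (gc s) (cols_mono i0 ij jn).
Qed.

(** By Cramer's rule, x_0 times a minor is a combination of the products of x with its columns; x_0
    cancels modulo the prime A. *)
Lemma minors_in_A m F : (forall j, (j < m)%N -> A (xB Bc j)) -> minors_ideal m Bc F -> A F.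
Proof.
move=> HA; apply: span_ind => [|_ [g [_ [gm ->]]]]; first exact: Aideal.
set M := \matrix_(r, s) _.
suff : A (x ord0 * \det M) by case/Aprime => [/Ax|].
pose X := \row_r x r.
have -> : x ord0 * \det M = (X *m (M *m \adj M)) 0 ord0.
  by rewrite mul_mx_adj mul_mx_scalar !mxE mulrC.
rewrite mulmxA mxE; apply: A_sum => s _; rewrite mulrC; apply: (Aideal.2.2).
rewrite mxE (eq_bigr (fun r => x r * Bc r (g s))); last by move=> r _; rewrite !mxE.
exact: HA.
Qed.

Lemma plusI_sub_A P Q F : subI P A -> subI Q A -> plusI P Q F -> A F.
Proof.
move=> PA QA; apply: span_ind => [|g [/PA|/QA] //]; exact: Aideal.
Qed.

Lemma cols_in_A i : (1 <= i)%N -> (i <= n)%N -> forall j, (j < c i)%N -> A (xB Bc j).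
Proof.
have [c1 [BL [_ step]]] := JD.
elim: i => // i IH _ iN j; case: (posnP i) => [->|i0].
  by rewrite c1 => jd; rewrite (BL (Ordinal jd)); exact: AL.
have {}IH := IH i0 (ltnW iN).
have [_ [_ E]] := step i.+1 (introT andP (conj i0 iN)).
case: (ltnP j (c i)) => [/IH //|ij ji].
have /E : plusI (Lcols (c i) Bc) (Lnew (c i) (c i.+1) Bc) (xB Bc j).
  by apply: plusIr; apply: span_gen; exists j; rewrite ij ji.
apply: plusI_sub_A => F; last by case=> /(minors_in_A IH).
by apply: span_ind => [|_ [l [lc ->]]]; [exact: Aideal|exact: IH].
Qed.

Lemma L'_Lideal F : inI L' F -> Lideal phi F.
Proof. by move=> H; apply/Lideal_Lall/inI_cons. Qed.

Lemma detlast_cols m j : (d <= m)%N -> (j < m)%N -> (e <= j)%N ->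
  minors_ideal m Bc (detlast B (fun r => Bc r j)).
Proof.
move=> dm jm ej; apply: span_gen.
(* Columns 0, ..., e-1 followed by column j; the bound [e <= j] keeps the choice injective. *)
exists (fun s : 'I_d => if s == ord_max then j else s : nat); split; last split.
- move=> s t; case: eqP => [->|/eqP sl]; case: eqP => [->|/eqP tl] // E.
  + have := ltn_ord t; rewrite -E ltnS => je; case/eqP: tl; apply: val_inj.
    by apply/eqP; rewrite eqn_leq -ltnS ltn_ord /= -E.
  + have := ltn_ord s; rewrite E ltnS => je; case/eqP: sl; apply: val_inj.
    by apply/eqP; rewrite eqn_leq -ltnS ltn_ord /= E.
  + exact: val_inj.
- by move=> s; case: eqP => // _; exact: leq_trans (ltn_ord s) dm.
rewrite detlastE; congr (\det _); apply/matrixP => r s; rewrite !mxE.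
by case: eqP.
Qed.

Lemma detlast_Lcols m u : (d <= m)%N ->
  Lcols m Bc (\sum_r x r * u r) -> plusI (Lideal phi) (minors_ideal m Bc) (detlast B u).
Proof.
move=> dm.
suff H G : Lcols m Bc G -> exists2 v : 'I_d -> S, G = \sum_r x r * v r &
    minors_ideal m Bc (detlast B v).
  move=> /H [v E Mv]; rewrite -(subrK (detlast B v) (detlast B u)).
  have [_ [PD _]] := span_ideal (fun q => Lideal phi q \/ minors_ideal m Bc q).
  apply: PD; last exact: plusIr.
  apply: plusIl; apply: L'_Lideal; rewrite detlastB.
  apply: (detlast_syzygy x_hom xneq0 Llin Lprime B_L).
  under eq_bigr => r _ do rewrite mulrBr.
  by rewrite sumrB E subrr; exact: inI0.
have [M0 [MD MM]] := span_ideal (fun q => exists f : 'I_d -> nat, injective f /\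
  (forall s, (f s < m)%N) /\ q = \det (\matrix_(r, s) Bc r (f s))).
apply: (span_ind (P := fun G => exists2 v : 'I_d -> S, G = \sum_r x r * v r &
    minors_ideal m Bc (detlast B v))) => [|_ [j [jm ->]]].
  split.
    exists (fun _ => 0); first by rewrite big1 // => r _; rewrite mulr0.
    by rewrite /detlast big1 // => r _; rewrite mul0r.
  split=> [a b [v -> Mv] [w -> Mw]|r0 a [v -> Mv]].
    exists (fun r => v r + w r).
      by rewrite -big_split; apply: eq_bigr => r _; rewrite mulrDr.
    have -> : detlast B (fun r => v r + w r) = detlast B v + detlast B w.
      by rewrite -big_split; apply: eq_bigr => r _; rewrite mulrDl.
    exact: MD.
  exists (fun r => r0 * v r).
    by rewrite mulr_sumr; apply: eq_bigr => r _; rewrite mulrCA.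
  have -> : detlast B (fun r => r0 * v r) = r0 * detlast B v.
    by rewrite mulr_sumr; apply: eq_bigr => r _; rewrite mulrA.
  exact: MM.
exists (fun r => Bc r j) => //; case: (leqP e j) => [ej|je]; first exact: detlast_cols.
have jl : Ordinal (ltnW je : (j < d)%N) != ord_max by rewrite -val_eqE /= ltn_eqF.
have -> : detlast B (fun r => Bc r j) = detlast B (B ^~ (Ordinal (ltnW je : (j < d)%N))).
  by apply: eq_bigr => r _; rewrite -Bc_B.
by rewrite detlast_col.
Qed.

Lemma minors_generator i : (1 <= i)%N -> (i <= n)%N ->
  exists F, [/\ xhom (n - i)%N F, sigma F = f & plusI (Lideal phi) (minors i) F].
Proof.
have [c1 [BL [_ step]]] := JD.
have xhom_L : xhom n (L ord_max) by apply: gsupp_sub Llast => X Y /andP [].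
have lower a F : xhom a.+1 F -> sigma F = f ->
    exists u, [/\ F = \sum_i x i * u i, xhom a (detlast B u) & sigma (detlast B u) = f].
  exact: (lower_degree x_hom x_span B_lin sigma_x sigma_id).
have Lcols_L m F : (d <= m)%N -> Lideal phi F -> Lcols m Bc F.
  move=> dm; apply: span_ind => [|_ [j ->]]; first exact: span_ideal.
  by apply: span_gen; exists j; rewrite BL; split=> //; exact: leq_trans (ltn_ord j) dm.
elim: i => // i IH _ iN; case: (posnP i) => [i0|i0].
  have [|u [E u_hom u_f]] := lower n.-1 (L ord_max) _ erefl; first by rewrite prednK.
  exists (detlast B u); rewrite i0 subn1; split=> //.
  rewrite c1; apply: detlast_Lcols => //; rewrite -E; apply: Lcols_L => //.
  by apply: span_gen; exists ord_max.
have [F [F_hom F_f MF]] := IH i0 (ltnW iN).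
have [|u [E u_hom u_f]] := lower (n - i.+1)%N F _ F_f; first by rewrite -subSn.
exists (detlast B u); split=> //.
have dc j : (1 <= j)%N -> (j <= n)%N -> (d <= c j)%N.
  by move=> j0 jn; rewrite -{1}c1; exact: cols_mono.
apply: detlast_Lcols; first exact: dc.
(* F has positive x-degree and G lies in (L), so both are in (x). Hence F - G is in (x) and in the
   ideal of minors, which is what the columns added in the next dual account for. *)
rewrite -E; have [G LG MG] := plusI_split (span_ideal _) (span_ideal _) MF.
have xG : xideal G.
  apply/xideal_xs; move/Lideal_Lall/inI_Lall: LG.
  by apply: inI_sub => _ /mapP [j _ ->]; exact: (L_in_xs B_L).
have [_ [_ EI]] := step i.+1 (introT andP (conj i0 iN)).
have : plusI (Lcols (c i) Bc) (capI (minors i) (@xideal k d)) F.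
  rewrite -(subrK G F); have [_ [PD _]] := span_ideal (fun q => Lcols (c i) Bc q \/ capI (minors i) (@xideal k d) q).
  apply: PD; last by apply: plusIl; apply: Lcols_L LG; apply: dc => //; exact: ltnW.
  apply: plusIr; split=> //; apply/xideal_xs; apply: inIB; last exact/xideal_xs.
  rewrite E; apply: inI_sum => r _; apply: inIMr; apply: mem_inI; apply: map_f.
  by rewrite mem_enum.
move/EI; apply: span_ind => [|g [|]]; first exact: span_ideal.
  apply: span_ind => [|_ [j [jc ->]]]; first exact: span_ideal.
  by apply: span_gen; exists j; split=> //; apply: leq_trans jc (cols_mono _ _ _).
apply: span_ind => [|_ [j [/andP [_ jc] ->]]]; first exact: span_ideal.
by apply: span_gen; exists j.
Qed.

Lemma A_minors : eqI A (plusI (Lideal phi) (minors n)).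
Proof.
move=> F; split; last first.
  apply: plusI_sub_A => G; first by move=> /Lideal_Lall /(A_Lall alpha_phi).
  exact: minors_in_A (cols_in_A n_gt0 (leqnn n)).
move=> AF; have [P0 [PD PM]] := span_ideal (fun q => Lideal phi q \/ minors n q).
have [K ->] := xcomp_sum F; apply: (big_ind (plusI (Lideal phi) (minors n))) => // b _.
have := Axcomp b AF; have := gsupp_filt gr (fun X _ => X == b) F.
move: (gfilt _ _ F) => G G_hom AG.
case: (leqP n b) => [nb|bn]; first by apply: plusIl; exact: A_high AG G_hom nb.
have [||F0 [F0_hom F0_f MF0]] := @minors_generator (n - b)%N; rewrite ?subn_gt0 ?leq_subr //.
rewrite subKn ?(ltnW bn) // in F0_hom.
have [H HG] := A_low_degree n_gt0 x_hom xneq0 x_reg x_span const_unit Llin Llast Lprime Lnotin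
    B_L B_lin dlast_neq0 sigma_x sigma_id sigma_hom0 Asat AG G_hom F0_hom F0_f.
rewrite -(subrK (H * F0) G); apply: (PD); first by apply: plusIl; exact: L'_Lideal.
apply: (PM); move: MF0; apply: span_ind => // g [Lg|Mg]; first exact: plusIl.
by apply: plusIr; apply: minors_mono Mg; rewrite ?subn_gt0 ?leq_subr.
Qed.

End IteratedDuals.
End SpecialFiber.

End JacobianDuals.

Lemma whomog_inj (k : fieldType) d a b a' b' (F : {mpoly k[d + d.+1]}) : F != 0 ->
  whomog (xT_grading k d) a b F -> whomog (xT_grading k d) a' b' F -> a = a' /\ b = b'.
Proof.
rewrite -msupp_eq0 => F0 /bihomP Hab /bihomP Hab'.
case E: (msupp F) F0 => [//|m s] _.
have mF : m \in msupp F by rewrite E mem_head.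
by have [<- <-] := Hab m mF; exact: Hab' mF.
Qed.

Theorem theorem5p3 (k : fieldType) (d n : nat)
    (alpha : 'rV[{mpoly k[d]}]_(d.+1)) (phi : 'M[{mpoly k[d]}]_(d.+1, d)) :
  (1 <= n)%N ->
  (* phi is a Hilbert-Burch matrix of I = (alpha_1..alpha_m), m = d+1:
     0 -> R^(m-1) --phi--> R^m --alpha--> I -> 0 is exact *)
  alpha *m phi = 0 ->
  (forall v : 'cV_(d.+1), alpha *m v = 0 -> exists w : 'cV_d, v = phi *m w) ->
  (forall w : 'cV_d, phi *m w = 0 -> w = 0) ->
  (* columns v_1..v_{m-2} linear, v_{m-1} of degree n *)
  (forall (i : 'I_d.+1) (j : 'I_d), (j < d.-1)%N -> homog_of 1 (phi i j)) ->
  (forall (i : 'I_d.+1) (j : 'I_d), j = d.-1 :> nat -> homog_of n (phi i j)) ->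
  (* I is perfect of height 2 (perfection given by the resolution above) *)
  ideal_height_eq (ideal_gen (fun j => alpha 0 j)) 2 ->
  G_cond (ideal_gen (fun j => alpha 0 j)) d ->
  mu_eq (ideal_gen (fun j => alpha 0 j)) d.+1 ->
  (forall (c : nat -> nat) (B : 'I_d -> nat -> Sr k d),
     jacobian_duals phi n c B ->
     eqI (rees_ideal alpha) (plusI (Lideal phi) (minors_ideal (c n) B)) /\
     eqI (rees_ideal alpha) (colonI (Lideal phi) (@xpow k d n))) /\
  (* F(I) = S/(A + (x)S) = k[T]/(f) via the natural map k[T] -> F(I) *)
  (exists f : {mpoly k[d.+1]},
     f != 0 /\ homog_of (n * (d - 1) + 1) f /\
     forall q : {mpoly k[d.+1]},
       plusI (rees_ideal alpha) (@xideal k d) (TtoS q) <-> ideal_span (fun p => p = f) q).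
Proof.
move=> n_gt0 alpha_phi exact_alpha phi_inj phi_lin phi_last ht2 G_d mu.
have alpha0 : alpha != 0.
  apply/eqP => a0; have := mu.2 0%N (fun _ => 0) _; rewrite ltn0 => H.
  suff : false by []; apply: H => a; split=> /ideal_genP [u ->].
    by rewrite big_ord0; exact: (span_ideal _).1.
  by rewrite big1 => [|i _]; [exact: (span_ideal _).1|rewrite a0 mxE mul0r].
have d_gt0 : (0 < d)%N by apply: leq_trans (dim_ge_height ht2).
case: d d_gt0 => // e _ in alpha phi alpha_phi exact_alpha phi_inj phi_lin phi_last ht2 G_d mu alpha0 *.
split; last first.
  have [B [B_L B_lin]] := jacobian_dual_exists phi_lin phi_last n_gt0.
  exact: (special_fiber alpha0 alpha_phi exact_alpha phi_inj phi_lin phi_last G_d n_gt0 B_L B_lin).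
move=> c B JD; split; last first.
  exact: (A_colon alpha0 alpha_phi exact_alpha phi_inj phi_lin phi_last G_d n_gt0).
have [c1 [BL [bihomB step]]] := JD.
pose Bm := \matrix_(r, j < e.+1) B r j.
have Bm_L j : \sum_r @xS k e.+1 r * Bm r j = Tphi phi j.
  by rewrite -BL; apply: eq_bigr => r _; rewrite mxE.
have dc : (e.+1 <= c n)%N by rewrite -{1}c1; exact: (cols_mono JD (leqnn 1) n_gt0 (leqnn n)).
apply: (A_minors alpha0 alpha_phi exact_alpha phi_inj phi_lin phi_last G_d n_gt0 Bm_L) JD.
  move=> r j jl; rewrite mxE.
  (* The column has constant bidegree and its product with x is a nonzero form of bidegree (1,1);
     its entries must have bidegree (0,1). *)
  have [a [b Hab]] := bihomB j (leq_trans (ltn_ord j) dc).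
  have H : whomog (xT_grading k e.+1) (1 + a)%N (0 + b)%N (Tphi phi j).
    rewrite -BL; apply: gsupp_sum => l _.
    by apply: (whomogM (x_whomog k l)); apply/bihomP.
  have [] := whomog_inj (L_neq0 phi_inj j) H (L_lin phi_lin jl).
  by rewrite add1n add0n => -[a0] b1; apply/bihomP; move: (Hab r); rewrite a0 b1.
by move=> r j; rewrite mxE.
Qed.
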